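(* Let $n\ge1$, $\sigma\in[0,2]$, $s\ge0$ and $m\in[1,2)$. Assume $(|D|^2u_0,u_1,\theta_0)\in\mathcal{A}_{m,s}(\mathbb{R}^n)$. Then the solution to the Cauchy problem (P) satisfies, for all $t\ge0$, $$\left\||D|^2u(t,\cdot)\right\|_{\dot H^s(\mathbb{R}^n)}+\|u_t(t,\cdot)\|_{\dot H^s(\mathbb{R}^n)}+\|\theta(t,\cdot)\|_{\dot H^s(\mathbb{R}^n)}\lesssim(1+t)^{-\gamma(\sigma,n,m,s)}\left\|\left(|D|^2u_0,u_1,\theta_0\right)\right\|_{\mathcal{A}_{m,s}(\mathbb{R}^n)}.$$
   Context: Cauchy problem (P): for unknown functions $u=u(t,x)$, $\theta=\theta(t,x)$, $$u_{tt}+\Delta^2u+\Delta\theta+(-\Delta)^{\sigma}u_t=0,\qquad \theta_t-\Delta\theta-\Delta u_t=0,\qquad t>0,\ x\in\mathbb{R}^n,$$ with $(u,u_t,\theta)(0,x)=(u_0,u_1,\theta_0)(x)$. $|D|^s$ is the pseudo-differential operator with symbol $|\xi|^s$, $(-\Delta)^\sigma$ has symbol $|\xi|^{2\sigma}$, and $\|f\|_{\dot H^s}=\||D|^sf\|_{L^2}$. The partial Fourier transform $w^{(0)}(t,\xi)$ in $x$ of $(u_t+|D|^2u,u_t-|D|^2u,\theta)^{\mathrm T}$ solves $w^{(0)}_t+(|\xi|^2A_0+|\xi|^{2\sigma}A_1)w^{(0)}=0$ with initial value $(\hat u_1+|\xi|^2\hat u_0,\hat u_1-|\xi|^2\hat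 u_0,\hat\theta_0)^{\mathrm T}$, where $$A_0=\tfrac12\begin{pmatrix}0&-2&-2\\2&0&-2\\1&1&2\end{pmatrix},\qquad A_1=\tfrac12\begin{pmatrix}1&1&0\\1&1&0\\0&0&0\end{pmatrix}.$$ For $s\ge0$ and $m\in[1,2]$, $$\gamma(\sigma,n,m,s):=\begin{cases}\dfrac{(2-m)n+2ms}{4m(2-\sigma)}&\text{if }\sigma\in[0,1),\\[2mm]\dfrac{(2-m)n+2ms}{4m}&\text{if }\sigma\in[1,2],\end{cases}$$ and $\mathcal{A}_{m,s}(\mathbb{R}^n):=\left(H^s(\mathbb{R}^n)\cap L^m(\mathbb{R}^n)\right)^3$ (threefold Cartesian product) with its natural norm (the sum over the components of the $H^s$ and $L^m$ norms). $f\lesssim g$ means $f\le Cg$ with a constant $C>0$ independent of $t$ and of the initial data. *)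

(* Defs.v *)
(* Complex-valued functions on R^n over an abstract [R : realType];
   R^n is [n.-tuple R] with its product sigma-algebra. *)
From HB Require Import structures.
From mathcomp Require Import all_boot all_order all_algebra.
From mathcomp Require Import complex.
From mathcomp Require Import all_classical all_reals all_analysis.

Set Implicit Arguments.
Unset Strict Implicit.
Unset Printing Implicit Defensive.

Import Order.TTheory GRing.Theory Num.Theory.
Import numFieldNormedType.Exports.

Local Open Scope classical_set_scope.
Local Open Scope ring_scope.
Local Open Scope complex_scope.

Notation Rn R n := (n.-tuple (measurableTypeR R)).

Section lebesgue_tuple.
Context {R : realType}.

Definition cons_pair n (p : measurableTypeR R * Rn R n) : Rn R n.+1 :=
  [tuple of p.1 :: p.2].

Definition uncons_pair n (x : Rn R n.+1) : measurableTypeR R * Rn R n :=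
  (thead x, [tuple of behead x]).

Lemma cons_pairK n : cancel (@cons_pair n) (@uncons_pair n).
Proof.
move=> [a x]; rewrite /uncons_pair /cons_pair /= theadE.
by congr pair; apply/val_inj.
Qed.

Lemma uncons_pairK n : cancel (@uncons_pair n) (@cons_pair n).
Proof. by move=> x; rewrite [RHS]tuple_eta; apply/val_inj. Qed.

Lemma measurable_cons_pair n : measurable_fun [set: _] (@cons_pair n).
Proof. exact: measurable_cons. Qed.

Lemma measurable_uncons_pair n : measurable_fun [set: _] (@uncons_pair n).
Proof.
apply/measurable_fun_pairP; split; last exact: measurable_behead.
exact: (@measurable_tnth _ (measurableTypeR R) n.+1 ord0).
Qed.

Section step.
Variables (n : nat) (mu : {sigma_finite_measure set (Rn R n) -> \bar R}).

Definition lebesgue_cons : set (Rn R n.+1) -> \bar R :=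
  pushforward (@lebesgue_measure R \x mu)%E (@cons_pair n).

Let measurable_preimage_cons A : measurable A ->
  measurable (@cons_pair n @^-1` A).
Proof.
by move=> mA; rewrite -[X in measurable X]setTI; exact: measurable_cons_pair.
Qed.

Let lebesgue_cons0 : lebesgue_cons set0 = 0%E.
Proof. by rewrite /lebesgue_cons /pushforward preimage_set0 measure0. Qed.

Let lebesgue_cons_ge0 A : (0 <= lebesgue_cons A)%E.
Proof. by rewrite /lebesgue_cons /pushforward; exact: measure_ge0. Qed.

Let lebesgue_cons_sigma_additive : semi_sigma_additive lebesgue_cons.
Proof.
move=> F mF tF mUF; rewrite /lebesgue_cons /pushforward preimage_bigcup.
apply: measure_semi_sigma_additive.
- by move=> i; exact: measurable_preimage_cons.
- apply/trivIsetP => /= i j _ _ ij; rewrite -preimage_setI.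
  by move/trivIsetP : tF => /(_ _ _ _ _ ij) ->//; rewrite preimage_set0.
- by rewrite -preimage_bigcup; exact: measurable_preimage_cons.
Qed.

HB.instance Definition _ := isMeasure.Build _ _ _ lebesgue_cons
  lebesgue_cons0 lebesgue_cons_ge0 lebesgue_cons_sigma_additive.

Let lebesgue_cons_sigma_finite : sigma_finite setT lebesgue_cons.
Proof.
have /sigma_finiteP[F [TF ndF Foo]] := sigma_finiteT (@lebesgue_measure R).
have /sigma_finiteP[G [TG ndG Goo]] := sigma_finiteT mu.
exists (fun i => @uncons_pair n @^-1` (F i `*` G i)).
  rewrite -preimage_bigcup (_ : \bigcup_i _ = setT) ?preimage_setT//.
  rewrite -setXTT TF TG predeqE => -[x y]; split; first by
    move=> [i _ []]/= ? ?; split; exists i.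
  move=> [/= [i _ Fix] [k _ Gky]]; exists (maxn i k) => //; split.
    by move: x Fix; exact/subsetPset/ndF/leq_maxl.
  by move: y Gky; exact/subsetPset/ndG/leq_maxr.
move=> i; have [mFi Fioo] := Foo i; have [mGi Gioo] := Goo i; split.
  rewrite -[X in measurable X]setTI.
  by apply: measurable_uncons_pair => //; exact: measurableX.
rewrite /lebesgue_cons /pushforward -comp_preimage.
rewrite (_ : _ \o _ = id); last by apply/funext => p; exact: cons_pairK.
by rewrite preimage_id product_measure1E// lte_mul_pinfty// ge0_fin_numE.
Qed.

HB.instance Definition _ := Measure_isSigmaFinite.Build _ _ _ lebesgue_cons
  lebesgue_cons_sigma_finite.

End step.

Fixpoint lebesgue n : {sigma_finite_measure set (Rn R n) -> \bar R} :=
  match n with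
  | 0 => dirac [tuple]
  | n'.+1 => lebesgue_cons (lebesgue n')
  end.

End lebesgue_tuple.

Section fourier.
Context {R : realType} {n : nat}.
Implicit Types (x xi : Rn R n) (f g u F U : Rn R n -> R[i]).

Definition dotp x xi : R := \sum_(i < n) tnth x i * tnth xi i.
Definition enorm x : R := Num.sqrt (dotp x x).

Definition cmeasurable f :=
  measurable_fun [set: Rn R n] (fun x => complex.Re (f x) : measurableTypeR R) /\
  measurable_fun [set: Rn R n] (fun x => complex.Im (f x) : measurableTypeR R).

Definition cintegral f : R[i] :=
  Rintegral (lebesgue n) setT (fun x => complex.Re (f x)) +i*
  Rintegral (lebesgue n) setT (fun x => complex.Im (f x)).

Definition Lp_norm (p : R) f : \bar R :=
  Lnorm (lebesgue n) p%:E (fun x => (Normc.normc (f x))%:E).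

Definition in_Lp (p : R) f := cmeasurable f /\ (Lp_norm p f < +oo)%E.

Definition cexp_i (a : R) : R[i] := cos a +i* sin a.

(* Unitary normalisation of the Fourier integral; meaningful for f in L^1. *)
Definition fourier_integral f xi : R[i] :=
  ((2 * pi) `^ (- (n%:R / 2)))%:C *
  cintegral (fun x => cexp_i (- dotp x xi) * f x).

Definition truncate (k : nat) f x : R[i] := if enorm x <= k%:R then f x else 0.

(* F is (a representative of) the Fourier-Plancherel transform of f in L^2. *)
Definition fourier_L2 f F :=
  [/\ in_Lp 2 f, in_Lp 2 F &
      Lp_norm 2 (fun xi => F xi - fourier_integral (truncate k f) xi)
        @[k --> \oo] --> 0%E].

(* L^2 norm of a(D) f, where a(D) has symbol a.  The function g below is
   determined a.e. by f, so the infimum is its norm, or +oo if f or a(D) f is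
   not in L^2. *)
Definition multiplier_norm (a : Rn R n -> R) f : \bar R :=
  ereal_inf [set Lp_norm 2 g | g in
    [set g | exists2 F, fourier_L2 f F &
                        fourier_L2 g (fun xi => (a xi)%:C * F xi)]].

Definition homogeneous_sobolev_norm (s : R) :=
  multiplier_norm (fun xi => enorm xi `^ s).

Definition sobolev_norm (s : R) :=
  multiplier_norm (fun xi => (1 + enorm xi ^+ 2) `^ (s / 2)).

Definition shift (i : 'I_n) (h : R) x : Rn R n :=
  [tuple if j == i then tnth x j + h else tnth x j | j < n].

Definition has_cderive (f : R -> R[i]) (t : R) (z : R[i]) :=
  is_derive t (1 : R) (fun r : R => complex.Re (f r)) (complex.Re z) /\
  is_derive t (1 : R) (fun r : R => complex.Im (f r)) (complex.Im z).

(* Partial derivatives up to order k exist and are bounded; for all k at once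
   this forces their continuity. *)
Fixpoint bounded_partials (k : nat) f : Prop :=
  (exists M, forall x, Normc.normc (f x) <= M) /\
  if k is k'.+1 then
    forall i : 'I_n, exists g,
      (forall x, has_cderive (fun h => f (shift i h x)) 0 (g x)) /\
      bounded_partials k' g
  else True.

(* Smooth functions with compact support in R^n \ {0}. *)
Definition test_function f :=
  (forall k, bounded_partials k f) /\
  exists2 r, 0 < r & forall x, f x != 0 -> r <= enorm x <= r^-1.

Definition tempered u :=
  cmeasurable u /\ exists N : nat,
    (\int[lebesgue n]_x (Normc.normc (u x) / (1 + enorm x) ^+ N)%:E < +oo)%E.

(* The Fourier transform of the tempered distribution u is, on R^n \ {0}, the
   locally integrable function U.  As usual for homogeneous spaces, u thus
   matters modulo polynomials only.  Every tempered distribution whose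
   Laplacian is in L^2 is a function u of this kind, but need not be in L^2. *)
Definition tempered_fourier u U :=
  [/\ tempered u, cmeasurable U,
      forall r : R, 0 < r ->
        (\int[lebesgue n]_(xi in [set xi | r <= enorm xi <= r^-1]%R)
           (Normc.normc (U xi))%:E < +oo)%E &
      forall phi, test_function phi ->
        cintegral (fun x => u x * fourier_integral phi x) =
        cintegral (fun xi => U xi * phi xi)].

End fourier.

Section thermoelastic.
Context {R : realType} {n : nat}.
Implicit Types (f u v w th U W Th : Rn R n -> R[i]).

(* v = |D|^2 u, and U, W, Th are the Fourier transforms of u, w, th. *)
Definition fourier_state u v w th U W Th :=
  [/\ tempered_fourier u U,
      fourier_L2 v (fun xi => (enorm xi ^+ 2)%:C * U xi),
      fourier_L2 w W & fourier_L2 th Th].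

(* Partial Fourier transform, at a frequency of modulus r, of
     u_tt + Delta^2 u + Delta th + (-Delta)^sigma u_t = 0,
     th_t - Delta th - Delta u_t = 0;
   Delta has symbol - r^2, and W is the time derivative of U. *)
Definition fourier_system (sigma r : R) (U W Th : R -> R[i]) (t : R) :=
  let lap := (- r ^+ 2)%:C in
  exists Wt Tht : R[i],
    [/\ has_cderive U t (W t), has_cderive W t Wt, has_cderive Th t Tht,
        Wt + lap ^+ 2 * U t + lap * Th t + (r `^ (2 * sigma))%:C * W t = 0 &
        Tht - lap * Th t - lap * W t = 0].

Definition right_continuous0 (f : R -> R[i]) :=
  complex.Re (f t) @[t --> 0^'+] --> complex.Re (f 0) /\
  complex.Im (f t) @[t --> 0^'+] --> complex.Im (f 0).

(* (u, th) solves the Cauchy problem, with v = |D|^2 u and w = u_t; the initial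
   values are given by the Fourier transforms U0, W0, Th0 of u_0, u_1, th_0. *)
Definition solution (sigma : R) U0 W0 Th0 (u v w th : R -> Rn R n -> R[i]) :=
  exists U W Th : R -> Rn R n -> R[i],
    (forall t, 0 <= t ->
       fourier_state (u t) (v t) (w t) (th t) (U t) (W t) (Th t)) /\
    {ae lebesgue n, forall xi,
      [/\ forall t, 0 < t ->
            fourier_system sigma (enorm xi) (U ^~ xi) (W ^~ xi) (Th ^~ xi) t,
          [/\ right_continuous0 (U ^~ xi), right_continuous0 (W ^~ xi) &
              right_continuous0 (Th ^~ xi)] &
          [/\ U 0 xi = U0 xi, W 0 xi = W0 xi & Th 0 xi = Th0 xi]]}.

Definition in_Hs_Lm (m s : R) f := (sobolev_norm s f < +oo)%E /\ in_Lp m f.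

Definition Hs_Lm_norm (m s : R) f : \bar R := (sobolev_norm s f + Lp_norm m f)%E.

Definition in_A (m s : R) v w th :=
  [/\ in_Hs_Lm m s v, in_Hs_Lm m s w & in_Hs_Lm m s th].

Definition A_norm (m s : R) v w th : \bar R :=
  (Hs_Lm_norm m s v + Hs_Lm_norm m s w + Hs_Lm_norm m s th)%E.

End thermoelastic.

Definition decay_rate (R : realType) (sigma : R) (n : nat) (m s : R) : R :=
  if sigma < 1 then ((2 - m) * n%:R + 2 * m * s) / (4 * m * (2 - sigma))
  else ((2 - m) * n%:R + 2 * m * s) / (4 * m).

(* Main.v *)
(** On the Fourier side the system is, at each frequency of modulus r, an ODE in
    time for (V, W, Th) = (r^2 U, U_t, Th) with damping coefficients q = r^2 and
    p = r^(2 sigma).  A Lyapunov functional |V|^2 + |W|^2 + |Th|^2 + a Th W + b V W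
    decays at a rate comparable with q when p <= q and with q^2/p when q <= p,
    hence at a rate of at least min(r^kappa, 1) up to a constant, where
    kappa = 2 (2 - sigma) for sigma < 1 and kappa = 2 otherwise.  High frequencies
    therefore decay exponentially and are controlled by the H^s norm.  For low
    frequencies, a dyadic decomposition reduces the estimate to the bound
    ||F||_(L^2(|xi| <= r))^2 <= C r^(n (2-m)/m) ||f||_(L^m)^2, obtained without
    interpolation by splitting f at a height depending on r.

    Plancherel's theorem is derived in dimension one from the convergence of
    Poisson averages, tensorised to R^n, and extended to L^2 with surjectivity of
    the transform, which provides the functions whose L^2 norms are the
    homogeneous Sobolev norms in the theorem. *)
Require Import Defs.
From HB Require Import structures.
From mathcomp Require Import all_boot all_order all_algebra.
From mathcomp Require Import complex.
From mathcomp Require Import all_classical all_reals all_analysis.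
From mathcomp Require Import measurable_realfun ring lra.

Set Implicit Arguments.
Unset Strict Implicit.
Unset Printing Implicit Defensive.

Import Order.TTheory GRing.Theory Num.Theory.
Import numFieldNormedType.Exports.

Local Open Scope ring_scope.
Local Open Scope classical_set_scope.

(** * Fubini's theorem for real-valued integrals *)

(** The rate is a matter of scaling. Against the weight r^(2s) exp(-c r^kappa t), a mass of at most
    r^b in the ball of radius r, with b = n(2-m)/m, integrates to t^(-(2s+b)/kappa), and this
    exponent is twice [decay_rate] because squared norms are estimated. What shapes the proof is
    that the norms are infima over Fourier-Plancherel pairs, and that such a pair is only a limit of
    transforms of truncations. Estimates of a transform are therefore proved for truncations, which
    lie in L^1 and in L^2, and then passed to the limit. The isometry itself is stated on that
    intersection, a class that almost every slice of a function inherits, so that it tensorises by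
    Fubini. Squared quantities [sqn] and [energy] replace norms, so that the triangle inequality
    reads |z+w|^2 <= 2|z|^2 + 2|w|^2; the lost factors 2 only enlarge the final constant. At a fixed
    frequency V has no damping of its own: the cross terms of the Lyapunov functional transfer it
    from W and Th, and an overdamped W allows the V W term a weight of order q/p only. *)

Section real_fubini.
Context d1 d2 (T1 : measurableType d1) (T2 : measurableType d2) (R : realType).
Variables (m1 : {sigma_finite_measure set T1 -> \bar R}).
Variables (m2 : {sigma_finite_measure set T2 -> \bar R}).
Implicit Types (h : T1 * T2 -> R).

(** An inner integral may be infinite on a null set; [fine] sends such values to 0, which affects
    neither integrability nor the integral. *)
Lemma EFin_fine_integrable d (T : measurableType d)
    (m : {measure set T -> \bar R}) (F : T -> \bar R) :
  m.-integrable setT F ->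
  [/\ m.-integrable setT (EFin \o (fine \o F)) &
     (\int[m]_x (fine (F x))%:E = \int[m]_x F x)%E].
Proof.
move=> iF; have mF := measurable_int m iF.
have mf : measurable_fun setT (EFin \o (fine \o F)).
  by apply/measurable_EFinP; exact: (measurableT_comp (fine_measurable measurableT)).
have ae : ae_eq m setT F (EFin \o (fine \o F)).
  by apply: filterS (integrable_ae measurableT iF) => x /= + _; move=> /(_ I)/fineK.
split.
  apply: le_integrable iF => // x _ /=.
  by case: (F x) => [r| |] //=; rewrite normr0 leey.
by apply/esym; exact: ae_eq_integral.
Qed.

Lemma Rintegral12_prod h : (m1 \x m2)%E.-integrable setT (EFin \o h) ->
  m1.-integrable setT (fun x => (Rintegral m2 setT (fun y => h (x, y)))%:E) /\
  Rintegral (m1 \x m2)%E setT h =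
  Rintegral m1 setT (fun x => Rintegral m2 setT (fun y => h (x, y))).
Proof.
move=> ih.
have [i1 e1] := EFin_fine_integrable (integrable_fubini_F ih).
split; first exact: i1.
by rewrite /Rintegral -integral12_prod_meas1//; congr fine; exact/esym.
Qed.

Lemma Rintegral21_prod h : (m1 \x m2)%E.-integrable setT (EFin \o h) ->
  m2.-integrable setT (fun y => (Rintegral m1 setT (fun x => h (x, y)))%:E) /\
  Rintegral (m1 \x m2)%E setT h =
  Rintegral m2 setT (fun y => Rintegral m1 setT (fun x => h (x, y))).
Proof.
move=> ih.
have mG : measurable_fun setT (fubini_G m1 (EFin \o h)) := measurable_fubini_G ih.
have iG : m2.-integrable setT (fubini_G m1 (EFin \o h)).
  have mh := measurable_int _ ih.
  apply/integrableP; split => //.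
  move/(integrable21ltyP m1 m2 mh) : ih; apply: le_lt_trans.
  apply: ge0_le_integral => //.
  - exact: measurableT_comp.
  - apply: (measurable_fun_fubini_tonelli_G (abse \o (EFin \o h))) => //.
      exact: measurableT_comp.
    by move=> x; exact: abse_ge0.
  - move=> y _; apply: le_abse_integral => //.
    exact: (measurableT_comp mh).
have [i1 e1] := EFin_fine_integrable iG.
split; first exact: i1.
by rewrite /Rintegral -integral21_prod_meas1//; congr fine; exact/esym.
Qed.

Lemma integrable_prodM (u : T1 -> R) (v : T2 -> R) :
  m1.-integrable setT (EFin \o u) -> m2.-integrable setT (EFin \o v) ->
  (m1 \x m2)%E.-integrable setT (fun p => (u p.1 * v p.2)%:E).
Proof.
move=> iu iv.
have mu_ : measurable_fun setT u by exact/measurable_EFinP/(measurable_int m1).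
have mv_ : measurable_fun setT v by exact/measurable_EFinP/(measurable_int m2).
apply/integrable12ltyP.
  apply/measurable_EFinP; apply: measurable_funM.
    exact: measurableT_comp.
  exact: measurableT_comp.
have -> : (\int[m1]_x \int[m2]_y `|(u (x, y).1 * v (x, y).2)%:E| =
           \int[m1]_x (`|(u x)%:E| * \int[m2]_y `|(v y)%:E|))%E.
  apply: eq_integral => x _ /=.
  rewrite -ge0_integralZl//; last by do 2 apply: measurableT_comp => //.
  by apply: eq_integral => y _; rewrite /= normrM.
rewrite ge0_integralZr//; last 2 first.
- by do 2 apply: measurableT_comp => //.
- exact: integral_ge0.
move/integrableP : iu => [_ iu]; move/integrableP : iv => [_ iv].
by apply: lte_mul_pinfty => //; rewrite ?ge0_fin_numE//; exact: integral_ge0.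
Qed.

(** No integrability is assumed: positive and negative parts are treated by Tonelli, and the
    conventions for infinite values do no harm to measurability. With its twin in the other
    variable, this makes transforms of merely measurable functions measurable. *)
Lemma measurable_Rintegral12 h : measurable_fun setT h ->
  measurable_fun setT (fun x => Rintegral m2 setT (fun y => h (x, y))).
Proof.
move=> mh; apply: (measurableT_comp (fine_measurable measurableT)).
have mEh : measurable_fun setT (EFin \o h) by exact/measurable_EFinP.
rewrite (_ : (fun x => _) = fun x => (\int[m2]_y (EFin \o h)^\+ (x, y) -
    \int[m2]_y (EFin \o h)^\- (x, y))%E); last first.
  apply/funext => x; rewrite integralE; congr (_ - _)%E.
    by apply: eq_integral => y _; rewrite !funeposE.
  by apply: eq_integral => y _; rewrite !funenegE.
apply: emeasurable_funB.
- by apply: measurable_fun_fubini_tonelli_F => //; exact: measurable_funepos.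
- by apply: measurable_fun_fubini_tonelli_F => //; exact: measurable_funeneg.
Qed.

Lemma measurable_Rintegral21 h : measurable_fun setT h ->
  measurable_fun setT (fun y => Rintegral m1 setT (fun x => h (x, y))).
Proof.
move=> mh; apply: (measurableT_comp (fine_measurable measurableT)).
have mEh : measurable_fun setT (EFin \o h) by exact/measurable_EFinP.
rewrite (_ : (fun y => _) = fun y => (\int[m1]_x (EFin \o h)^\+ (x, y) -
    \int[m1]_x (EFin \o h)^\- (x, y))%E); last first.
  apply/funext => y; rewrite integralE; congr (_ - _)%E.
    by apply: eq_integral => x _; rewrite !funeposE.
  by apply: eq_integral => x _; rewrite !funenegE.
apply: emeasurable_funB.
- by apply: measurable_fun_fubini_tonelli_G => //; exact: measurable_funepos.
- by apply: measurable_fun_fubini_tonelli_G => //; exact: measurable_funeneg.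
Qed.

End real_fubini.

(** * Bounded multipliers and convergence to 0 in the extended reals *)

Section integral_tools.
Context d (T : measurableType d) (R : realType) (m : {measure set T -> \bar R}).
Implicit Types (a h : T -> R).

Lemma integrable_bddM K h a : measurable_fun setT h ->
  (forall x, `|h x| <= K) -> m.-integrable setT (EFin \o a) ->
  m.-integrable setT (fun x => (h x * a x)%:E).
Proof.
move=> mh hK ia.
have ma : measurable_fun setT a by exact/measurable_EFinP/(measurable_int m).
have iK := integrableZl measurableT K ia.
apply: le_integrable iK => //.
  by apply/measurable_EFinP; exact: measurable_funM.
move=> x _ /=; rewrite lee_fin !normrM ler_wpM2r// (le_trans (hK x))//.
exact: ler_norm.
Qed.

Lemma normr_Rintegral_bddM K h a : measurable_fun setT h ->
  (forall x, `|h x| <= K) -> m.-integrable setT (EFin \o a) ->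
  `|Rintegral m setT (fun x => h x * a x)| <= K * Rintegral m setT (fun x => `|a x|).
Proof.
move=> mh hK ia.
have i1 := integrable_bddM mh hK ia.
have ma : measurable_fun setT a by exact/measurable_EFinP/(measurable_int m).
apply: le_trans (le_normr_Rintegral _ i1) _ => //.
rewrite -RintegralZl//; last exact: integrable_norm.
apply: le_Rintegral => //.
- exact: integrable_norm i1.
- have := integrableZl measurableT K (integrable_norm ia).
  by apply: eq_integrable => // x _ /=.
- by move=> x _; rewrite normrM ler_wpM2r.
Qed.

Lemma integrable_ge0 a : measurable_fun setT a -> (forall x, 0 <= a x) ->
  (\int[m]_x (a x)%:E < +oo)%E -> m.-integrable setT (EFin \o a).
Proof.
move=> ma a0 afin; apply/integrableP; split; first exact/measurable_EFinP.
by under eq_integral do rewrite /= ger0_norm//.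
Qed.

Lemma EFin_Rintegral a : m.-integrable setT (EFin \o a) ->
  (Rintegral m setT a)%:E = (\int[m]_x (a x)%:E)%E.
Proof. by move=> ia; rewrite fineK//; exact: integrable_fin_num ia. Qed.

End integral_tools.

Lemma cvge_near_le {R : realType} (v : nat -> \bar R) (eta : R) : (forall k, 0 <= v k)%E ->
  v k @[k --> \oo] --> 0%E -> 0 < eta -> \forall k \near \oo, (v k <= eta%:E)%E.
Proof.
move=> v0 /fine_cvgP[fv /cvgr0Pnorm_le vv] eta0; near=> k.
rewrite -[leLHS]fineK; last by near: k.
rewrite lee_fin -[leLHS]ger0_norm; last exact: fine_ge0.
by near: k; exact: vv.
Unshelve. all: by end_near. Qed.

Lemma cvge0_le {R : realType} (u : nat -> \bar R) : (forall k, 0 <= u k)%E ->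
  (forall eta : R, 0 < eta -> \forall k \near \oo, (u k <= eta%:E)%E) ->
  u @ \oo --> 0%E.
Proof.
move=> u0 H.
have ufin : \forall k \near \oo, u k \is a fin_num.
  have := H 1 ltr01; apply: filterS => k uk1.
  by rewrite ge0_fin_numE// (le_lt_trans uk1)// ltry.
apply/fine_cvgP; split => //.
apply/cvgr0Pnorm_le => eta eta0.
near=> k; rewrite /= ger0_norm; last exact/fine_ge0/u0.
rewrite -lee_fin fineK; last by near: k.
by near: k; exact: H.
Unshelve. all: by end_near. Qed.

(** * Plancherel's identity on the line *)

Section poisson_kernel.
Context {R : realType}.
Let mu := @lebesgue_measure R.
Implicit Types e x y z : R.

(** This is pi times the Poisson kernel of the upper half-plane at height e. *)
Definition poisson_kernel e z : R := e / (e ^+ 2 + z ^+ 2).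

Lemma poisson_kernel_ge0 e z : 0 < e -> 0 <= poisson_kernel e z.
Proof. by move=> e0; rewrite divr_ge0 ?addr_ge0 ?sqr_ge0// ltW. Qed.

Lemma poisson_kernel_den_gt0 e z : 0 < e -> 0 < e ^+ 2 + z ^+ 2.
Proof. by move=> e0; rewrite ltr_pwDl ?sqr_ge0 ?exprn_gt0. Qed.

Lemma continuous_poisson_kernel e : 0 < e -> continuous (poisson_kernel e).
Proof.
move=> e0 z; apply: cvgM; first exact: cvg_cst.
apply: cvgV; first by rewrite gt_eqF ?poisson_kernel_den_gt0.
apply: cvgD; first exact: cvg_cst.
exact: exprn_continuous.
Qed.

(** The substitution (y - x) / e reduces the integral to that of 1 / (1 + y^2), which by symmetry is
    twice the half-line value pi / 2. *)
Lemma integral_poisson_kernel e x : 0 < e ->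
  (\int[mu]_y (poisson_kernel e (x - y))%:E = pi%:E)%E.
Proof.
move=> e0.
have e0' : e != 0 by rewrite gt_eqF.
have h0 : (\int[mu]_y ((oneDsqr y)^-1)%:E = pi%:E)%E.
  rewrite ge0_symfun_integralT//.
  - rewrite -set_itvcy integral0y_oneDsqr -EFinM mulrC divfK//.
  - exact: continuous_oneDsqrV.
  - by move=> y /=; rewrite /oneDsqr sqrrN.
pose F y := e^-1 * (y - x).
have dF y : is_derive y (1 : R) F e^-1.
  by rewrite /F; apply: is_derive_eq; rewrite subr0 /GRing.scale/= mulr1.
have dFE : F^`() = cst e^-1.
  by apply/funext => y; rewrite derive1E; apply: derive_val.
rewrite -h0 [RHS](@increasing_ge0_integration_by_substitutionT _ F); first last.
- by move=> y; rewrite invr_ge0; exact: le_trans ler01 (oneDsqr_ge1 y).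
- exact: continuous_oneDsqrV.
- have : e^-1 * (y - x) @[y --> +oo] --> +oo.
    apply: gt0_cvgMry; first by rewrite invr_gt0.
    by apply: cvg_addrr.
  exact.
- have : e^-1 * (y - x) @[y --> -oo] --> -oo.
    apply: gt0_cvgMrNy; first by rewrite invr_gt0.
    by apply: cvg_addrr_Ny.
  exact.
- by [].
- by rewrite dFE; exact: is_cvg_cst.
- by rewrite dFE; exact: is_cvg_cst.
- by rewrite dFE; move=> y; exact: cvg_cst.
- by move=> y z yz; rewrite /F ltr_pM2l ?invr_gt0// ltrD2r.
apply: eq_integral => y _; congr EFin; rewrite dFE /= /GRing.mul/=.
rewrite -/(GRing.mul _ _) /F /oneDsqr /poisson_kernel /cst.
have : (e^-1 * (y - x)) ^+ 2 = (x - y) ^+ 2 / e ^+ 2 by field.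
move=> ->.
field; rewrite e0' /= gt_eqF//; last exact: poisson_kernel_den_gt0.
Qed.

End poisson_kernel.

(** * The cosine transform of exp(-e|y|) *)

Section laplace_cos.
Context {R : realType}.
Let mu := @lebesgue_measure R.
Implicit Types e x y z : R.

(** Adding 1 to the cosine makes the integrand nonnegative, so that symmetry and the fundamental
    theorem on the half-line apply before integrability is known. The case z = 0 is twice the
    exponential, whose integral is then subtracted. *)
Let expcos e z y := expR (- (e * `|y|)) * (1 + cos (z * y)).

Lemma cvg_expRN_bounded e (f : R -> R) (M : R) : 0 < e ->
  (forall y, `|f y| <= M) -> expR (- (e * y)) * f y @[y --> +oo] --> 0.
Proof.
move=> e0 fM.
have h : expR (- (e * y)) @[y --> +oo] --> 0.
  apply: (@cvg_comp _ _ _ (fun y => e * y) (fun x => expR (- x)) _ (+oo)).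
    by apply: gt0_cvgMry => //; exact: cvg_id.
  exact: cvgr_expR.
apply/cvgr0Pnorm_lt => eps eps0.
have M0 : 0 <= M by exact: le_trans (fM 0).
have M1 : 0 < M + 1 by rewrite ltr_wpDl.
near=> y.
rewrite normrM (@le_lt_trans _ _ (`|expR (- (e * y))| * (M + 1)))//.
  by rewrite ler_wpM2l// (le_trans (fM y))// lerDl.
rewrite -ltr_pdivlMr//.
near: y; move/cvgr0Pnorm_lt : h; apply; exact: divr_gt0.
Unshelve. all: by end_near. Qed.

Lemma continuous_expRN_norm e : continuous (fun y => expR (- (e * `|y|))).
Proof.
move=> y; apply: continuous_comp; last exact: continuous_expR.
apply: cvgN; apply: cvgM; first exact: cvg_cst.
exact: norm_continuous.
Qed.

Lemma measurable_expRN_norm e :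
  measurable_fun setT (fun y => expR (- (e * `|y|))).
Proof. by apply: continuous_measurable_fun; exact: continuous_expRN_norm. Qed.

Let integral_expcos e z : 0 < e ->
  (\int[mu]_y (expcos e z y)%:E = (2 / e + 2 * poisson_kernel e z)%:E)%E.
Proof.
move=> e0.
have e0' : e != 0 by rewrite gt_eqF.
have d0 := poisson_kernel_den_gt0 z e0.
have d0' : e ^+ 2 + z ^+ 2 != 0 by rewrite gt_eqF.
have c0 : continuous (expcos e z).
  move=> y; apply: cvgM; first exact: continuous_expRN_norm.
  apply: cvgD; first exact: cvg_cst.
  apply: continuous_comp; last exact: continuous_cos.
  by apply: cvgM; [exact: cvg_cst|exact: cvg_id].
have ge0 y : 0 <= expcos e z y.
  by rewrite mulr_ge0 ?expR_ge0// -lerBlDl sub0r cos_geN1.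
rewrite ge0_symfun_integralT//; last first.
  by move=> y /=; rewrite /expcos normrN mulrN cosN.
(* The oscillating part of this antiderivative is the real part of exp((-e + i z) y) / (-e + i
   z). *)
pose F y := expR (- (e * y)) * (- e^-1 + (z * sin (z * y) - e * cos (z * y)) / (e ^+ 2 + z ^+ 2)).
pose f y := expR (- (e * y)) * (1 + cos (z * y)).
have dF y : is_derive y (1 : R) F (f y).
  rewrite /F; apply: is_derive_eq; rewrite /f /GRing.scale/=; field.
  by rewrite d0'.
have cf : continuous f.
  move=> y; apply: cvgM.
    apply: continuous_comp; last exact: continuous_expR.
    by apply: cvgN; apply: cvgM; [exact: cvg_cst|exact: cvg_id].
  apply: cvgD; first exact: cvg_cst.
  apply: continuous_comp; last exact: continuous_cos.
  by apply: cvgM; [exact: cvg_cst|exact: cvg_id].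
have -> : (\int[mu]_(x in [set x | (0 <= x)%R]) (expcos e z x)%:E =
          \int[mu]_(x in `[0%R, +oo[) (f x)%:E)%E.
  rewrite -set_itvcy; apply: eq_integral => x.
  by rewrite inE/= in_itv/= andbT => x0; rewrite /expcos ger0_norm.
have cF : continuous F.
  move=> y; apply: differentiable_continuous; apply/derivable1_diffP.
  exact: ex_derive.
rewrite (@ge0_continuous_FTC2y _ _ F 0 0)//.
- rewrite -EFinB -EFinM; congr EFin; rewrite /F !mulr0 sin0 cos0 oppr0 expR0 /poisson_kernel.
  by field; rewrite ?d0' ?e0'.
- by move=> y _; rewrite /f mulr_ge0 ?expR_ge0// -lerBlDl sub0r cos_geN1.
- exact: continuous_subspaceT.
- pose M := e^-1 + (`|z| + e) / (e ^+ 2 + z ^+ 2).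
  apply: (@cvg_expRN_bounded _ _ M) => // y.
  rewrite /M (le_trans (ler_normD _ _))// normrN gtr0_norm ?invr_gt0// lerD2l.
  rewrite normrM [`|_^-1|]gtr0_norm ?invr_gt0// ler_pM2r ?invr_gt0//.
  rewrite (le_trans (ler_normB _ _))// !normrM [`|e|]gtr0_norm//.
  rewrite lerD//.
    by rewrite ler_piMr// ler_norml sin_geN1 sin_le1.
  by rewrite ler_piMr ?(ltW e0)// ler_norml cos_geN1 cos_le1.
- by apply: cvg_at_right_filter; exact: cF.
- by move=> y _; rewrite derive1E; exact: derive_val.
Qed.

Lemma integral_expRN_norm e : 0 < e ->
  (\int[mu]_y (expR (- (e * `|y|)))%:E = (2 / e)%:E)%E.
Proof.
move=> e0.
have := integral_expcos 0 e0.
under eq_integral.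
  move=> y _; rewrite /expcos mul0r cos0 mulrC EFinM; over.
rewrite /= ge0_integralZl//=.
- rewrite /poisson_kernel expr0n addr0 => h.
  have -> : 2 / e = ((1 + 1)^-1 * (2 / e + 2 * (e / e ^+ 2))).
    by field; rewrite gt_eqF.
  by rewrite EFinM -h muleA -EFinM mulVf ?mul1e.
- by apply/measurable_EFinP; exact: measurable_expRN_norm.
Qed.

Lemma integrable_expRN_norm e : 0 < e ->
  mu.-integrable setT (fun y => (expR (- (e * `|y|)))%:E).
Proof.
move=> e0; apply/integrableP; split.
  by apply/measurable_EFinP; exact: measurable_expRN_norm.
under eq_integral do rewrite gee0_abs ?lee_fin ?expR_ge0//.
by rewrite integral_expRN_norm// ltry.
Qed.

Lemma integral_expRN_norm_cos e z : 0 < e ->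
  (\int[mu]_y (expR (- (e * `|y|)) * cos (z * y))%:E = (2 * poisson_kernel e z)%:E)%E.
Proof.
move=> e0.
have iexp := integrable_expRN_norm e0.
transitivity (\int[mu]_y ((expcos e z y)%:E - (expR (- (e * `|y|)))%:E))%E.
  apply: eq_integral => y _; rewrite -EFinB; congr EFin.
  by rewrite /expcos mulrDr mulr1 addrC addKr.
rewrite integralB_EFin//.
  by rewrite integral_expcos// integral_expRN_norm// -EFinB addrC addKr.
apply: le_integrable (integrableZl measurableT 2 iexp) => //.
- apply/measurable_EFinP; apply: continuous_measurable_fun => y.
  apply: cvgM; first exact: continuous_expRN_norm.
  apply: cvgD; first exact: cvg_cst.
  apply: continuous_comp; last exact: continuous_cos.
  by apply: cvgM; [exact: cvg_cst|exact: cvg_id].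
- move=> y _; rewrite /= lee_fin /expcos mulrC !normrM.
  rewrite ler_wpM2r// ger0_norm; last by rewrite -lerBlDl sub0r cos_geN1.
  by rewrite ger0_norm// -[leRHS]/(1 + 1) lerD2l cos_le1.
Qed.

End laplace_cos.

(** * The quadratic defect of Poisson averaging *)

Section poisson_defect.
Context {R : realType}.
Let mu := @lebesgue_measure R.
Local Notation pm := (mu \x mu)%E.
Implicit Types (e : R) (a b : R -> R).

(* The defect of [a] under averaging with the Poisson kernel; it tends to 0
   with [e] for every square-integrable [a]. *)
Definition poisson_defect e a : \bar R :=
  (\int[pm]_p (poisson_kernel e (p.1 - p.2) * (a p.1 - a p.2) ^+ 2)%:E)%E.

Lemma measurable_poisson_kernelB e : 0 < e ->
  measurable_fun setT (fun p : measurableTypeR R * measurableTypeR R =>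
    poisson_kernel e (p.1 - p.2)).
Proof.
move=> e0; apply: (measurableT_comp (f := poisson_kernel e)).
  by apply: continuous_measurable_fun; exact: continuous_poisson_kernel.
exact: measurable_funB.
Qed.

Lemma poisson_kernelN e z : poisson_kernel e (- z) = poisson_kernel e z.
Proof. by rewrite /poisson_kernel sqrrN. Qed.

Lemma integral_poisson_kernel1 e b : 0 < e -> measurable_fun setT b ->
  (forall x, 0 <= b x) ->
  (\int[pm]_p (poisson_kernel e (p.1 - p.2) * b p.1)%:E = pi%:E * \int[mu]_x (b x)%:E)%E.
Proof.
move=> e0 mb b0.
rewrite fubini_tonelli1; last 2 first.
- apply/measurable_EFinP; apply: measurable_funM.
    exact: measurable_poisson_kernelB.
  exact: measurableT_comp.
- by move=> p; rewrite lee_fin mulr_ge0 ?poisson_kernel_ge0.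
rewrite -ge0_integralZl//; last 3 first.
- exact/measurable_EFinP.
- by move=> x _; rewrite lee_fin.
- by rewrite lee_fin pi_ge0.
apply: eq_integral => x _; rewrite /fubini_F /=.
under eq_integral do rewrite EFinM.
rewrite ge0_integralZr//.
- by rewrite integral_poisson_kernel.
- apply/measurable_EFinP; apply: (measurableT_comp (f := poisson_kernel e)).
    by apply: continuous_measurable_fun; exact: continuous_poisson_kernel.
  exact: measurable_funB.
- by move=> y _; rewrite lee_fin poisson_kernel_ge0.
- by rewrite lee_fin.
Qed.

Lemma integral_poisson_kernel2 e b : 0 < e -> measurable_fun setT b ->
  (forall x, 0 <= b x) ->
  (\int[pm]_p (poisson_kernel e (p.1 - p.2) * b p.2)%:E = pi%:E * \int[mu]_x (b x)%:E)%E.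
Proof.
move=> e0 mb b0.
rewrite fubini_tonelli2; last 2 first.
- apply/measurable_EFinP; apply: measurable_funM.
    exact: measurable_poisson_kernelB.
  exact: measurableT_comp.
- by move=> p; rewrite lee_fin mulr_ge0 ?poisson_kernel_ge0.
rewrite -ge0_integralZl//; last 3 first.
- exact/measurable_EFinP.
- by move=> x _; rewrite lee_fin.
- by rewrite lee_fin pi_ge0.
apply: eq_integral => y _; rewrite /fubini_G /=.
under eq_integral do rewrite -opprB poisson_kernelN EFinM.
rewrite ge0_integralZr//.
- by rewrite integral_poisson_kernel.
- apply/measurable_EFinP; apply: (measurableT_comp (f := poisson_kernel e)).
    by apply: continuous_measurable_fun; exact: continuous_poisson_kernel.
  exact: measurable_funB.
- by move=> x _; rewrite lee_fin poisson_kernel_ge0.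
- by rewrite lee_fin.
Qed.

Let measurable_defect e a : 0 < e -> measurable_fun setT a ->
  measurable_fun setT (fun p : measurableTypeR R * measurableTypeR R =>
    poisson_kernel e (p.1 - p.2) * (a p.1 - a p.2) ^+ 2).
Proof.
move=> e0 ma; apply: measurable_funM; first exact: measurable_poisson_kernelB.
by apply: measurable_funX; apply: measurable_funB; exact: measurableT_comp.
Qed.

Lemma poisson_defect_ge0 e a : 0 < e -> (0 <= poisson_defect e a)%E.
Proof.
move=> e0; apply: integral_ge0 => p _.
by rewrite lee_fin mulr_ge0 ?poisson_kernel_ge0 ?sqr_ge0.
Qed.

(** By (a1 - a2)^2 <= 2 a1^2 + 2 a2^2, with each of the two terms contributing mass 2 pi. The bound
    is uniform in e, which makes the functions of vanishing defect closed in L^2. *)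
Lemma poisson_defect_le e a : 0 < e -> measurable_fun setT a ->
  (poisson_defect e a <= (4 * pi)%:E * \int[mu]_x (a x ^+ 2)%:E)%E.
Proof.
move=> e0 ma.
have m2 : measurable_fun setT (fun x => a x ^+ 2) by exact: measurable_funX.
have m2' : measurable_fun setT (fun x => 2 * a x ^+ 2).
  by apply: measurable_funM => //; exact: measurable_cst.
have h0 x : 0 <= 2 * a x ^+ 2 by rewrite mulr_ge0 ?sqr_ge0.
have K0 (p : R * R) : 0 <= poisson_kernel e (p.1 - p.2) by exact: poisson_kernel_ge0.
have -> : ((4 * pi)%:E * \int[mu]_x (a x ^+ 2)%:E =
    \int[pm]_p ((poisson_kernel e (p.1 - p.2) * (2 * a p.1 ^+ 2))%:E +
                (poisson_kernel e (p.1 - p.2) * (2 * a p.2 ^+ 2))%:E))%E.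
  rewrite ge0_integralD//; last 4 first.
  - by move=> p _; rewrite lee_fin mulr_ge0.
  - apply/measurable_EFinP; apply: measurable_funM.
      exact: measurable_poisson_kernelB.
    exact: (measurableT_comp m2').
  - by move=> p _; rewrite lee_fin mulr_ge0.
  - apply/measurable_EFinP; apply: measurable_funM.
      exact: measurable_poisson_kernelB.
    exact: (measurableT_comp m2').
  rewrite (integral_poisson_kernel1 (b := fun x => 2 * a x ^+ 2))//.
  rewrite (integral_poisson_kernel2 (b := fun x => 2 * a x ^+ 2))//.
  under [in RHS]eq_integral do rewrite EFinM.
  rewrite ge0_integralZl//; last 2 first.
  - exact/measurable_EFinP.
  - by move=> x _; rewrite lee_fin sqr_ge0.
  rewrite muleA -EFinM -ge0_muleDl; last 2 first.
  - by rewrite lee_fin mulr_ge0 ?pi_ge0.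
  - by rewrite lee_fin mulr_ge0 ?pi_ge0.
  by congr (_ * _)%E; rewrite -EFinD; congr EFin; ring.
apply: ge0_le_integral => //.
- by move=> p _; rewrite lee_fin mulr_ge0 ?sqr_ge0.
- by apply/measurable_EFinP; exact: measurable_defect.
- apply/measurable_EFinP; apply: measurable_funD; apply: measurable_funM;
    try exact: measurable_poisson_kernelB; exact: (measurableT_comp m2').
- move=> p _; rewrite -EFinD lee_fin -mulrDr ler_wpM2l//.
  have := sqr_ge0 (a p.1 + a p.2); nra.
Qed.

Lemma poisson_defectD_le e a b : 0 < e -> measurable_fun setT a -> measurable_fun setT b ->
  (poisson_defect e (a \+ b)%R <= 2%:E * poisson_defect e a + 2%:E * poisson_defect e b)%E.
Proof.
move=> e0 ma mb.
have md (c : R -> R) : measurable_fun setT c ->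
    measurable_fun setT (fun p : measurableTypeR R * measurableTypeR R =>
      (poisson_kernel e (p.1 - p.2) * (c p.1 - c p.2) ^+ 2)%:E).
  by move=> mc; apply/measurable_EFinP; exact: measurable_defect.
have d0 (c : R -> R) (p : R * R) : (0 <= (poisson_kernel e (p.1 - p.2) * (c p.1 - c p.2) ^+ 2)%:E)%E.
  by rewrite lee_fin mulr_ge0 ?sqr_ge0 ?poisson_kernel_ge0.
rewrite /poisson_defect -!ge0_integralZl//; [|exact: md..].
rewrite -ge0_integralD//; last 4 first.
- by move=> p _; rewrite mule_ge0.
- by apply: emeasurable_funM => //; exact: md.
- by move=> p _; rewrite mule_ge0.
- by apply: emeasurable_funM => //; exact: md.
apply: ge0_le_integral => //.
- by apply: (md (a \+ b)%R); exact: measurable_funD.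
- by apply: emeasurable_funD; apply: emeasurable_funM => //; exact: md.
- move=> p _; rewrite -!EFinM -EFinD lee_fin.
  rewrite !(mulrCA 2) -mulrDr ler_wpM2l ?poisson_kernel_ge0//.
  rewrite /=; move: (a p.1) (a p.2) (b p.1) (b p.2) => a1 a2 b1 b2.
  have := sqr_ge0 ((a1 - a2) - (b1 - b2)); nra.
Qed.

End poisson_defect.

(** * Vanishing of the defect for square-integrable functions *)

Section poisson_defect_cvg.
Context {R : realType}.
Let mu := @lebesgue_measure R.
Local Notation pm := (mu \x mu)%E.
Implicit Types (a b : R -> R) (A V : set R).

Let eps (k : nat) : R := k.+1%:R^-1.
Let eps_gt0 k : 0 < eps k. Proof. by rewrite invr_gt0. Qed.
Local Hint Resolve eps_gt0 : core.

(** Along e = 1/(k+1). This property is linear and stable under L^2 approximation, so it only has to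
    be verified by hand for open sets of finite measure; outer regularity and simple functions carry
    it to all of L^2. *)
Let vanishes a := measurable_fun setT a /\
  poisson_defect (eps k) a @[k --> \oo] --> 0%E.

Let vanishes_near a (eta : R) : vanishes a -> 0 < eta ->
  \forall k \near \oo, (poisson_defect (eps k) a <= eta%:E)%E.
Proof.
move=> [_ /fine_cvgP[fa /cvgr0Pnorm_le va]] eta0.
near=> k.
rewrite -[leLHS]fineK; last by near: k.
rewrite lee_fin -[leLHS]ger0_norm; last exact/fine_ge0/poisson_defect_ge0.
by near: k; exact: va.
Unshelve. all: by end_near. Qed.

Let vanishes_closed a : measurable_fun setT a ->
  (forall eta : R, 0 < eta -> exists b,
     vanishes b /\ (\int[mu]_x ((a x - b x) ^+ 2)%:E <= eta%:E)%E) ->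
  vanishes a.
Proof.
move=> ma H; split => //; apply: cvge0_le => [k|eta eta0].
  exact: poisson_defect_ge0.
have c0 : 0 < (2 * (4 * pi)) :> R by rewrite !mulr_gt0 ?pi_gt0.
(* The distance is chosen so that the uniform bound 4 pi and the factor 2 of [poisson_defectD_le]
   return eta / 2; the defect of b accounts for the other half. *)
have [b [vb hb]] := H (eta / 2 / (2 * (4 * pi))) ltac:(by rewrite !divr_gt0).
have vb4 := vanishes_near vb (divr_gt0 eta0 (ltr0Sn R 3)).
have mb : measurable_fun setT b by case: vb.
have mab : measurable_fun setT (a \- b)%R by exact: measurable_funB.
near=> k.
have -> : a = (b \+ (a \- b))%R by apply/funext => x /=; rewrite addrC subrK.
apply: le_trans (poisson_defectD_le (eps_gt0 k) mb mab) _.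
have -> : eta = 2 * (eta / 4) + 2 * ((4 * pi) * (eta / 2 / (2 * (4 * pi)))).
  by move: (pi_gt0 R); move: (pi : R) => p p0; field; rewrite gt_eqF.
rewrite [leRHS]EFinD; apply: leeD.
  rewrite [leRHS]EFinM; apply: lee_wpmul2l; first by rewrite lee_fin.
  by near: k.
rewrite [leRHS]EFinM; apply: lee_wpmul2l; first by rewrite lee_fin.
apply: le_trans (poisson_defect_le (eps_gt0 k) mab) _.
rewrite [leRHS]EFinM; apply: lee_wpmul2l => //.
by rewrite lee_fin mulr_ge0 ?pi_ge0.
Unshelve. all: by end_near. Qed.

Let vanishesD a b : vanishes a -> vanishes b -> vanishes (a \+ b)%R.
Proof.
move=> va vb; have ma : measurable_fun setT a by case: va.
have mb : measurable_fun setT b by case: vb.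
split; first exact: measurable_funD.
apply: cvge0_le => [k|eta eta0]; first exact: poisson_defect_ge0.
have va4 := vanishes_near va (divr_gt0 eta0 (ltr0Sn R 3)).
have vb4 := vanishes_near vb (divr_gt0 eta0 (ltr0Sn R 3)).
near=> k; apply: le_trans (poisson_defectD_le (eps_gt0 k) ma mb) _.
have -> : eta = 2 * (eta / 4) + 2 * (eta / 4) by field.
by rewrite [leRHS]EFinD; apply: leeD; rewrite [leRHS]EFinM; apply: lee_wpmul2l;
  rewrite ?lee_fin//; near: k.
Unshelve. all: by end_near. Qed.

Let vanishesZ (c : R) a : vanishes a -> vanishes (fun x => c * a x).
Proof.
move=> va; have ma : measurable_fun setT a by case: va.
split; first by apply: measurable_funM => //; exact: measurable_cst.
have -> : (fun k => poisson_defect (eps k) (fun x => c * a x)) =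
          (fun k => (c ^+ 2)%:E * poisson_defect (eps k) a)%E.
  apply/funext => k; rewrite /poisson_defect -ge0_integralZl//; last 3 first.
  - apply/measurable_EFinP; apply: measurable_funM.
      exact: measurable_poisson_kernelB.
    by apply: measurable_funX; apply: measurable_funB; exact: measurableT_comp.
  - by move=> p _; rewrite lee_fin mulr_ge0 ?sqr_ge0 ?poisson_kernel_ge0.
  - by rewrite lee_fin sqr_ge0.
  by apply: eq_integral => p _; rewrite -EFinM; congr EFin; ring.
by rewrite -(mule0 (c ^+ 2)%:E); apply: cvgeZl => //; case: va.
Qed.

Let vanishes0 : vanishes (cst 0).
Proof.
split; first exact: measurable_cst.
have -> : (fun k => poisson_defect (eps k) (cst 0)) = cst 0%E.
  apply/funext => k; apply: integral0_eq => p _ /=.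
  by rewrite subrr expr0n mulr0.
exact: cvg_cst.
Qed.

(** The squared difference of the indicator at two points is 1 exactly when one of them lies in V,
    so by symmetry the defect is twice the integral over V of the Poisson mass [g] of the
    complement. Around a point of V the complement stays at a positive distance, hence [g] tends to
    0 there, and pi times the indicator of V dominates. *)
Let vanishes_open V : open V -> (mu V < +oo)%E -> vanishes (\1_V).
Proof.
move=> oV Vfin.
have mV : measurable V by exact: open_measurable.
split; first exact: measurable_indic.
have K0 k (p : R * R) : 0 <= poisson_kernel (eps k) (p.1 - p.2).
  exact: poisson_kernel_ge0.
pose g k x := (\int[mu]_y (poisson_kernel (eps k) (x - y) * \1_(~` V) y)%:E)%E.
have mPx k (x : R) : measurable_fun setT (fun y : measurableTypeR R => poisson_kernel (eps k) (x - y)).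
  apply: (measurableT_comp (f := poisson_kernel (eps k))).
    by apply: continuous_measurable_fun; exact: continuous_poisson_kernel.
  exact: measurable_funB.
have mVC : measurable_fun setT (\1_(~` V) : R -> R).
  by apply: measurable_indic; exact: measurableC.
have mV1 : measurable_fun setT (\1_V : R -> R) by exact: measurable_indic.
have g0 k x : (0 <= g k x)%E.
  apply: integral_ge0 => y _; rewrite lee_fin mulr_ge0 ?poisson_kernel_ge0//.
have mPV k : measurable_fun setT (fun p : measurableTypeR R * measurableTypeR R =>
    (poisson_kernel (eps k) (p.1 - p.2) * \1_(~` V) p.2)%:E).
  apply/measurable_EFinP; apply: measurable_funM.
    exact: measurable_poisson_kernelB.
  exact: (measurableT_comp mVC).
have mg k : measurable_fun setT (g k).
  apply: (measurable_fun_fubini_tonelli_F (fun p : measurableTypeR R * measurableTypeR R =>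
    (poisson_kernel (eps k) (p.1 - p.2) * \1_(~` V) p.2)%:E)) => //.
  by move=> p; rewrite lee_fin mulr_ge0.
have gpi k x : (g k x <= pi%:E)%E.
  rewrite -(integral_poisson_kernel x (eps_gt0 k)).
  apply: ge0_le_integral => //.
  - by move=> y _; rewrite lee_fin mulr_ge0 ?poisson_kernel_ge0.
  - by apply/measurable_EFinP; exact: measurable_funM.
  - exact/measurable_EFinP.
  - move=> y _; rewrite lee_fin ler_piMr ?poisson_kernel_ge0//.
have gcvg x : V x -> g k x @[k --> \oo] --> 0%E.
  move=> Vx.
  have [d /= d0 dV] : nbhs_ball x V by apply/nbhs_ballP; exact: open_nbhs_nbhs.
  (* For z^2 >= d^2 one has 1/z^2 <= (1 + 1/d^2) / (1 + z^2), so away from x the kernel at height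
     eps is at most eps (1 + 1/d^2) times the kernel at height 1, whose mass is pi. *)
  pose M := (1 + (d ^+ 2)^-1) * pi : R.
  have M0 : 0 < M by rewrite mulr_gt0 ?pi_gt0// ltr_pwDl// invr_ge0 sqr_ge0.
  have gM k : (g k x <= (eps k * M)%:E)%E.
    rewrite /M mulrA EFinM -(integral_poisson_kernel x ltr01).
    rewrite -ge0_integralZl//; last 3 first.
    - apply/measurable_EFinP; apply: (measurableT_comp (f := poisson_kernel 1)).
        by apply: continuous_measurable_fun; exact: continuous_poisson_kernel.
      exact: measurable_funB.
    - by move=> y _; rewrite lee_fin poisson_kernel_ge0.
    - by rewrite lee_fin mulr_ge0 ?(ltW (eps_gt0 k))// addr_ge0 ?invr_ge0 ?sqr_ge0.
    apply: ge0_le_integral => //.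
    - by move=> y _; rewrite lee_fin mulr_ge0 ?poisson_kernel_ge0.
    - by apply/measurable_EFinP; exact: measurable_funM.
    - apply: emeasurable_funM => //.
      apply/measurable_EFinP; apply: (measurableT_comp (f := poisson_kernel 1)).
        by apply: continuous_measurable_fun; exact: continuous_poisson_kernel.
      exact: measurable_funB.
    - move=> y _; rewrite -EFinM lee_fin indicE.
      have [yV|yV] := boolP (y \in ~` V); last first.
        rewrite mulr0 mulr_ge0 ?poisson_kernel_ge0// mulr_ge0 ?(ltW (eps_gt0 k))//.
        by rewrite addr_ge0 ?invr_ge0 ?sqr_ge0.
      have dxy : d ^+ 2 <= (x - y) ^+ 2.
        rewrite -ler_sqrt ?sqr_ge0// !sqrtr_sqr ger0_norm ?(ltW d0)//.
        rewrite leNgt; apply/negP => xyd.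
        by move: yV; rewrite inE; apply; apply: dV.
      rewrite mulr1 /poisson_kernel -mulrA ler_wpM2l ?(ltW (eps_gt0 k))//.
      have z0 : 0 < (x - y) ^+ 2 by apply: lt_le_trans dxy; exact: exprn_gt0.
      rewrite (@le_trans _ _ ((x - y) ^+ 2)^-1)//.
        by rewrite lef_pV2 ?posrE ?lerDr ?sqr_ge0// ltr_wpDl ?sqr_ge0.
      rewrite expr1n mul1r ler_pdivlMr ?ltr_pwDl ?sqr_ge0// mulrDr mulVf ?gt_eqF//.
      rewrite mulr1 addrC lerD2l lef_pV2 ?posrE// exprn_gt0//.
  apply: cvge0_le => // eta eta0.
  near=> k; apply: le_trans (gM k) _.
  rewrite lee_fin -ler_pdivlMr//.
  near: k; apply: filterS (near_infty_natSinv_lt (PosNum (divr_gt0 eta0 M0))) => k.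
  exact: ltW.
have ->  : (fun k => poisson_defect (eps k) (\1_V)) =
   (fun k => 2%:E * \int[mu]_x ((\1_V x)%:E * g k x))%E.
  apply/funext => k.
  pose h1 (p : measurableTypeR R * measurableTypeR R) : R := poisson_kernel (eps k) (p.1 - p.2) * (\1_V p.1 * \1_(~` V) p.2).
  pose h2 (p : measurableTypeR R * measurableTypeR R) : R := poisson_kernel (eps k) (p.1 - p.2) * (\1_V p.2 * \1_(~` V) p.1).
  have mh1 : measurable_fun setT (EFin \o h1).
    apply/measurable_EFinP; apply: measurable_funM; first exact: measurable_poisson_kernelB.
    by apply: measurable_funM; [exact: (measurableT_comp mV1)|exact: (measurableT_comp mVC)].
  have mh2 : measurable_fun setT (EFin \o h2).
    apply/measurable_EFinP; apply: measurable_funM; first exact: measurable_poisson_kernelB.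
    by apply: measurable_funM; [exact: (measurableT_comp mV1)|exact: (measurableT_comp mVC)].
  have h10 p : (0 <= (EFin \o h1) p)%E by rewrite lee_fin mulr_ge0 ?poisson_kernel_ge0 ?mulr_ge0.
  have h20 p : (0 <= (EFin \o h2) p)%E by rewrite lee_fin mulr_ge0 ?poisson_kernel_ge0 ?mulr_ge0.
  rewrite /poisson_defect (_ : (\int[_]_p _ = \int[pm]_p ((EFin \o h1) p + (EFin \o h2) p))%E); last first.
    apply: eq_integral => p _; rewrite /= -EFinD; congr EFin; rewrite /h1 /h2 -mulrDr.
    congr (_ * _); rewrite !indicE !in_setC.
    by case: (p.1 \in V); case: (p.2 \in V) => /=; ring.
  rewrite ge0_integralD//.
  rewrite (fubini_tonelli1 (EFin \o h1))// (fubini_tonelli2 (EFin \o h2))//.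
  rewrite mule_natl mule2n; congr (_ + _)%E; apply: eq_integral => x _.
    rewrite /fubini_F -ge0_integralZl//; last 2 first.
    - by apply/measurable_EFinP; exact: measurable_funM.
    - by move=> y _; rewrite lee_fin mulr_ge0 ?poisson_kernel_ge0.
    by apply: eq_integral => y _; rewrite -EFinM /h1 /=; congr EFin; ring.
  rewrite /fubini_G -ge0_integralZl//; last 2 first.
  - by apply/measurable_EFinP; exact: measurable_funM.
  - by move=> y _; rewrite lee_fin mulr_ge0 ?poisson_kernel_ge0.
  apply: eq_integral => y _; rewrite -EFinM /h2 /= -opprB poisson_kernelN.
  by congr EFin; ring.
rewrite -(mule0 2%:E); apply: cvgeZl => //.
have := @dominated_convergence _ _ _ mu setT measurableT
  (fun k x => (\1_V x)%:E * g k x)%E (cst 0%E) (fun x => pi%:E * (\1_V x)%:E)%E.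
case.
- by move=> k; apply: emeasurable_funM; [exact/measurable_EFinP|exact: mg].
- exact: measurable_cst.
- apply: aeW => x _; rewrite indicE; have [xV|xV] := boolP (x \in V).
    under eq_cvg do rewrite mul1e.
    by apply: gcvg; move: xV; rewrite inE.
  have -> : (fun k => (false%:R)%:E * g k x)%E = cst 0%E.
    by apply/funext => k; rewrite mul0e.
  exact: cvg_cst.
- apply: integrableZl => //; apply: integrable_ge0 => //.
  by rewrite integral_indic// setIT.
- apply: aeW => x k _; rewrite gee0_abs ?mule_ge0 ?lee_fin//.
  by rewrite muleC lee_wpmul2r ?lee_fin.
- by move=> _ _; rewrite integral_cst// mul0e.
Unshelve. all: by end_near. Qed.

(** Outer regularity encloses A in an open V with small excess, and the squared L^2 distance of the
    two indicators is the measure of that excess. *)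
Let vanishes_indic A : measurable A -> (mu A < +oo)%E -> vanishes (\1_A).
Proof.
move=> mA Afin; apply: vanishes_closed => [|eta eta0]; first exact: measurable_indic.
have [V [oV AV VA]] := lebesgue_regularity_outer mA Afin eta0.
have mV : measurable V by exact: open_measurable.
exists (\1_V); split.
  apply: vanishes_open => //.
  rewrite -(setDUK AV) /mu measureU//.
  - by apply: lte_add_pinfty => //; rewrite (lt_trans VA)// ltry.
  - exact: measurableD.
  - by rewrite setDE setICA setICr setI0.
rewrite (_ : (\int[_]_x _ = \int[mu]_x (\1_(V `\` A) x)%:E)%E); last first.
  apply: eq_integral => x _; congr EFin.
  rewrite !indicE in_setD; have [xA|xA] := boolP (x \in A).
    have -> : x \in V by move: xA; rewrite !inE; exact: AV.
    by rewrite subrr expr0n.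
  by case: (x \in V) => /=; rewrite sub0r ?oppr0 ?expr0n ?sqrrN ?expr1n.
rewrite integral_indic//; last exact: measurableD.
by rewrite setIT; exact: ltW.
Qed.

Let vanishes_sum (I : eqType) (s : seq I) (F : I -> R -> R) :
  (forall i, i \in s -> vanishes (F i)) ->
  vanishes (fun x => \sum_(i <- s) F i x).
Proof.
elim: s => [|i s IH] H.
  rewrite (_ : (fun _ => _) = cst 0); first exact: vanishes0.
  by apply/funext => x; rewrite big_nil.
rewrite (_ : (fun _ => _) = F i \+ (fun x => \sum_(j <- s) F j x)); last first.
  by apply/funext => x; rewrite big_cons.
apply: vanishesD; first by apply: H; rewrite mem_head.
by apply: IH => j js; apply: H; rewrite in_cons js orbT.
Qed.

Import HBNNSimple.

(** Each nonzero level y has finite measure, since y^2 times this measure is at most the integral of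
    f^2. The level 0 may have infinite measure but contributes the zero function. *)
Let vanishes_nnsfun (f : {nnsfun (measurableTypeR R) >-> R}) :
  (\int[mu]_x (f x ^+ 2)%:E < +oo)%E -> vanishes f.
Proof.
move=> fin.
rewrite (_ : (f : R -> R) = fun x => \sum_(y <- finmap.enum_fset (fset_set (range f))) y * \1_(f @^-1` [set y]) x); last first.
  by apply/funext => x; rewrite [LHS]fimfunE fsbig_finite.
apply: vanishes_sum => y _.
have [->|y0] := eqVneq y 0.
  rewrite (_ : (fun _ => _) = cst 0)//; apply/funext => x.
  by rewrite mul0r.
apply: vanishesZ.
have mf1 : measurable (f @^-1` [set y]).
  by rewrite -[X in measurable X]setTI; exact: measurable_funP.
apply: vanishes_indic => //.
have y20 : 0 < y ^+ 2 by rewrite exprn_even_gt0.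
have : ((y ^+ 2)%:E * mu (f @^-1` [set y]) < +oo)%E.
  apply: le_lt_trans fin.
  have -> : mu (f @^-1` [set y]) = (\int[mu]_x (\1_(f @^-1` [set y]) x)%:E)%E.
    by rewrite integral_indic// setIT.
  rewrite -ge0_integralZl//; last 2 first.
  - by apply/measurable_EFinP; exact: measurable_indic.
  - by rewrite lee_fin ltW.
  apply: ge0_le_integral => //.
  - by move=> x _; rewrite mule_ge0 ?lee_fin ?(ltW y20).
  - by apply: emeasurable_funM => //; apply/measurable_EFinP; exact: measurable_indic.
  - by apply/measurable_EFinP; exact: measurable_funX.
  - move=> x _; rewrite -EFinM lee_fin indicE.
    have [|_] := boolP (x \in _); last by rewrite mulr0 sqr_ge0.
    by rewrite inE => /= ->; rewrite mulr1.
rewrite !ltey; apply: contraNneq => ->.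
by rewrite gt0_muley ?lte_fin.
Qed.

(** Simple functions s approach a from below, so that (a - s)^2 is dominated by a^2 and the L^2
    distance tends to 0. *)
Let vanishes_ge0 a : measurable_fun setT a -> (forall x, 0 <= a x) ->
  (\int[mu]_x (a x ^+ 2)%:E < +oo)%E -> vanishes a.
Proof.
move=> ma a0 afin; apply: vanishes_closed => // eta eta0.
have mEa : measurable_fun [set: measurableTypeR R] (EFin \o a) by exact/measurable_EFinP.
pose s := nnsfun_approx measurableT mEa.
have scvg (x : R) : s k x @[k --> \oo] --> a x.
  have H : forall y : R, setT y -> (0 <= (EFin \o a) y)%E by move=> y _; rewrite lee_fin.
  have := cvg_nnsfun_approx measurableT mEa H (Logic.I : setT x).
  by move/fine_cvgP => [].
have sa k x : s k x <= a x.
  have <- : limn (s ^~ x) = a x by apply/cvg_lim => //; exact: scvg.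
  apply: (nondecreasing_cvgn_le (u_ := s ^~ x)).
    by move=> m p mp; apply/lefP: x; exact: nd_nnsfun_approx.
  by apply/cvg_ex; exists (a x); exact: scvg.
have a2fin : (\int[mu]_x (a x ^+ 2)%:E \is a fin_num)%E.
  by rewrite ge0_fin_numE// integral_ge0// => x _; rewrite lee_fin sqr_ge0.
have ia2 : mu.-integrable setT (EFin \o (fun x => a x ^+ 2)).
  apply: integrable_ge0 => //; first exact: measurable_funX.
  by move=> x; rewrite sqr_ge0.
have : (\int[mu]_x ((a x - s k x) ^+ 2)%:E)%E @[k --> \oo] --> 0%E.
  have := @dominated_convergence _ _ _ mu setT measurableT
    (fun k x => ((a x - s k x) ^+ 2)%:E) (cst 0%E) (fun x => (a x ^+ 2)%:E).
  case.
  - by move=> k; apply/measurable_EFinP; apply: measurable_funX; exact: measurable_funB.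
  - exact: measurable_cst.
  - apply: aeW => x _.
    apply/fine_cvgP; split; first exact: nearW.
    have -> : 0 = (a x - a x) ^+ 2 by rewrite subrr expr0n.
    apply: (@cvg_comp _ _ _ (fun k => a x - s k x) (fun y => y ^+ 2)); last exact: exprn_continuous.
    by apply: cvgB => //; exact: cvg_cst.
  - exact: ia2.
  - apply: aeW => x k _; rewrite gee0_abs ?lee_fin ?sqr_ge0//.
    have := sa k x; have : 0 <= s k x by []; have := a0 x.
    by move: (a x) (s k x) => u v; nra.
  - by move=> _ _; rewrite integral_cst// mul0e.
move/fine_cvgP => [f0 /cvgr0Pnorm_le H].
have [k [fk Hk]] : exists k, (\int[mu]_x ((a x - s k x) ^+ 2)%:E)%E \is a fin_num /\
    `|fine (\int[mu]_x ((a x - s k x) ^+ 2)%:E)%E| <= eta.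
  have : \forall k \near \oo, (\int[mu]_x ((a x - s k x) ^+ 2)%:E)%E \is a fin_num /\
    `|fine (\int[mu]_x ((a x - s k x) ^+ 2)%:E)%E| <= eta.
    by apply: filterI; [exact: f0|exact: H].
  by case=> N _ /(_ N (leqnn N)) ?; exists N.
exists (s k); split.
  apply: vanishes_nnsfun; apply: le_lt_trans afin.
  apply: ge0_le_integral => //.
  - by move=> x _; rewrite lee_fin sqr_ge0.
  - by apply/measurable_EFinP; exact: measurable_funX.
  - by apply/measurable_EFinP; exact: measurable_funX.
  - by move=> x _; rewrite lee_fin ler_sqr ?nnegrE.
rewrite -(fineK fk) lee_fin; apply: le_trans Hk; exact: ler_norm.
Qed.

Lemma cvg_poisson_defect a : measurable_fun setT a ->
  (\int[mu]_x (a x ^+ 2)%:E < +oo)%E ->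
  poisson_defect k.+1%:R^-1 a @[k --> \oo] --> 0%E.
Proof.
move=> ma afin.
suff : vanishes a by case.
have le2 (b : R -> R) : measurable_fun setT b -> (forall x, `|b x| <= `|a x|) ->
    (\int[mu]_x (b x ^+ 2)%:E < +oo)%E.
  move=> mb ba; apply: le_lt_trans afin; apply: ge0_le_integral => //.
  - by move=> x _; rewrite lee_fin sqr_ge0.
  - by apply/measurable_EFinP; exact: measurable_funX.
  - by apply/measurable_EFinP; exact: measurable_funX.
  - by move=> x _; rewrite lee_fin -real_normK ?num_real// -[leRHS]real_normK ?num_real// ler_sqr ?nnegrE.
have -> : a = (a^\+ \+ (fun x => -1 * a^\- x))%R.
  apply/funext => x; rewrite /= mulN1r.
  rewrite /funrpos /funrneg /Order.max.
  by case: ifPn; case: ifPn; rewrite -?leNgt => ? ?; lra.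
apply: vanishesD; last apply: vanishesZ; apply: vanishes_ge0.
- exact: measurable_funrpos.
- by move=> x; exact: funrpos_ge0.
- apply: le2; first exact: measurable_funrpos.
  by move=> x; rewrite /funrpos /Order.max; case: ifP => _; rewrite ?normr0.
- exact: measurable_funrneg.
- by move=> x; exact: funrneg_ge0.
- apply: le2; first exact: measurable_funrneg.
  by move=> x; rewrite /funrneg /Order.max; case: ifP => _; rewrite ?normr0 ?normrN.
Qed.

End poisson_defect_cvg.

(** * Plancherel's identity for real functions of one variable *)

Section real_plancherel.
Context {R : realType}.
Let mu := @lebesgue_measure R.
Local Notation pm := (mu \x mu)%E.
Variable a : R -> R.
Hypothesis ia : mu.-integrable setT (EFin \o a).
Hypothesis a2 : (\int[mu]_x (a x ^+ 2)%:E < +oo)%E.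

Let ma : measurable_fun setT a.
Proof. by have /measurable_EFinP := measurable_int _ ia. Qed.

(** For the real function a, the unnormalised Fourier transform is the cosine transform minus i
    times the sine transform, so the sum of their squares is its squared modulus. *)
Definition cos_transform (xi : R) : R := Rintegral mu setT (fun x => cos (x * xi) * a x).
Definition sin_transform (xi : R) : R := Rintegral mu setT (fun x => sin (x * xi) * a x).

Local Notation C := cos_transform.
Local Notation S := sin_transform.

Let mprod : measurable_fun setT (fun p : measurableTypeR R * measurableTypeR R => p.1 * p.2).
Proof. exact: measurable_funM. Qed.

Let mcos : measurable_fun setT (cos : R -> R).
Proof. by apply: continuous_measurable_fun; exact: continuous_cos. Qed.

Let msin : measurable_fun setT (sin : R -> R).
Proof. by apply: continuous_measurable_fun; exact: continuous_sin. Qed.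

Let cos1 (x : R) : `|cos x| <= 1. Proof. by rewrite ler_norml cos_geN1 cos_le1. Qed.
Let sin1 (x : R) : `|sin x| <= 1. Proof. by rewrite ler_norml sin_geN1 sin_le1. Qed.

Let measurable_kernelx (h : R -> R) (xi : R) : measurable_fun setT h ->
  measurable_fun setT (fun x : measurableTypeR R => h (x * xi)).
Proof.
move=> mh; apply: (measurableT_comp mh).
by apply: measurable_funM => //; exact: measurable_cst.
Qed.

Lemma measurable_cos_transform : measurable_fun setT C.
Proof.
apply: (measurable_Rintegral21 mu (h := fun p => cos (p.1 * p.2) * a p.1)).
by apply: measurable_funM; [exact: (measurableT_comp mcos)|exact: (measurableT_comp ma)].
Qed.

Lemma measurable_sin_transform : measurable_fun setT S.
Proof.
apply: (measurable_Rintegral21 mu (h := fun p => sin (p.1 * p.2) * a p.1)).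
by apply: measurable_funM; [exact: (measurableT_comp msin)|exact: (measurableT_comp ma)].
Qed.

Let A := Rintegral mu setT (fun x => `|a x|).

Let A_ge0 : 0 <= A. Proof. by apply: Rintegral_ge0 => x _. Qed.

Lemma cos_transform_le xi : `|C xi| <= A.
Proof.
have := normr_Rintegral_bddM (measurable_kernelx xi mcos) (fun x => cos1 _) ia.
by rewrite mul1r.
Qed.

Lemma sin_transform_le xi : `|S xi| <= A.
Proof.
have := normr_Rintegral_bddM (measurable_kernelx xi msin) (fun x => sin1 _) ia.
by rewrite mul1r.
Qed.

Let damp e (xi : R) := expR (- (e * `|xi|)).

Let idamp (e : R) : 0 < e -> mu.-integrable setT (EFin \o damp e).
Proof. exact: integrable_expRN_norm. Qed.

(** The addition formula turns the integrand into the integral of cos((x - y) xi) a(y); damping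
    permits the exchange of integrals, and the damped cosine integrates to twice the Poisson
    kernel. *)
Let correlation (e x : R) : 0 < e ->
  Rintegral mu setT (fun xi => damp e xi * (cos (x * xi) * C xi + sin (x * xi) * S xi)) =
  Rintegral mu setT (fun y => 2 * poisson_kernel e (x - y) * a y).
Proof.
move=> e0.
pose h (p : measurableTypeR R * measurableTypeR R) :=
  cos ((x - p.2) * p.1) * (damp e p.1 * a p.2).
have ih : pm.-integrable setT (EFin \o h).
  apply: (integrable_bddM (K := 1)) => //.
    apply: (measurableT_comp mcos); apply: measurable_funM => //.
    by apply: measurable_funB => //; exact: measurable_cst.
  apply: (integrable_prodM (m1 := mu) (m2 := mu)) => //.
  exact: idamp.
have [_ e1] := Rintegral12_prod ih.
have [_ e2] := Rintegral21_prod ih.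
transitivity (Rintegral mu setT (fun xi => Rintegral mu setT (fun y => h (xi, y)))).
  apply: eq_Rintegral => xi _; rewrite /h /=.
  have ic := integrable_bddM (measurable_kernelx xi mcos) (fun x => cos1 _) ia.
  have is_ := integrable_bddM (measurable_kernelx xi msin) (fun x => sin1 _) ia.
  transitivity (Rintegral mu setT (fun y =>
      (damp e xi * cos (x * xi)) * (cos (y * xi) * a y) +
      (damp e xi * sin (x * xi)) * (sin (y * xi) * a y))).
    rewrite RintegralD//; last 2 first.
    - exact: (integrableZl measurableT _ ic).
    - exact: (integrableZl measurableT _ is_).
    by rewrite !RintegralZl// mulrDr !mulrA.
  apply: eq_Rintegral => y _; rewrite mulrBl cosB; ring.
rewrite -e1 e2.
apply: eq_Rintegral => y _; rewrite /h /=.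
transitivity (Rintegral mu setT (fun xi => (damp e xi * cos ((x - y) * xi)) * a y)).
  by apply: eq_Rintegral => xi _; ring.
rewrite RintegralZr//.
  by rewrite /Rintegral integral_expRN_norm_cos.
have := integrable_bddM (measurableT_comp mcos (_ : measurable_fun setT (fun xi : measurableTypeR R => (x - y) * xi))) (fun x => cos1 _) (idamp e0).
move=> H; under eq_fun do rewrite mulrC; apply: H.
by apply: measurable_funM => //; exact: measurable_cst.
Qed.

Let energy_integrable (e : R) : 0 < e ->
  mu.-integrable setT (fun xi => (damp e xi * (C xi ^+ 2 + S xi ^+ 2))%:E).
Proof.
move=> e0.
have H : measurable_fun setT (fun xi : measurableTypeR R => C xi ^+ 2 + S xi ^+ 2).
  by apply: measurable_funD; apply: measurable_funX;
    [exact: measurable_cos_transform|exact: measurable_sin_transform].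
have Hb xi : `|C xi ^+ 2 + S xi ^+ 2| <= 2 * A ^+ 2.
  rewrite ger0_norm ?addr_ge0 ?sqr_ge0// mulrDl !mul1r.
  rewrite -(real_normK (num_real (C xi))) -(real_normK (num_real (S xi))).
  by rewrite lerD// ler_sqr ?nnegrE ?cos_transform_le ?sin_transform_le.
have := integrable_bddM H Hb (idamp e0).
by under eq_fun do rewrite mulrC.
Qed.

(** One factor of each square is written as an integral against a and the order of integration is
    exchanged, which leaves the expression computed by [correlation]. Boundedness of both transforms
    and the damping justify Fubini. *)
Let energy_correlation (e : R) : 0 < e ->
  Rintegral mu setT (fun xi => damp e xi * (C xi ^+ 2 + S xi ^+ 2)) =
  Rintegral mu setT (fun x => a x *
    Rintegral mu setT (fun y => 2 * poisson_kernel e (x - y) * a y)).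
Proof.
move=> e0.
pose h (p : measurableTypeR R * measurableTypeR R) :=
  (cos (p.1 * p.2) * C p.2 + sin (p.1 * p.2) * S p.2) * (a p.1 * damp e p.2).
have mC2 : measurable_fun setT (fun p : measurableTypeR R * measurableTypeR R => C p.2).
  exact: (measurableT_comp measurable_cos_transform).
have mS2 : measurable_fun setT (fun p : measurableTypeR R * measurableTypeR R => S p.2).
  exact: (measurableT_comp measurable_sin_transform).
have ih : pm.-integrable setT (EFin \o h).
  apply: (integrable_bddM (K := 2 * A)) => //.
  - apply: measurable_funD; apply: measurable_funM => //.
      exact: (measurableT_comp mcos).
    exact: (measurableT_comp msin).
  - move=> p; rewrite (le_trans (ler_normD _ _))// mulrDl !mul1r !normrM.
    by rewrite lerD// -[leRHS]mul1r ler_pM// ?cos_transform_le ?sin_transform_le.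
  - apply: (integrable_prodM (m1 := mu) (m2 := mu)) => //.
    exact: idamp.
have [_ e1] := Rintegral12_prod ih.
have [_ e2] := Rintegral21_prod ih.
transitivity (Rintegral mu setT (fun xi => Rintegral mu setT (fun x => h (x, xi)))).
  apply: eq_Rintegral => xi _; rewrite /h /=.
  have ic := integrable_bddM (measurable_kernelx xi mcos) (fun x => cos1 _) ia.
  have is_ := integrable_bddM (measurable_kernelx xi msin) (fun x => sin1 _) ia.
  transitivity (Rintegral mu setT (fun x =>
      (damp e xi * C xi) * (cos (x * xi) * a x) +
      (damp e xi * S xi) * (sin (x * xi) * a x))).
    rewrite RintegralD//; last 2 first.
    - exact: (integrableZl measurableT _ ic).
    - exact: (integrableZl measurableT _ is_).
    by rewrite !RintegralZl// -/(C xi) -/(S xi); ring.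
  apply: eq_Rintegral => x _; ring.
rewrite -e2 e1.
apply: eq_Rintegral => x _; rewrite /h /= -correlation// -RintegralZl//.
  by apply: eq_Rintegral => xi _; ring.
have Hm : measurable_fun setT (fun xi : measurableTypeR R => cos (x * xi) * C xi + sin (x * xi) * S xi).
  apply: measurable_funD; apply: measurable_funM;
   try exact: measurable_cos_transform; try exact: measurable_sin_transform.
    by under eq_fun do rewrite mulrC; exact: measurable_kernelx.
  by under eq_fun do rewrite mulrC; exact: measurable_kernelx.
have Hb xi : `|cos (x * xi) * C xi + sin (x * xi) * S xi| <= 2 * A.
  rewrite (le_trans (ler_normD _ _))// mulrDl !mul1r !normrM.
  by rewrite lerD// -[leRHS]mul1r ler_pM// ?cos_transform_le ?sin_transform_le.
have := integrable_bddM Hm Hb (idamp e0).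
by under eq_fun do rewrite mulrC.
Qed.

Let E2 := Rintegral mu setT (fun x => a x ^+ 2).

Let ia2 : mu.-integrable setT (EFin \o (fun x => a x ^+ 2)).
Proof.
apply: integrable_ge0 => //; first exact: measurable_funX.
by move=> x; exact: sqr_ge0.
Qed.

(** By 2 a(x) a(y) = a(x)^2 + a(y)^2 - (a(x) - a(y))^2, the correlation with the Poisson kernel is
    the full energy minus the defect. This is Plancherel's identity with an explicit nonnegative
    error. *)
Let energy_defect (e : R) : 0 < e ->
  (\int[mu]_xi (damp e xi * (C xi ^+ 2 + S xi ^+ 2))%:E + poisson_defect e a
   = (2 * pi * E2)%:E)%E.
Proof.
move=> e0.
pose P (p : measurableTypeR R * measurableTypeR R) := poisson_kernel e (p.1 - p.2).
have mP : measurable_fun setT P by exact: measurable_poisson_kernelB.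
have P0 p : 0 <= P p by exact: poisson_kernel_ge0.
pose H1 p := P p * a p.1 ^+ 2.
pose H2 p := P p * a p.2 ^+ 2.
pose H p := P p * (a p.1 * a p.2).
have ma1 : measurable_fun setT (fun p : measurableTypeR R * measurableTypeR R => a p.1).
  exact: (measurableT_comp ma).
have ma2 : measurable_fun setT (fun p : measurableTypeR R * measurableTypeR R => a p.2).
  exact: (measurableT_comp ma).
have mH1 : measurable_fun setT H1 by apply: measurable_funM => //; exact: measurable_funX.
have mH2 : measurable_fun setT H2 by apply: measurable_funM => //; exact: measurable_funX.
have mH : measurable_fun setT H by apply: measurable_funM => //; exact: measurable_funM.
have I1 : (\int[pm]_p (H1 p)%:E = (pi * E2)%:E)%E.
  rewrite (integral_poisson_kernel1 (b := fun x => a x ^+ 2))//.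
  - by rewrite EFinM EFin_Rintegral.
  - exact: measurable_funX.
  - by move=> x; exact: sqr_ge0.
have I2 : (\int[pm]_p (H2 p)%:E = (pi * E2)%:E)%E.
  rewrite (integral_poisson_kernel2 (b := fun x => a x ^+ 2))//.
  - by rewrite EFinM EFin_Rintegral.
  - exact: measurable_funX.
  - by move=> x; exact: sqr_ge0.
have iH1 : pm.-integrable setT (EFin \o H1).
  apply: integrable_ge0 => //; last by rewrite I1 ltry.
  by move=> p; rewrite mulr_ge0 ?sqr_ge0.
have iH2 : pm.-integrable setT (EFin \o H2).
  apply: integrable_ge0 => //; last by rewrite I2 ltry.
  by move=> p; rewrite mulr_ge0 ?sqr_ge0.
have iH : pm.-integrable setT (EFin \o H).
  apply: le_integrable (integrableD measurableT iH1 iH2) => //.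
    exact/measurable_EFinP.
  move=> p _; rewrite /= lee_fin /H /H1 /H2 -mulrDr [leLHS]normrM [leRHS]normrM.
  rewrite ler_wpM2l// [leRHS]ger0_norm ?addr_ge0 ?sqr_ge0//.
  rewrite ler_norml; move: (a p.1) (a p.2) => u v.
  have := sqr_ge0 (u - v); have := sqr_ge0 (u + v).
  by move=> h1 h2; apply/andP; split; nra.
have -> : poisson_defect e a = (\int[pm]_p ((H1 p + H2 p)%:E - (2 * H p)%:E))%E.
  by apply: eq_integral => p _; rewrite -EFinB /H /H1 /H2 /P; congr EFin; ring.
have iH12 : pm.-integrable setT (EFin \o (fun p => H1 p + H2 p)).
  exact: (integrableD measurableT iH1 iH2).
have i2H : pm.-integrable setT (EFin \o (fun p => 2 * H p)).
  exact: (integrableZl measurableT _ iH).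
rewrite integralB_EFin//.
have -> : (\int[pm]_p (H1 p + H2 p)%:E = (2 * pi * E2)%:E)%E.
  under eq_integral do rewrite EFinD.
  rewrite (integralD measurableT iH1 iH2) I1 I2 -EFinD; congr EFin; ring.
have -> : (\int[pm]_p (2 * H p)%:E = \int[mu]_xi (damp e xi * (C xi ^+ 2 + S xi ^+ 2))%:E)%E.
  rewrite -!EFin_Rintegral//; last exact: energy_integrable.
  congr EFin; rewrite energy_correlation//.
  have [_ ->] := Rintegral12_prod i2H.
  apply: eq_Rintegral => x _; rewrite /H /P /= -RintegralZl//.
    by apply: eq_Rintegral => y _; ring.
  apply: (integrable_bddM (K := 2 * e^-1)) => //.
    apply: measurable_funM; first exact: measurable_cst.
    apply: (measurableT_comp (f := poisson_kernel e)).
      by apply: continuous_measurable_fun; exact: continuous_poisson_kernel.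
    exact: measurable_funB.
  move=> y; rewrite ger0_norm; last by rewrite mulr_ge0// poisson_kernel_ge0.
  apply: ler_wpM2l => //.
  rewrite /poisson_kernel ler_pdivrMr ?poisson_kernel_den_gt0// mulrDr.
  have -> : e^-1 * e ^+ 2 = e by field; rewrite gt_eqF.
  by rewrite lerDl mulr_ge0 ?sqr_ge0 ?invr_ge0 ?(ltW e0).
rewrite -EFin_Rintegral; last exact: energy_integrable.
by rewrite -EFinB -EFinD addrC subrK.
Qed.

(** As the damping is removed in [energy_defect], the damped energy converges monotonically and the
    defect vanishes. *)
Lemma real_plancherel :
  (\int[mu]_xi (C xi ^+ 2 + S xi ^+ 2)%:E = (2 * pi)%:E * \int[mu]_x (a x ^+ 2)%:E)%E.
Proof.
rewrite (_ : (\int[mu]_x (a x ^+ 2)%:E = E2%:E)%E) -?EFinM; last first.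
  by rewrite /E2 EFin_Rintegral.
pose eps (k : nat) : R := k.+1%:R^-1.
have eps0 k : 0 < eps k by rewrite invr_gt0.
have mC := measurable_cos_transform; have mS := measurable_sin_transform.
have cvg1 : (\int[mu]_xi (damp (eps k) xi * (C xi ^+ 2 + S xi ^+ 2))%:E)%E @[k --> \oo]
    --> (\int[mu]_xi (C xi ^+ 2 + S xi ^+ 2)%:E)%E.
  have CS0 xi : 0 <= C xi ^+ 2 + S xi ^+ 2 by rewrite addr_ge0 ?sqr_ge0.
  have dcvg xi : (damp (eps k) xi * (C xi ^+ 2 + S xi ^+ 2))%:E @[k --> \oo] --> (C xi ^+ 2 + S xi ^+ 2)%:E.
    apply/fine_cvgP; split; first exact: nearW.
    rewrite -[X in _ --> X]mul1r; apply: cvgM; last exact: cvg_cst.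
    rewrite -expR0; apply: (@cvg_comp _ _ _ (fun k => - (eps k * `|xi|)) expR).
      2: exact: continuous_expR.
    rewrite -oppr0; apply: cvgN; rewrite -(mul0r `|xi|); apply: cvgM; last exact: cvg_cst.
    exact: cvg_harmonic.
  have -> : (\int[mu]_xi (C xi ^+ 2 + S xi ^+ 2)%:E = \int[mu]_xi
     limn (fun k => (damp (eps k) xi * (C xi ^+ 2 + S xi ^+ 2))%:E))%E.
    by apply: eq_integral => xi _; apply/esym/cvg_lim => //; exact: dcvg.
  apply: cvg_monotone_convergence => //.
  - move=> k; apply/measurable_EFinP; apply: measurable_funM.
      exact: measurable_expRN_norm.
    by apply: measurable_funD; exact: measurable_funX.
  - by move=> k xi _; rewrite lee_fin mulr_ge0 ?expR_ge0.
  - move=> xi _ k l kl; rewrite lee_fin ler_wpM2r// ler_expR lerN2 ler_wpM2r//.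
    by rewrite lef_pV2 ?posrE// ler_nat ltnS.
have cvg2 : (2 * pi * E2)%:E @[_ --> \oo] --> (\int[mu]_xi (C xi ^+ 2 + S xi ^+ 2)%:E + 0)%E.
  under eq_cvg => k do rewrite -(energy_defect (eps0 k)).
  apply: cvgeD => //.
  - apply: ge0_adde_def; rewrite inE// integral_ge0// => xi _.
    by rewrite lee_fin addr_ge0 ?sqr_ge0.
  - by apply: cvg_poisson_defect.
rewrite adde0 in cvg2.
have := cvg_unique _ cvg2 (@cvg_cst _ (2 * pi * E2)%:E _ \oo _).
exact.
Qed.

End real_plancherel.

(** * Isometric integral kernels *)

Local Open Scope complex_scope.

Local Notation Re := complex.Re.
Local Notation Im := complex.Im.

(** * Complex-valued integrals and squared L^2 norms *)

Section complex_energy.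
Context {R : realType}.
Implicit Types z w : R[i].

Definition sqn z : R := Re z ^+ 2 + Im z ^+ 2.

Lemma sqn_ge0 z : 0 <= sqn z. Proof. by rewrite addr_ge0 ?sqr_ge0. Qed.

Lemma normcE z : Normc.normc z = Num.sqrt (sqn z).
Proof. by case: z. Qed.

Lemma Re_normc z : `|Re z| <= Normc.normc z.
Proof. by rewrite normcE -sqrtr_sqr ler_wsqrtr ?lerDl ?sqr_ge0. Qed.

Lemma Im_normc z : `|Im z| <= Normc.normc z.
Proof. by rewrite normcE -sqrtr_sqr ler_wsqrtr ?lerDr ?sqr_ge0. Qed.

Lemma sqr_normc z : Normc.normc z ^+ 2 = sqn z.
Proof. by rewrite normcE sqr_sqrtr ?sqn_ge0. Qed.

Lemma ReD z w : Re (z + w) = Re z + Re w. Proof. by case: z; case: w. Qed.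
Lemma ImD z w : Im (z + w) = Im z + Im w. Proof. by case: z; case: w. Qed.
Lemma ReN z : Re (- z) = - Re z. Proof. by case: z. Qed.
Lemma ImN z : Im (- z) = - Im z. Proof. by case: z. Qed.
Lemma ReM z w : Re (z * w) = Re z * Re w - Im z * Im w.
Proof. by case: z; case: w. Qed.
Lemma ImM z w : Im (z * w) = Re z * Im w + Im z * Re w.
Proof. by case: z => a b; case: w => c d. Qed.

Lemma eq_complexP z w : Re z = Re w -> Im z = Im w -> z = w.
Proof. by case: z => a b; case: w => c d /= -> ->. Qed.

Lemma sqnM z w : sqn (z * w) = sqn z * sqn w.
Proof. rewrite /sqn ReM ImM; ring. Qed.

Lemma sqnN z : sqn (- z) = sqn z.
Proof. by rewrite /sqn ReN ImN !sqrrN. Qed.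

Lemma sqn_real (a : R) : sqn a%:C = a ^+ 2.
Proof. by rewrite /sqn /= expr0n addr0. Qed.

Lemma sqnD_le z w : sqn (z + w) <= 2 * sqn z + 2 * sqn w.
Proof.
rewrite /sqn ReD ImD; move: (Re z) (Im z) (Re w) (Im w) => a b c d.
by have := sqr_ge0 (a - c); have := sqr_ge0 (b - d); nra.
Qed.

End complex_energy.

Section complex_integral.
Context d (T : measurableType d) (R : realType).
Variable m : {measure set T -> \bar R}.
Implicit Types (f g : T -> R[i]).

Definition cmfun f :=
  measurable_fun setT (fun x => Re (f x)) /\ measurable_fun setT (fun x => Im (f x)).

Definition cL1 f :=
  m.-integrable setT (fun x => (Re (f x))%:E) /\ m.-integrable setT (fun x => (Im (f x))%:E).

Definition cint f : R[i] :=
  Rintegral m setT (fun x => Re (f x)) +i* Rintegral m setT (fun x => Im (f x)).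

Definition energy f : \bar R := (\int[m]_x (sqn (f x))%:E)%E.

Lemma energy_ge0 f : (0 <= energy f)%E.
Proof. by apply: integral_ge0 => x _; rewrite lee_fin sqn_ge0. Qed.

Lemma cL1_cmfun f : cL1 f -> cmfun f.
Proof. by move=> [/measurable_int/measurable_EFinP + /measurable_int/measurable_EFinP]. Qed.

Lemma cmfunD f g : cmfun f -> cmfun g -> cmfun (fun x => f x + g x).
Proof.
move=> [fr fi] [gr gi]; split.
- by under eq_fun do rewrite ReD; exact: measurable_funD.
- by under eq_fun do rewrite ImD; exact: measurable_funD.
Qed.

Lemma cmfunN f : cmfun f -> cmfun (fun x => - f x).
Proof.
move=> [fr fi]; split.
- by under eq_fun do rewrite ReN; exact: measurable_funN.
- by under eq_fun do rewrite ImN; exact: measurable_funN.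
Qed.

Lemma cmfunB f g : cmfun f -> cmfun g -> cmfun (fun x => f x - g x).
Proof. by move=> mf mg; apply: cmfunD => //; exact: cmfunN. Qed.

Lemma cmfunM f g : cmfun f -> cmfun g -> cmfun (fun x => f x * g x).
Proof.
move=> [fr fi] [gr gi]; split.
- under eq_fun do rewrite ReM.
  by apply: measurable_funB; exact: measurable_funM.
- under eq_fun do rewrite ImM.
  by apply: measurable_funD; exact: measurable_funM.
Qed.

Lemma cmfun_real (h : T -> R) : measurable_fun setT h -> cmfun (fun x => (h x)%:C).
Proof. by move=> mh; split => //=; exact: measurable_cst. Qed.

Lemma measurable_sqn f : cmfun f -> measurable_fun setT (fun x => (sqn (f x))%:E).
Proof.
move=> [fr fi]; apply/measurable_EFinP.
by apply: measurable_funD; exact: measurable_funX.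
Qed.

Lemma cL1D f g : cL1 f -> cL1 g -> cL1 (fun x => f x + g x).
Proof.
move=> [fr fi] [gr gi]; split.
- under eq_fun do rewrite ReD EFinD.
  exact: (integrableD measurableT fr gr).
- under eq_fun do rewrite ImD EFinD.
  exact: (integrableD measurableT fi gi).
Qed.

Lemma cL1_bddM K f g : cmfun f -> (forall x, `|Re (f x)| <= K /\ `|Im (f x)| <= K) ->
  cL1 g -> cL1 (fun x => f x * g x).
Proof.
move=> [fr fi] fK [gr gi]; split.
- under eq_fun do rewrite ReM EFinB.
  apply: (integrableB measurableT).
    by apply: (integrable_bddM (K := K) (h := fun x => Re (f x)) fr _ gr) => x; case: (fK x).
  by apply: (integrable_bddM (K := K) (h := fun x => Im (f x)) fi _ gi) => x; case: (fK x).
- under eq_fun do rewrite ImM EFinD.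
  apply: (integrableD measurableT).
    by apply: (integrable_bddM (K := K) (h := fun x => Re (f x)) fr _ gi) => x; case: (fK x).
  by apply: (integrable_bddM (K := K) (h := fun x => Im (f x)) fi _ gr) => x; case: (fK x).
Qed.

Lemma cintZ z f : cL1 f -> cint (fun x => z * f x) = z * cint f.
Proof.
move=> [fr fi]; apply: eq_complexP; rewrite ?ReM ?ImM /=.
- under eq_Rintegral do rewrite ReM.
  rewrite RintegralB//; last 2 first.
  - exact: (integrableZl measurableT _ fr).
  - exact: (integrableZl measurableT _ fi).
  by rewrite !RintegralZl.
- under eq_Rintegral do rewrite ImM.
  rewrite RintegralD//; last 2 first.
  - exact: (integrableZl measurableT _ fi).
  - exact: (integrableZl measurableT _ fr).
  by rewrite !RintegralZl.
Qed.

Lemma cintD f g : cL1 f -> cL1 g -> cint (fun x => f x + g x) = cint f + cint g.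
Proof.
move=> [fr fi] [gr gi]; apply: eq_complexP; rewrite ?ReD ?ImD /=.
- under eq_Rintegral do rewrite ReD.
  by rewrite RintegralD.
- under eq_Rintegral do rewrite ImD.
  by rewrite RintegralD.
Qed.

Lemma cint_le f (u : T -> R) : cL1 f -> m.-integrable setT (EFin \o u) ->
  (forall x, `|Re (f x)| <= u x /\ `|Im (f x)| <= u x) ->
  `|Re (cint f)| <= Rintegral m setT u /\ `|Im (cint f)| <= Rintegral m setT u.
Proof.
move=> [fr fi] iu fu; split => /=.
  apply: le_trans (le_normr_Rintegral _ fr) _ => //.
  apply: le_Rintegral => //; first exact: integrable_norm.
  by move=> x _; case: (fu x).
apply: le_trans (le_normr_Rintegral _ fi) _ => //.
apply: le_Rintegral => //; first exact: integrable_norm.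
by move=> x _; case: (fu x).
Qed.

Lemma ae_eq_cint f g : cmfun f -> cmfun g -> {ae m, forall x, f x = g x} ->
  cint f = cint g.
Proof.
move=> [fr fi] [gr gi] fg; congr (_ +i* _); congr fine; apply: ae_eq_integral => //;
  try exact/measurable_EFinP; by apply: filterS fg => x -> _.
Qed.

Lemma energyD_le f g : cmfun f -> cmfun g ->
  (energy (fun x => f x + g x)%R <= 2%:E * energy f + 2%:E * energy g)%E.
Proof.
move=> mf mg; rewrite /energy -!ge0_integralZl//; first last.
- by move=> x _; rewrite lee_fin sqn_ge0.
- exact: measurable_sqn.
- by move=> x _; rewrite lee_fin sqn_ge0.
- exact: measurable_sqn.
rewrite -ge0_integralD//; first last.
- by apply: emeasurable_funM => //; exact: measurable_sqn.
- by move=> x _; rewrite mule_ge0 ?lee_fin ?sqn_ge0.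
- by apply: emeasurable_funM => //; exact: measurable_sqn.
- by move=> x _; rewrite mule_ge0 ?lee_fin ?sqn_ge0.
apply: ge0_le_integral => //.
- by move=> x _; rewrite lee_fin sqn_ge0.
- by apply: measurable_sqn; exact: cmfunD.
- by apply: emeasurable_funD; apply: emeasurable_funM => //; exact: measurable_sqn.
- by move=> x _; rewrite -!EFinM -EFinD lee_fin sqnD_le.
Qed.

Lemma le_energy f g : cmfun f -> cmfun g -> (forall x, sqn (f x) <= sqn (g x)) ->
  (energy f <= energy g)%E.
Proof.
move=> mf mg fg; apply: ge0_le_integral => //; try exact: measurable_sqn.
- by move=> x _; rewrite lee_fin sqn_ge0.
- by move=> x _; rewrite lee_fin.
Qed.

End complex_integral.

(** * Integral transforms with bounded kernels *)

Section kernel_transform.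
Context d (T : measurableType d) (R : realType).
Variable m : {measure set T -> \bar R}.
Implicit Types (k : T -> T -> R[i]) (f : T -> R[i]).

Definition bounded_kernel k := cmfun (fun p : T * T => k p.1 p.2) /\
  exists K : R, forall x y, `|Re (k x y)| <= K /\ `|Im (k x y)| <= K.

Definition transform k f y : R[i] := cint m (fun x => k x y * f x).

(** Required only for functions in both L^1 and L^2, where a bounded kernel gives an absolutely
    convergent integral. *)
Definition isometric k := forall f, cL1 m f -> (energy m f < +oo)%E ->
  energy m (transform k f) = energy m f.

Lemma cmfun_kernel_slice k y : bounded_kernel k -> cmfun (fun x => k x y).
Proof.
move=> [[kr ki] _]; split.
- exact: (measurableT_comp kr (measurable_pair2 y)).
- exact: (measurableT_comp ki (measurable_pair2 y)).
Qed.

Lemma cL1_kernel k f y : bounded_kernel k -> cL1 m f -> cL1 m (fun x => k x y * f x).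
Proof.
move=> bk fL1; have [_ [K kK]] := bk.
by apply: (cL1_bddM (K := K)) => //; exact: cmfun_kernel_slice.
Qed.

Lemma transformD k f g : bounded_kernel k -> cL1 m f -> cL1 m g ->
  transform k (fun x => f x + g x) = fun y => transform k f y + transform k g y.
Proof.
move=> bk fL1 gL1; apply/funext => y; rewrite /transform -cintD; last 2 first.
- exact: cL1_kernel.
- exact: cL1_kernel.
by congr cint; apply/funext => x; rewrite mulrDr.
Qed.

End kernel_transform.

Lemma cmfun_transform d (T : measurableType d) (R : realType)
    (m : {sigma_finite_measure set T -> \bar R}) (k : T -> T -> R[i]) (f : T -> R[i]) :
  bounded_kernel k -> cmfun f -> cmfun (transform m k f).
Proof.
move=> [mk _] [fr fi].
have mkf : cmfun (fun p : T * T => k p.1 p.2 * f p.1).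
  by apply: cmfunM => //; split; [exact: (measurableT_comp fr)|exact: (measurableT_comp fi)].
case: mkf => mr mi; split.
- exact: (measurable_Rintegral21 m (h := fun p => Re (k p.1 p.2 * f p.1))).
- exact: (measurable_Rintegral21 m (h := fun p => Im (k p.1 p.2 * f p.1))).
Qed.


Section complex_fubini.
Context d1 d2 (T1 : measurableType d1) (T2 : measurableType d2) (R : realType).
Variables (m1 : {sigma_finite_measure set T1 -> \bar R}).
Variables (m2 : {sigma_finite_measure set T2 -> \bar R}).
Implicit Types (h : T1 * T2 -> R[i]).

Lemma cint12_prod h : cL1 (m1 \x m2)%E h ->
  cint (m1 \x m2)%E h = cint m1 (fun x => cint m2 (fun y => h (x, y))).
Proof.
move=> [hr hi]; apply: eq_complexP => /=.
- by have [_ ->] := Rintegral12_prod (h := fun p => Re (h p)) hr.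
- by have [_ ->] := Rintegral12_prod (h := fun p => Im (h p)) hi.
Qed.

Lemma ae_cL1_slice h : cL1 (m1 \x m2)%E h ->
  {ae m1, forall x, cL1 m2 (fun y => h (x, y))}.
Proof.
move=> [hr hi]; have h1 := ae_integrable1 hr; have h2 := ae_integrable1 hi.
by apply: filterS2 h1 h2 => x; split.
Qed.

Lemma cmfun_slice2 h y : cmfun h -> cmfun (fun x => h (x, y)).
Proof.
move=> [hr hi]; split.
- exact: (measurableT_comp hr (measurable_pair2 y)).
- exact: (measurableT_comp hi (measurable_pair2 y)).
Qed.

Lemma energy12 h : cmfun h ->
  energy (m1 \x m2)%E h = (\int[m1]_x energy m2 (fun y => h (x, y)))%E.
Proof.
move=> mh; rewrite /energy (fubini_tonelli1 (fun p => (sqn (h p))%:E))//.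
- exact: measurable_sqn.
- by move=> p; rewrite lee_fin sqn_ge0.
Qed.

Lemma energy21 h : cmfun h ->
  energy (m1 \x m2)%E h = (\int[m2]_y energy m1 (fun x => h (x, y)))%E.
Proof.
move=> mh; rewrite /energy (fubini_tonelli2 (fun p => (sqn (h p))%:E))//.
- exact: measurable_sqn.
- by move=> p; rewrite lee_fin sqn_ge0.
Qed.

Lemma measurable_energy12 h : cmfun h ->
  measurable_fun setT (fun x => energy m2 (fun y => h (x, y))).
Proof.
move=> mh; apply: (measurable_fun_fubini_tonelli_F (fun p => (sqn (h p))%:E)).
- exact: measurable_sqn.
- by move=> p; rewrite lee_fin sqn_ge0.
Qed.

Lemma measurable_energy21 h : cmfun h ->
  measurable_fun setT (fun y => energy m1 (fun x => h (x, y))).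
Proof.
move=> mh; apply: (measurable_fun_fubini_tonelli_G (fun p => (sqn (h p))%:E)).
- exact: measurable_sqn.
- by move=> p; rewrite lee_fin sqn_ge0.
Qed.

End complex_fubini.

Lemma ae_fin_integral d (T : measurableType d) (R : realType)
    (m : {measure set T -> \bar R}) (F : T -> \bar R) :
  measurable_fun setT F -> (forall x, 0 <= F x)%E -> (\int[m]_x F x < +oo)%E ->
  {ae m, forall x, (F x < +oo)%E}.
Proof.
move=> mF F0 Ffin.
have iF : m.-integrable setT F.
  by apply/integrableP; split => //; under eq_integral do rewrite gee0_abs//.
apply: filterS (integrable_ae measurableT iF) => x /(_ Logic.I).
by rewrite ge0_fin_numE.
Qed.

(** * Tensor products of isometric kernels *)

Section kernel_product.
Context d1 d2 (T1 : measurableType d1) (T2 : measurableType d2) (R : realType).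
Variables (m1 : {sigma_finite_measure set T1 -> \bar R}).
Variables (m2 : {sigma_finite_measure set T2 -> \bar R}).
Variables (k1 : T1 -> T1 -> R[i]) (k2 : T2 -> T2 -> R[i]).
Hypotheses (bk1 : bounded_kernel k1) (bk2 : bounded_kernel k2).

Definition kernel_prod (p q : T1 * T2) := k1 p.1 q.1 * k2 p.2 q.2.

Lemma bounded_kernel_prod : bounded_kernel kernel_prod.
Proof.
have [[r1 i1] [K1 b1]] := bk1; have [[r2 i2] [K2 b2]] := bk2.
have m11 : measurable_fun setT (fun p : (T1 * T2) * (T1 * T2) => (p.1.1, p.2.1)).
  by apply/measurable_fun_pairP; split; [exact: (measurableT_comp measurable_fst measurable_fst)|
    exact: (measurableT_comp measurable_fst measurable_snd)].
have m22 : measurable_fun setT (fun p : (T1 * T2) * (T1 * T2) => (p.1.2, p.2.2)).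
  by apply/measurable_fun_pairP; split; [exact: (measurableT_comp measurable_snd measurable_fst)|
    exact: (measurableT_comp measurable_snd measurable_snd)].
split.
  apply: (cmfunM (f := fun p : (T1 * T2) * (T1 * T2) => k1 p.1.1 p.2.1)).
    by split; [exact: (measurableT_comp r1 m11)|exact: (measurableT_comp i1 m11)].
  by split; [exact: (measurableT_comp r2 m22)|exact: (measurableT_comp i2 m22)].
exists (K1 * K2 + K1 * K2) => p q; rewrite /kernel_prod ReM ImM.
have [? ?] := b1 p.1 q.1; have [? ?] := b2 p.2 q.2; split.
  by rewrite (le_trans (ler_normB _ _))// !normrM lerD// ler_pM.
by rewrite (le_trans (ler_normD _ _))// !normrM lerD// ler_pM.
Qed.

Section isometric_product.
Hypotheses (iso1 : isometric m1 k1) (iso2 : isometric m2 k2).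
Variable f : T1 * T2 -> R[i].
Hypotheses (fL1 : cL1 (m1 \x m2)%E f) (fL2 : (energy (m1 \x m2)%E f < +oo)%E).

Let mf : cmfun f. Proof. exact: cL1_cmfun fL1. Qed.

(** The transform in the second variable alone. Transforming it in the first variable gives the full
    transform, so each of the two isometries is applied to slices. *)
Let g (p : T1 * T2) : R[i] := transform m2 k2 (fun x2 => f (p.1, x2)) p.2.

Let mg : cmfun g.
Proof.
have [kr ki] := proj1 bk2; have [fr fi] := mf.
have mk : measurable_fun setT (fun p : (T1 * T2) * T2 => (p.2, p.1.2)).
  by apply/measurable_fun_pairP; split;
    [exact: measurable_snd|exact: (measurableT_comp measurable_snd measurable_fst)].
have mx : measurable_fun setT (fun p : (T1 * T2) * T2 => (p.1.1, p.2)).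
  by apply/measurable_fun_pairP; split;
    [exact: (measurableT_comp measurable_fst measurable_fst)|exact: measurable_snd].
have [hr hi] : cmfun (fun p : (T1 * T2) * T2 => k2 p.2 p.1.2 * f (p.1.1, p.2)).
  apply: cmfunM; split.
  - exact: (measurableT_comp kr mk).
  - exact: (measurableT_comp ki mk).
  - exact: (measurableT_comp fr mx).
  - exact: (measurableT_comp fi mx).
split.
- exact: (measurable_Rintegral12 m2 (h := fun p : (T1 * T2) * T2 => Re (k2 p.2 p.1.2 * f (p.1.1, p.2)))).
- exact: (measurable_Rintegral12 m2 (h := fun p : (T1 * T2) * T2 => Im (k2 p.2 p.1.2 * f (p.1.1, p.2)))).
Qed.

Let energy_fin_slice : {ae m1, forall x1, (energy m2 (fun x2 => f (x1, x2)) < +oo)%E}.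
Proof.
apply: ae_fin_integral.
- exact: measurable_energy12.
- by move=> x; exact: energy_ge0.
- by rewrite -energy12.
Qed.

Let energy_g : energy (m1 \x m2)%E g = energy (m1 \x m2)%E f.
Proof.
rewrite (energy12 m1 m2 mg) (energy12 m1 m2 mf).
apply: ae_eq_integral; first exact: measurableT.
- exact: measurable_energy12 mg.
- exact: measurable_energy12 mf.
have H1 := ae_cL1_slice fL1.
apply: filterS2 H1 energy_fin_slice => x1 h1 h2 _.
exact: (iso2 h1 h2).
Qed.

(** Valid for every y2, not merely almost every: the slice of [k2] at y2 is bounded, so its product
    with f is integrable on the product space and Fubini makes the partial integral integrable. *)
Let cL1_g y2 : cL1 m1 (fun x1 => g (x1, y2)).
Proof.
have [_ [K kK]] := bk2.
have mk : cmfun (fun p : T1 * T2 => k2 p.2 y2).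
  have [kr ki] := cmfun_kernel_slice y2 bk2.
  by split; [exact: (measurableT_comp kr)|exact: (measurableT_comp ki)].
have [hr hi] : cL1 (m1 \x m2)%E (fun p => k2 p.2 y2 * f p).
  by apply: (cL1_bddM (K := K)) => //.
split.
- by have [] := Rintegral12_prod (h := fun p => Re (k2 p.2 y2 * f p)) hr.
- by have [] := Rintegral12_prod (h := fun p => Im (k2 p.2 y2 * f p)) hi.
Qed.

(** Pulling [k1] out of the inner integral needs an integrable slice of f, available for almost
    every x1. This suffices under the outer integral, so the identity itself holds at every y. *)
Let transform_prodE y : transform (m1 \x m2)%E kernel_prod f y =
  transform m1 k1 (fun x1 => g (x1, y.2)) y.1.
Proof.
have hL1 := cL1_kernel y bounded_kernel_prod fL1.
rewrite /transform cint12_prod//; apply: ae_eq_cint.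
- have [hr hi] := cL1_cmfun hL1; split.
  + exact: (measurable_Rintegral12 m2 (h := fun p => Re (kernel_prod p y * f p))).
  + exact: (measurable_Rintegral12 m2 (h := fun p => Im (kernel_prod p y * f p))).
- apply: cmfunM; first exact: cmfun_kernel_slice.
  exact: cmfun_slice2.
have H1 := ae_cL1_slice fL1.
apply: filterS H1 => x1 h1; rewrite /g /transform -cintZ.
  by congr cint; apply/funext => x2; rewrite /kernel_prod /= mulrA.
exact: cL1_kernel.
Qed.

Let mt : cmfun (transform (m1 \x m2)%E kernel_prod f).
Proof.
have [kr ki] := proj1 bk1; have [gr gi] := mg.
have mk : measurable_fun setT (fun p : (T1 * T2) * T1 => (p.2, p.1.1)).
  by apply/measurable_fun_pairP; split;
    [exact: measurable_snd|exact: (measurableT_comp measurable_fst measurable_fst)].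
have mx : measurable_fun setT (fun p : (T1 * T2) * T1 => (p.2, p.1.2)).
  by apply/measurable_fun_pairP; split;
    [exact: measurable_snd|exact: (measurableT_comp measurable_snd measurable_fst)].
have [hr hi] : cmfun (fun p : (T1 * T2) * T1 => k1 p.2 p.1.1 * g (p.2, p.1.2)).
  apply: cmfunM; split.
  - exact: (measurableT_comp kr mk).
  - exact: (measurableT_comp ki mk).
  - exact: (measurableT_comp gr mx).
  - exact: (measurableT_comp gi mx).
rewrite (_ : transform _ _ _ = fun y => transform m1 k1 (fun x1 => g (x1, y.2)) y.1); last first.
  by apply/funext => y; exact: transform_prodE.
split.
- exact: (measurable_Rintegral12 m1 (h := fun p : (T1 * T2) * T1 => Re (k1 p.2 p.1.1 * g (p.2, p.1.2)))).
- exact: (measurable_Rintegral12 m1 (h := fun p : (T1 * T2) * T1 => Im (k1 p.2 p.1.1 * g (p.2, p.1.2)))).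
Qed.

(** Applying [iso1] requires slices of [g] in L^2; almost all are, because [g] has the same finite
    energy as f by the isometry in the other variable. *)
Lemma energy_transform_prod :
  energy (m1 \x m2)%E (transform (m1 \x m2)%E kernel_prod f) = energy (m1 \x m2)%E f.
Proof.
rewrite -energy_g (energy21 m1 m2 mt).
rewrite (energy21 m1 m2 mg); apply: ae_eq_integral; first exact: measurableT.
- exact: measurable_energy21 mt.
- exact: measurable_energy21 mg.
have gfin : {ae m2, forall y2, (energy m1 (fun x1 => g (x1, y2)) < +oo)%E}.
  apply: ae_fin_integral.
  - exact: measurable_energy21.
  - by move=> x; exact: energy_ge0.
  - by rewrite -energy21// energy_g.
apply: filterS gfin => y2 h2 _.
rewrite -(iso1 (cL1_g y2) h2); congr (energy m1 _).
by apply/funext => y1; exact: transform_prodE.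
Qed.

End isometric_product.

Lemma isometric_prod : isometric m1 k1 -> isometric m2 k2 ->
  isometric (m1 \x m2)%E kernel_prod.
Proof. by move=> iso1 iso2 f fL1 fL2; exact: energy_transform_prod. Qed.

End kernel_product.

(** * The Fourier transform on R^n *)

Section fourier_line.
Context {R : realType}.
Let mu : {sigma_finite_measure set (measurableTypeR R) -> \bar R} := @lebesgue_measure R.

Lemma ge0_integral_oppr (f : R -> \bar R) : measurable_fun setT f ->
  (forall x, 0 <= f x)%E -> (\int[mu]_x f (- x)%R = \int[mu]_x f x)%E.
Proof.
move=> mf f0; transitivity (\int[pushforward mu (-%R : _ -> measurableTypeR R)]_x f x)%E.
  by rewrite ge0_integral_pushforward//; exact: oppr_measurable.
by apply: eq_measure_integral => A mA _; exact: lebesgue_measureN.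
Qed.

Lemma sqn_cexp_i (t : R) : sqn (cexp_i t) = 1.
Proof. by rewrite /sqn /= cos2Dsin2. Qed.

Lemma cexp_iD (s t : R) : cexp_i (s + t) = cexp_i s * cexp_i t.
Proof.
apply: eq_complexP; rewrite ?ReM ?ImM /=; first exact: cosD.
by rewrite sinD; ring.
Qed.

Definition fourier_const n : R := (2 * pi) `^ (- (n%:R / 2)).

Lemma fourier_const_gt0 n : 0 < fourier_const n.
Proof. by apply: powR_gt0; rewrite mulr_gt0 ?pi_gt0. Qed.

Lemma fourier_constD m n : fourier_const (m + n) = fourier_const m * fourier_const n.
Proof.
rewrite /fourier_const -powRD; last first.
  by apply/implyP => _; rewrite gt_eqF// mulr_gt0// pi_gt0.
by congr (_ `^ _); rewrite natrD; field.
Qed.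

Lemma fourier_const1 : fourier_const 1 ^+ 2 * (2 * pi) = 1.
Proof.
have p0 : 0 < 2 * pi :> R by rewrite mulr_gt0 ?pi_gt0.
rewrite expr2 -fourier_constD /fourier_const.
have -> : - ((1 + 1)%:R / 2) = -1 :> R by rewrite natrD; field.
by rewrite powR_inv1 ?ltW// mulVf ?gt_eqF.
Qed.

Definition line_kernel (x xi : measurableTypeR R) : R[i] :=
  (fourier_const 1)%:C * cexp_i (- (x * xi)).

Lemma measurable_cexp_i d (T : measurableType d) (h : T -> R) :
  measurable_fun setT h -> cmfun (fun x => cexp_i (h x)).
Proof.
move=> mh; split => /=.
- apply: (measurableT_comp (f := cos)) => //.
  by apply: continuous_measurable_fun; exact: continuous_cos.
- apply: (measurableT_comp (f := sin)) => //.
  by apply: continuous_measurable_fun; exact: continuous_sin.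
Qed.

Lemma Re_cexp_i_le1 t : `|Re (cexp_i t)| <= 1 :> R.
Proof. by rewrite ler_norml cos_geN1 cos_le1. Qed.

Lemma Im_cexp_i_le1 t : `|Im (cexp_i t)| <= 1 :> R.
Proof. by rewrite ler_norml sin_geN1 sin_le1. Qed.

Lemma bounded_kernel_cexp_i d (T : measurableType d) (c : R) (h : T -> T -> R) :
  measurable_fun setT (fun p : T * T => h p.1 p.2) ->
  bounded_kernel (fun x y => c%:C * cexp_i (h x y)).
Proof.
move=> mh; split.
  apply: cmfunM; last exact: measurable_cexp_i.
  by apply: (cmfun_real (h := fun _ : T * T => c)); exact: measurable_cst.
exists `|c| => x y; rewrite ReM ImM /= !mul0r subr0 addr0 !normrM.
by split; rewrite ler_piMr// (Re_cexp_i_le1, Im_cexp_i_le1).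
Qed.

Lemma bounded_line_kernel : bounded_kernel line_kernel.
Proof.
apply: (@bounded_kernel_cexp_i _ _ _ (fun x y : measurableTypeR R => - (x * y))).
by apply: measurable_funN; exact: measurable_funM.
Qed.

(** For f = a + i b the squared modulus of the transform contains cross terms between a and b. They
    are odd in xi, so adding the values at xi and - xi removes them and leaves the real Plancherel
    identities of a and b. *)
Lemma isometric_line_kernel : isometric mu line_kernel.
Proof.
move=> f fL1 fL2; have [ia ib] := fL1; have mf := cL1_cmfun fL1; have [ma mb] := mf.
pose a x := Re (f x); pose b x := Im (f x).
have a2 : (\int[mu]_x (a x ^+ 2)%:E < +oo)%E.
  apply: le_lt_trans fL2; apply: ge0_le_integral => //.
  - by move=> x _; rewrite lee_fin sqr_ge0.
  - by apply/measurable_EFinP; exact: measurable_funX.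
  - exact: measurable_sqn.
  - by move=> x _; rewrite lee_fin lerDl sqr_ge0.
have b2 : (\int[mu]_x (b x ^+ 2)%:E < +oo)%E.
  apply: le_lt_trans fL2; apply: ge0_le_integral => //.
  - by move=> x _; rewrite lee_fin sqr_ge0.
  - by apply/measurable_EFinP; exact: measurable_funX.
  - exact: measurable_sqn.
  - by move=> x _; rewrite lee_fin lerDr sqr_ge0.
have efE : (energy mu f = \int[mu]_x (a x ^+ 2)%:E + \int[mu]_x (b x ^+ 2)%:E)%E.
  rewrite /energy -ge0_integralD//.
  - by move=> x _; rewrite lee_fin sqr_ge0.
  - by apply/measurable_EFinP; exact: measurable_funX.
  - by move=> x _; rewrite lee_fin sqr_ge0.
  - by apply/measurable_EFinP; exact: measurable_funX.
have Pa := real_plancherel ia a2; have Pb := real_plancherel ib b2.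
have mCa := measurable_cos_transform ia; have mSa := measurable_sin_transform ia.
have mCb := measurable_cos_transform ib; have mSb := measurable_sin_transform ib.
pose Ca := cos_transform a; pose Sa := sin_transform a.
pose Cb := cos_transform b; pose Sb := sin_transform b.
pose E xi := (Ca xi + Sb xi) ^+ 2 + (Cb xi - Sa xi) ^+ 2.
have mE : measurable_fun setT E.
  by apply: measurable_funD; apply: measurable_funX; [exact: measurable_funD|exact: measurable_funB].
have E0 xi : 0 <= E xi by rewrite addr_ge0 ?sqr_ge0.
have mcos xi : measurable_fun setT (fun x : measurableTypeR R => cos (x * xi)).
  apply: (measurableT_comp (f := cos)).
    by apply: continuous_measurable_fun; exact: continuous_cos.
  by apply: measurable_funM => //; exact: measurable_cst.
have msin xi : measurable_fun setT (fun x : measurableTypeR R => sin (x * xi)).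
  apply: (measurableT_comp (f := sin)).
    by apply: continuous_measurable_fun; exact: continuous_sin.
  by apply: measurable_funM => //; exact: measurable_cst.
have icos (h : R -> R) xi : mu.-integrable setT (EFin \o h) ->
    mu.-integrable setT (EFin \o (fun x => cos (x * xi) * h x)).
  move=> ih; apply: (integrable_bddM (K := 1) (mcos xi)) => // x.
  exact: Re_cexp_i_le1.
have isin (h : R -> R) xi : mu.-integrable setT (EFin \o h) ->
    mu.-integrable setT (EFin \o (fun x => sin (x * xi) * h x)).
  move=> ih; apply: (integrable_bddM (K := 1) (msin xi)) => // x.
  exact: Im_cexp_i_le1.
have cosN (h : R -> R) xi : cos_transform h (- xi) = cos_transform h xi.
  by apply: eq_Rintegral => x _; rewrite mulrN cosN.
have sinN_ (h : R -> R) xi : mu.-integrable setT (EFin \o h) ->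
    sin_transform h (- xi) = - sin_transform h xi.
  move=> ih; rewrite -[RHS]mulN1r /sin_transform -RintegralZl//; last exact: isin.
  by apply: eq_Rintegral => x _; rewrite mulrN sinN; ring.
have tE xi : sqn (transform mu line_kernel f xi) = fourier_const 1 ^+ 2 * E xi.
  have -> : transform mu line_kernel f xi =
      (fourier_const 1)%:C * ((Ca xi + Sb xi) +i* (Cb xi - Sa xi)).
    rewrite /transform /line_kernel.
    under [X in cint _ X]eq_fun do rewrite -mulrA.
    rewrite cintZ; last first.
      apply: (cL1_bddM (K := 1)) => //.
        apply: measurable_cexp_i; apply: measurable_funN.
        by apply: measurable_funM => //; exact: measurable_cst.
      by move=> x; split; [exact: Re_cexp_i_le1|exact: Im_cexp_i_le1].
    congr (_ * (_ +i* _)).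
      rewrite /Ca /Sb -RintegralD//; last 2 first.
      - exact: icos.
      - exact: isin.
      by apply: eq_Rintegral => x _; rewrite ReM /= trigo.cosN sinN /a /b; ring.
    rewrite /Cb /Sa -RintegralB//; last 2 first.
    - exact: icos.
    - exact: isin.
    by apply: eq_Rintegral => x _; rewrite ImM /= trigo.cosN sinN /a /b; ring.
  by rewrite sqnM sqn_real.
have E2 : (2%:E * \int[mu]_xi (E xi)%:E = 2%:E * ((2 * pi)%:E * energy mu f))%E.
  transitivity (\int[mu]_xi ((E xi)%:E + (E (- xi))%:E))%E.
    rewrite ge0_integralD//; last 4 first.
    - by move=> x _; rewrite lee_fin.
    - exact/measurable_EFinP.
    - by move=> x _; rewrite lee_fin.
    - by apply/measurable_EFinP; apply: (measurableT_comp mE); exact: oppr_measurable.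
    rewrite (ge0_integral_oppr (f := fun x => (E x)%:E)) ?mule_natl ?mule2n//.
    exact/measurable_EFinP.
  transitivity (\int[mu]_xi (2%:E * ((Ca xi ^+ 2 + Sa xi ^+ 2)%:E + (Cb xi ^+ 2 + Sb xi ^+ 2)%:E)))%E.
    apply: eq_integral => xi _; rewrite -!EFinD -EFinM; congr EFin.
    by rewrite /E /Ca /Sa /Cb /Sb !cosN !sinN_//; ring.
  have mA : measurable_fun setT (fun xi => (Ca xi ^+ 2 + Sa xi ^+ 2)%:E).
    by apply/measurable_EFinP; apply: measurable_funD; exact: measurable_funX.
  have mB : measurable_fun setT (fun xi => (Cb xi ^+ 2 + Sb xi ^+ 2)%:E).
    by apply/measurable_EFinP; apply: measurable_funD; exact: measurable_funX.
  have A0 xi : (0 <= (Ca xi ^+ 2 + Sa xi ^+ 2)%:E)%E by rewrite lee_fin addr_ge0 ?sqr_ge0.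
  have B0 xi : (0 <= (Cb xi ^+ 2 + Sb xi ^+ 2)%:E)%E by rewrite lee_fin addr_ge0 ?sqr_ge0.
  rewrite ge0_integralZl//; last 2 first.
  - exact: emeasurable_funD.
  - by move=> xi _; rewrite adde_ge0.
  rewrite ge0_integralD// Pa Pb efE; congr (_ * _)%E; rewrite [RHS]ge0_muleDr//.
  - by apply: integral_ge0 => x _; rewrite lee_fin sqr_ge0.
  - by apply: integral_ge0 => x _; rewrite lee_fin sqr_ge0.
have E1 : (\int[mu]_xi (E xi)%:E = (2 * pi)%:E * energy mu f)%E.
  have := congr1 (fun z => (2^-1)%:E * z)%E E2.
  by rewrite !muleA -!EFinM !mulrA mulVf// mul1r mul1e.
rewrite {1}/energy; under eq_integral do rewrite tE EFinM.
rewrite ge0_integralZl//; last 3 first.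
- exact/measurable_EFinP.
- by move=> x _; rewrite lee_fin.
- by rewrite lee_fin sqr_ge0.
by rewrite E1 muleA -EFinM fourier_const1 mul1e.
Qed.

End fourier_line.

(** * Change of variables for isometric kernels *)

Section isometric_pushforward.
Context d1 d2 (T1 : measurableType d1) (T2 : measurableType d2) (R : realType).
Variables (m1 : {measure set T1 -> \bar R}).
Variables (m2 : {measure set T2 -> \bar R}).
Variables (phi : T2 -> T1) (mphi : measurable_fun setT phi).
Hypothesis m1E : m1 = pushforward m2 phi :> (set T1 -> \bar R).
Implicit Types f : T1 -> R[i].

Let cmfun_phi f : cmfun f -> cmfun (f \o phi).
Proof. by move=> [fr fi]; split; [exact: (measurableT_comp fr)|exact: (measurableT_comp fi)]. Qed.

Lemma energy_pushforward f : cmfun f -> energy m1 f = energy m2 (f \o phi).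
Proof.
move=> mf; rewrite /energy m1E ge0_integral_pushforward//.
- exact: measurable_sqn.
- by move=> x _; rewrite lee_fin sqn_ge0.
Qed.

Let integrable_phi (h : T1 -> R) : m1.-integrable setT (EFin \o h) ->
  m2.-integrable setT (EFin \o (h \o phi)).
Proof.
move=> ih; have mh := measurable_int _ ih.
move/integrableP : ih => [_]; rewrite m1E ge0_integral_pushforward//; last first.
  exact: measurableT_comp.
rewrite preimage_setT => ih; apply/integrableP; split => //.
exact: (measurableT_comp mh).
Qed.

Let Rintegral_phi (h : T1 -> R) : m1.-integrable setT (EFin \o h) ->
  Rintegral m1 setT h = Rintegral m2 setT (h \o phi).
Proof.
move=> ih; have mh := measurable_int _ ih.
rewrite /Rintegral m1E (integral_pushforward mphi mh)// preimage_setT.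
exact: integrable_phi.
Qed.

Lemma cL1_pushforward f : cL1 m1 f -> cL1 m2 (f \o phi).
Proof. by move=> [fr fi]; split; [exact: (integrable_phi fr)|exact: (integrable_phi fi)]. Qed.

Lemma cint_pushforward f : cL1 m1 f -> cint m1 f = cint m2 (f \o phi).
Proof.
by move=> [fr fi]; congr (_ +i* _); [exact: (Rintegral_phi fr)|exact: (Rintegral_phi fi)].
Qed.

(** Energy and transform both commute with composition by [phi]. Measurability of transforms is a
    hypothesis because [m1] is not assumed sigma-finite here. *)
Lemma isometric_pushforward k : bounded_kernel k ->
  (forall f, cmfun f -> cmfun (transform m1 k f)) ->
  isometric m2 (fun p q => k (phi p) (phi q)) -> isometric m1 k.
Proof.
move=> bk mk iso f fL1 fL2; have mf := cL1_cmfun fL1.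
rewrite energy_pushforward; last exact: mk.
rewrite [RHS]energy_pushforward// -[RHS]iso; last 2 first.
- exact: cL1_pushforward.
- by rewrite -energy_pushforward.
congr energy; apply/funext => q /=.
by rewrite /transform cint_pushforward//; exact: cL1_kernel.
Qed.

End isometric_pushforward.

(** * The Fourier kernel in dimension n *)

Section fourier_space.
Context {R : realType}.

Definition fourier_kernel n (x xi : Rn R n) : R[i] :=
  (fourier_const n)%:C * cexp_i (- dotp x xi).

Lemma measurable_dotp n : measurable_fun setT (fun p : Rn R n * Rn R n => dotp p.1 p.2).
Proof.
apply: measurable_sum => i; apply: measurable_funM.
- exact: (measurableT_comp (measurable_tnth i) measurable_fst).
- exact: (measurableT_comp (measurable_tnth i) measurable_snd).
Qed.

Lemma bounded_fourier_kernel n : bounded_kernel (@fourier_kernel n).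
Proof.
apply: (@bounded_kernel_cexp_i _ _ _ _ (fun x y : Rn R n => - dotp x y)).
apply: measurable_funN; exact: measurable_dotp.
Qed.

Lemma dotp_cons n (p q : measurableTypeR R * Rn R n) :
  dotp (cons_pair p) (cons_pair q) = p.1 * q.1 + dotp p.2 q.2.
Proof.
rewrite /dotp big_ord_recl; congr (_ + _).
apply: eq_bigr => i _; rewrite !(tnth_nth 0) /=.
by [].
Qed.

(** In dimension 0 the measure is a unit mass and the kernel is 1, so the transform is the identity.
    Splitting off one coordinate factors both the exponential and the normalising constant, which
    exhibits the kernel as a product. *)
Lemma isometric_fourier_kernel n : isometric (lebesgue n) (@fourier_kernel n).
Proof.
elim: n => [|n IH].
  move=> f fL1 fL2; congr energy; apply/funext => y; rewrite /transform.
  have H (h : Rn R 0 -> R) : measurable_fun setT h -> Rintegral (lebesgue 0) setT h = h y.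
    move=> mh; rewrite /Rintegral /= integral_dirac//; last exact/measurable_EFinP.
    by rewrite diracT mul1e /= (tuple0 y).
  have [mr mi] := cL1_cmfun (cL1_kernel y (bounded_fourier_kernel 0) fL1).
  rewrite /cint (H _ mr) (H _ mi).
  rewrite /fourier_kernel /fourier_const mul0r oppr0 powRr0 /dotp big_ord0 oppr0.
  rewrite /cexp_i cos0 sin0 mul1r.
  by apply: eq_complexP => //=; rewrite ?ReM ?ImM /= ?mul1r ?mul0r ?subr0 ?addr0.
apply: (@isometric_pushforward _ _ _ _ _ (lebesgue n.+1) (@lebesgue_measure R \x lebesgue n)%E
  (@cons_pair R n)) => //.
- exact: measurable_cons_pair.
- exact: bounded_fourier_kernel.
- by move=> f; apply: cmfun_transform; exact: bounded_fourier_kernel.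
rewrite (_ : (fun p q => _) = kernel_prod line_kernel (@fourier_kernel n)); last first.
  apply/funext => p; apply/funext => q; rewrite /kernel_prod /line_kernel /fourier_kernel.
  rewrite dotp_cons opprD cexp_iD -[in fourier_const n.+1]addn1 addnC fourier_constD.
  by rewrite rmorphM /=; ring.
apply: isometric_prod => //.
- exact: bounded_line_kernel.
- exact: bounded_fourier_kernel.
- exact: isometric_line_kernel.
Qed.

End fourier_space.

(** * Completeness of L^2 *)

Lemma cvg_of_geometric_increments {R : realType} (v : nat -> R) (M : R) :
  (forall j, 4 ^+ j * (v j.+1 - v j) ^+ 2 <= M) -> cvgn v.
Proof.
move=> H; have M0 : 0 <= M by apply: le_trans (H 0%N); rewrite mulr_ge0 ?sqr_ge0.
have H2 j : `|v j.+1 - v j| <= Num.sqrt M * 2^-1 ^+ j.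
  have p2 : 0 < 2 ^+ j :> R by rewrite exprn_gt0.
  rewrite exprVn ler_pdivlMr// -(gtr0_norm p2) -normrM -sqrtr_sqr ler_wsqrtr//.
  by rewrite exprMn mulrC -exprM mulnC exprM (_ : 2 ^+ 2 = 4 :> R)//; ring.
have -> : v = (fun n => v 0%N + series (telescope v) n).
  by apply/funext => n; exact: eq_sum_telescope.
apply: is_cvgD; first exact: is_cvg_cst.
apply: normed_cvg; apply: (series_le_cvg (v_ := geometric (Num.sqrt M) 2^-1)).
- by move=> j /=.
- by move=> j; rewrite /= mulr_ge0 ?sqrtr_ge0 ?exprn_ge0.
- by move=> j; exact: H2.
- by apply: is_cvg_geometric_series; rewrite ger0_norm// invf_lt1// ltr1n.
Qed.

Section riesz_fischer.
Context d (T : measurableType d) (R : realType) (m : {measure set T -> \bar R}).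
Variable u : nat -> T -> R[i].
Hypothesis mu_ : forall j, cmfun (u j).
Hypothesis u_cauchy : forall j l, (j <= l)%N ->
  (energy m (fun x => u l x - u j x)%R <= (16^-1 ^+ j)%:E)%E.

Let inc j x := u j.+1 x - u j x.

(** The weights 4^j against increments of energy at most 16^(-j) give a series of finite integral.
    Where its sum is finite, the increments are O(2^(-j)), so the sequence converges pointwise. *)
Let D x : \bar R := (\sum_(j <oo) ((4 ^+ j)%:E * (sqn (inc j x))%:E))%E.

Let D_term_ge0 j x : (0 <= (4 ^+ j)%:E * (sqn (inc j x))%:E :> \bar R)%E.
Proof. by rewrite mule_ge0// lee_fin ?sqn_ge0// exprn_ge0. Qed.

Let minc j : cmfun (inc j).
Proof. exact: cmfunB. Qed.

Let mterm j : measurable_fun setT (fun x => (4 ^+ j)%:E * (sqn (inc j x))%:E)%E.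
Proof. by apply: emeasurable_funM => //; exact: measurable_sqn. Qed.

Let D_ae_fin : {ae m, forall x, (D x < +oo)%E}.
Proof.
apply: ae_fin_integral.
- by apply: (ge0_emeasurable_sum (P := xpredT)) => // j x _ _.
- by move=> x; apply: nneseries_ge0 => j _ _.
rewrite integral_nneseries//.
apply: (@le_lt_trans _ _ (\sum_(j <oo) ((2 / (2 ^ j.+1)%:R)%:E : \bar R))%E).
  apply: lee_nneseries => j _; first by move=> _; exact: integral_ge0.
  rewrite ge0_integralZl//; last 2 first.
  - exact: measurable_sqn.
  - by move=> x _; rewrite lee_fin sqn_ge0.
  apply: (@le_trans _ _ ((4 ^+ j)%:E * (16^-1 ^+ j)%:E)%E).
    by apply: lee_wpmul2l; [rewrite lee_fin exprn_ge0|exact: u_cauchy].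
  rewrite -EFinM lee_fin natrX exprS invfM mulrA divff// mul1r -exprMn -exprVn.
  by apply: lerXn2r; rewrite ?nnegrE; lra.
apply: (@le_lt_trans _ _ (2%:E)%E); last exact: ltry.
exact: (epsilon_trick0 xpredT).
Qed.

Let cvg_u x : (D x < +oo)%E -> cvgn (fun j => Re (u j x)) /\ cvgn (fun j => Im (u j x)).
Proof.
move=> Dx.
have Dfin : D x \is a fin_num by rewrite ge0_fin_numE// nneseries_ge0.
have H j : 4 ^+ j * sqn (inc j x) <= fine (D x).
  rewrite -lee_fin fineK// /D.
  apply: le_trans (nneseries_lim_ge j.+1 _) => //.
  by rewrite big_nat_recr//= leeDr// sume_ge0.
split; apply: (@cvg_of_geometric_increments _ _ (fine (D x))) => j;
  apply: le_trans (H j); rewrite ler_wpM2l ?exprn_ge0// /sqn /inc ReD ImD ReN ImN.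
- by rewrite lerDl sqr_ge0.
- by rewrite lerDr sqr_ge0.
Qed.

(** Fatou's lemma transfers the Cauchy bound to the pointwise limit, so the rate survives and not
    only the convergence. *)
Lemma riesz_fischer : exists g, cmfun g /\
  forall j, (energy m (fun x => g x - u j x)%R <= (16^-1 ^+ j)%:E)%E.
Proof.
(* An upper limit is measurable without any exceptional set. It is the true limit wherever [D] is
   finite, hence almost everywhere; elsewhere its value is immaterial. *)
pose gr x := fine (limn_esup (fun j => (Re (u j x))%:E)).
pose gi x := fine (limn_esup (fun j => (Im (u j x))%:E)).
pose g x : R[i] := gr x +i* gi x.
have mg : cmfun g.
  split; apply: (measurableT_comp (fine_measurable measurableT)).
  - by apply: (measurable_fun_limn_esup (f := fun j x => (Re (u j x))%:E)) => j;
      apply/measurable_EFinP; case: (mu_ j).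
  - by apply: (measurable_fun_limn_esup (f := fun j x => (Im (u j x))%:E)) => j;
      apply/measurable_EFinP; case: (mu_ j).
have gE x : (D x < +oo)%E -> Re (u j x) @[j --> \oo] --> gr x /\ Im (u j x) @[j --> \oo] --> gi x.
  move=> /cvg_u[cr ci]; rewrite /gr /gi.
  have er : (Re (u j x))%:E @[j --> \oo] --> (limn (fun j => Re (u j x)))%:E.
    by apply: cvg_EFin; [exact: nearW|exact: cr].
  have ei : (Im (u j x))%:E @[j --> \oo] --> (limn (fun j => Im (u j x)))%:E.
    by apply: cvg_EFin; [exact: nearW|exact: ci].
  by rewrite (cvg_limn_einf_sup er) (cvg_limn_einf_sup ei).
exists g; split => // j.
have mgu l : cmfun (fun x => u l x - u j x) by exact: cmfunB.
apply: (@le_trans _ _ (\int[m]_x limn_einf (fun l => (sqn (u l x - u j x))%:E))%E).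
  rewrite le_eqVlt; apply/orP; left; apply/eqP; apply: ae_eq_integral; first exact: measurableT.
  - by apply: measurable_sqn; exact: cmfunB.
  - apply: (eq_measurable_fun (fun x => - limn_esup (fun l => - (sqn (u l x - u j x))%:E))%E).
      move=> x _; have := limn_esupN (fun l => (sqn (u l x - u j x))%:E).
      by rewrite /comp => ->; rewrite oppeK.
    apply: measurableT_comp => //.
    apply: (measurable_fun_limn_esup (f := fun l x => - (sqn (u l x - u j x))%:E)%E) => l.
    by apply: measurableT_comp => //; exact: measurable_sqn.
  apply: filterS D_ae_fin => x /gE[cr ci] _; apply/esym.
  have c : (sqn (u l x - u j x))%:E @[l --> \oo] --> (sqn (g x - u j x))%:E.
    apply: cvg_EFin; first exact: nearW.
    have sE z w : sqn (z - w) = (Re z - Re w) ^+ 2 + (Im z - Im w) ^+ 2 :> R.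
      by rewrite /sqn ReD ImD ReN ImN.
    rewrite sE; under eq_cvg do rewrite /= sE.
    have sqr_cvg (a : nat -> R) (b : R) : a l @[l --> \oo] --> b ->
        a l ^+ 2 @[l --> \oo] --> b ^+ 2.
      by move=> ab; apply: (@cvg_comp _ _ _ a (fun y => y ^+ 2) _ (nbhs b)) => //; exact: exprn_continuous.
    by apply: cvgD; apply: sqr_cvg; (apply: cvgB; [|exact: cvg_cst]).
  by rewrite (cvg_limn_einf_sup c).
apply: le_trans (@fatou _ _ _ m setT measurableT (fun l x => (sqn (u l x - u j x))%:E) _ _) _.
- by move=> l; exact: measurable_sqn.
- by move=> l x _; rewrite lee_fin sqn_ge0.
rewrite limn_einf_lim; apply: lime_le; first exact: is_cvg_einfs.
(* The infimum over the tail from l on is at most its member of index [maxn l j], which is late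
   enough for the Cauchy bound at j. *)
near=> l; apply: (@le_trans _ _ (energy m (fun x => u (maxn l j) x - u j x)%R)).
  apply: ereal_inf_lbound; exists (maxn l j) => //=.
  exact: leq_maxl.
by apply: u_cauchy; exact: leq_maxr.
Unshelve. all: by end_near. Qed.

End riesz_fischer.

(** * Conjugate and adjoint kernels *)

Section adjoint_kernel.
Context d (T : measurableType d) (R : realType).
Variable m : {sigma_finite_measure set T -> \bar R}.
Variable k : T -> T -> R[i].
Hypotheses (bk : bounded_kernel k) (iso : isometric m k).
Implicit Types f g : T -> R[i].

Definition cconj (z : R[i]) : R[i] := Re z +i* (- Im z).

Lemma sqn_cconj z : sqn (cconj z) = sqn z.
Proof. by rewrite /sqn /= sqrrN. Qed.

Lemma cL1_cconj f : cL1 m f -> cL1 m (fun x => cconj (f x)).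
Proof.
move=> [fr fi]; split => //=.
under eq_fun do rewrite EFinN.
by apply: integrableN fi.
Qed.

Lemma energy_cconj f : energy m (fun x => cconj (f x)) = energy m f.
Proof. by apply: eq_integral => x _; rewrite sqn_cconj. Qed.

Lemma bounded_kernel_cconj : bounded_kernel (fun x y => cconj (k x y)).
Proof.
have [[kr ki] [K kK]] := bk; split.
  by split => //=; exact: measurable_funN.
by exists K => x y; rewrite /= normrN; exact: kK.
Qed.

(** Transforming f with the conjugate kernel amounts to conjugating the transform of the conjugate
    of f. *)
Lemma isometric_cconj : isometric m (fun x y => cconj (k x y)).
Proof.
move=> f fL1 fL2; rewrite -(energy_cconj f) -[RHS]iso; last 2 first.
- exact: cL1_cconj.
- by rewrite energy_cconj.
rewrite -[RHS]energy_cconj; congr energy; apply/funext => y.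
have cf := cL1_cconj fL1; have kf := cL1_kernel y bk cf.
apply: eq_complexP => /=.
  apply: eq_Rintegral => x _; rewrite !ReM /=; ring.
rewrite -mulN1r -RintegralZl//; last by case: kf.
by apply: eq_Rintegral => x _; rewrite !ImM /=; ring.
Qed.

(** The real part of the Hermitian inner product, which is all that expanding the energy of a
    difference involves. *)
Definition inner f g : R := Rintegral m setT (fun x => Re (f x) * Re (g x) + Im (f x) * Im (g x)).

Lemma integrable_sqn f : cmfun f -> (energy m f < +oo)%E ->
  m.-integrable setT (fun x => (sqn (f x))%:E).
Proof.
move=> mf fin; apply: (integrable_ge0 (a := fun x => sqn (f x))) => //.
- by have /measurable_EFinP := measurable_sqn mf.
- by move=> x; exact: sqn_ge0.
Qed.

Lemma integrable_inner f g : cmfun f -> cmfun g -> (energy m f < +oo)%E ->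
  (energy m g < +oo)%E ->
  m.-integrable setT (fun x => (Re (f x) * Re (g x) + Im (f x) * Im (g x))%:E).
Proof.
move=> mf mg ff fg; have [fr fi] := mf; have [gr gi] := mg.
apply: le_integrable (integrableD measurableT (integrable_sqn mf ff) (integrable_sqn mg fg)) => //.
  by apply/measurable_EFinP; apply: measurable_funD; exact: measurable_funM.
move=> x _; rewrite /= lee_fin [leRHS]ger0_norm; last by apply: addr_ge0; exact: sqn_ge0.
rewrite /sqn.
move: (Re (f x)) (Im (f x)) (Re (g x)) (Im (g x)) => a b a' b'.
rewrite ler_norml; apply/andP.
have := sqr_ge0 (a - a'); have := sqr_ge0 (b - b').
have := sqr_ge0 (a + a'); have := sqr_ge0 (b + b').
by split; nra.
Qed.

(** Expansion of the square, with the inner product moved to the left so that no extended real is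
    subtracted. *)
Lemma energyB f g : cmfun f -> cmfun g -> (energy m f < +oo)%E -> (energy m g < +oo)%E ->
  (energy m (fun x => f x - g x)%R + (2 * inner f g)%:E = energy m f + energy m g)%E.
Proof.
move=> mf mg ff fg.
have If := integrable_sqn mf ff; have Ig := integrable_sqn mg fg.
have Ifg := integrable_inner mf mg ff fg.
have I2 := integrableZl measurableT 2 Ifg.
rewrite /inner EFinM EFin_Rintegral// -integralZl// /energy -integralD//; last first.
  apply: integrable_sqn; first exact: cmfunB.
  apply: (@le_lt_trans _ _ (2%:E * energy m f + 2%:E * energy m (fun x => - g x)%R)%E).
    by apply: energyD_le => //; exact: cmfunN.
  rewrite (_ : energy m (fun x => - g x) = energy m g); last first.
    by apply: eq_integral => x _; rewrite sqnN.
  by rewrite lte_add_pinfty// lte_mul_pinfty.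
rewrite -integralD//; apply: eq_integral => x _.
by rewrite -EFinM -!EFinD; congr EFin; rewrite /sqn ReD ImD ReN ImN; ring.
Qed.

Lemma inner_transform f g : cL1 m f -> cL1 m g ->
  inner f (transform m k g) = inner (transform m (fun x y => cconj (k y x)) f) g.
Proof.
move=> fL1 gL1.
have [kr ki] := proj1 bk; have [_ [K kK]] := bk.
have [fr fi] := fL1; have [gr gi] := gL1.
(* The real part of k(x,y) g(x) times the conjugate of f(y), arranged as bounded factors times
   tensor products so that [P] gives the integrability of each summand. *)
pose h (p : T * T) : R := Re (k p.1 p.2) * (Re (g p.1) * Re (f p.2)) +
   - Im (k p.1 p.2) * (Im (g p.1) * Re (f p.2)) +
   (Re (k p.1 p.2) * (Im (g p.1) * Im (f p.2)) + Im (k p.1 p.2) * (Re (g p.1) * Im (f p.2))).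
have P (u v : T -> R) (w : T * T -> R) : measurable_fun setT w -> (forall p, `|w p| <= K) ->
    m.-integrable setT (EFin \o u) -> m.-integrable setT (EFin \o v) ->
    (m \x m)%E.-integrable setT (EFin \o (fun p => w p * (u p.1 * v p.2))).
  move=> mw wK iu iv.
  by apply: (integrable_bddM mw wK); exact: (integrable_prodM iu iv).
have krK (p : T * T) : `|Re (k p.1 p.2)| <= K by case: (kK p.1 p.2).
have kiK (p : T * T) : `|Im (k p.1 p.2)| <= K by case: (kK p.1 p.2).
have kiNK (p : T * T) : `|- Im (k p.1 p.2)| <= K by rewrite normrN.
have iD (u v : T * T -> R) : (m \x m)%E.-integrable setT (EFin \o u) ->
    (m \x m)%E.-integrable setT (EFin \o v) ->
    (m \x m)%E.-integrable setT (EFin \o (fun p => u p + v p)).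
  by move=> iu iv; exact: (integrableD measurableT iu iv).
have ih : (m \x m)%E.-integrable setT (EFin \o h).
  apply: (iD _ _).
    apply: (iD _ _).
      exact: (P (fun x => Re (g x)) (fun x => Re (f x)) (fun p => Re (k p.1 p.2))).
    apply: (P (fun x => Im (g x)) (fun x => Re (f x)) (fun p => - Im (k p.1 p.2))) => //.
    exact: measurable_funN.
  apply: (iD _ _).
    exact: (P (fun x => Im (g x)) (fun x => Im (f x)) (fun p => Re (k p.1 p.2))).
  exact: (P (fun x => Re (g x)) (fun x => Im (f x)) (fun p => Im (k p.1 p.2))).
have [_ e1] := Rintegral12_prod ih.
have [_ e2] := Rintegral21_prod ih.
rewrite /inner.
transitivity (Rintegral m setT (fun y => Rintegral m setT (fun x => h (x, y)))).
  apply: eq_Rintegral => y _; have [i1 i2] := cL1_kernel y bk gL1.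
  rewrite /= -!RintegralZl// -RintegralD//; last 2 first.
  - exact: (integrableZl measurableT _ i1).
  - exact: (integrableZl measurableT _ i2).
  by apply: eq_Rintegral => x _; rewrite /h ReM ImM /=; ring.
rewrite -e2 e1; apply: eq_Rintegral => x _.
have bkc : bounded_kernel (fun x y => cconj (k y x)).
  split; last by exists K => ? ?; rewrite /= normrN; exact: kK.
  have ms : measurable_fun setT (fun p : T * T => (p.2, p.1)).
    by apply/measurable_fun_pairP; split; [exact: measurable_snd|exact: measurable_fst].
  split => /=; first exact: (measurableT_comp kr ms).
  by apply: measurable_funN; exact: (measurableT_comp ki ms).
have [i1 i2] := cL1_kernel x bkc fL1.
rewrite /= -!RintegralZr// -RintegralD//; last 2 first.
- exact: (integrableZr measurableT _ i1).
- exact: (integrableZr measurableT _ i2).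
by apply: eq_Rintegral => y _; rewrite /h ReM ImM /=; ring.
Qed.

End adjoint_kernel.

(** * L^2 norms and the volume of balls *)

Section space_norms.
Context {R : realType} {n : nat}.
Local Notation leb := (lebesgue n : {sigma_finite_measure set (Rn R n) -> \bar R}).
Implicit Types (f g F : Rn R n -> R[i]).

Lemma Lp_norm2E f : Lp_norm 2 f = poweR (energy leb f) 2^-1.
Proof.
rewrite /Lp_norm unlock; congr (poweR _ _); apply: eq_integral => x _.
rewrite gee0_abs ?lee_fin ?normcE ?sqrtr_ge0// poweR_EFin powR_mulrn ?sqrtr_ge0//.
by rewrite sqr_sqrtr// sqn_ge0.
Qed.

Lemma Lp_norm2_le f (c : R) : 0 <= c ->
  (Lp_norm 2 f <= c%:E)%E = (energy leb f <= (c ^+ 2)%:E)%E.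
Proof.
move=> c0; rewrite Lp_norm2E; have := energy_ge0 leb f.
case: (energy leb f) => [e| |] //=; last by rewrite ifF ?leye_eq//; apply/negbTE; rewrite invr_eq0.
rewrite !lee_fin => e0; rewrite powR12_sqrt//.
by rewrite -[in RHS](sqr_sqrtr e0) ler_sqr ?nnegrE ?sqrtr_ge0.
Qed.

Lemma in_Lp2P f : in_Lp 2 f <-> cmfun f /\ (energy leb f < +oo)%E.
Proof.
split=> -[mf fin]; split => //.
  by move: fin; rewrite Lp_norm2E; apply: lty_poweRy; rewrite invr_eq0.
by rewrite Lp_norm2E poweR_lty.
Qed.

Lemma cvg_Lp_norm2P (u : nat -> Rn R n -> R[i]) :
  Lp_norm 2 (u k) @[k --> \oo] --> 0%E <-> energy leb (u k) @[k --> \oo] --> 0%E.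
Proof.
split=> H; apply: cvge0_le => [k|eta eta0].
- exact: energy_ge0.
- have se : 0 < Num.sqrt eta by rewrite sqrtr_gt0.
  have := cvge_near_le (fun k => Lnorm_ge0 _ _ _) H se.
  by apply: filterS => k; rewrite Lp_norm2_le ?sqr_sqrtr// ltW.
- exact: Lnorm_ge0.
- have := cvge_near_le (fun k => energy_ge0 _ _) H (exprn_gt0 2 eta0).
  by apply: filterS => k; rewrite Lp_norm2_le// ltW.
Qed.

Lemma measurable_enorm : measurable_fun setT (enorm : Rn R n -> R).
Proof.
have msqrt : measurable_fun setT (Num.sqrt : R -> R).
  by apply: continuous_measurable_fun; exact: sqrt_continuous.
apply: (measurableT_comp msqrt).
apply: measurable_sum => i.
by apply: measurable_funM; exact: measurable_tnth.
Qed.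

Lemma measurable_ball_enorm (r : R) : measurable [set x : Rn R n | enorm x <= r].
Proof.
have := @measurable_fun_ler _ _ _ setT _ _ measurable_enorm (measurable_cst r).
move=> /(_ measurableT [set true] Logic.I); rewrite setTI.
by congr measurable; apply/funext => x /=; rewrite -[LHS]propeqE; apply/propext.
Qed.

End space_norms.

Section ball_volume.
Context {R : realType}.

(** Enclosing the ball in a cube bounds its volume by a multiple of r^n, and only this power of r
    matters. *)
Definition cube n (r : R) : set (Rn R n) := [set x | forall i, `|tnth x i| <= r].
Arguments cube : clear implicits.

Lemma measurable_cube n r : measurable (cube n r).
Proof.
rewrite (_ : cube n r = \bigcap_(i in [set: 'I_n]) [set x : Rn R n | `|tnth x i| <= r]); last first.
  by apply/seteqP; split => x h i => [_|]; exact: h.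
apply: fin_bigcap_measurable => // i _.
rewrite (_ : [set _ | _] = (fun x => tnth x i) @^-1` `[- r, r]%classic); last first.
  by apply/funext => x; apply/propext; rewrite /= in_itv /= ler_norml.
rewrite -[X in measurable X]setTI.
by apply: (measurable_tnth i) => //; exact: measurable_itv.
Qed.

Lemma lebesgue_cube n (r : R) : 0 <= r -> lebesgue n (cube n r) = ((2 * r) ^+ n)%:E.
Proof.
move=> r0; elim: n => [|n IH].
  rewrite expr0 /= diracE mem_set// => i; by case: i.
rewrite /= /lebesgue_cons /pushforward.
rewrite (_ : _ @^-1` _ = `[- r, r]%classic `*` cube n r); last first.
  apply/seteqP; split => -[a x] /=.
    move=> h; split.
      by have := h ord0; rewrite (tnth_nth 0) /= in_itv /= ler_norml.
    by move=> i; have := h (lift ord0 i); rewrite !(tnth_nth 0).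
  move=> [ha hx] i; case: (unliftP ord0 i) => [j ->|->].
    by have := hx j; rewrite !(tnth_nth 0).
  by move: ha; rewrite (tnth_nth 0) /= in_itv /= ler_norml.
rewrite product_measure1E//; last exact: measurable_cube.
rewrite [X in (_ * X)%E](_ : _ = ((2 * r) ^+ n)%:E)//.
rewrite exprS EFinM [X in (X * _)%E](_ : _ = (2 * r)%:E)//.
have := lebesgue_measure_itv (Interval (BLeft (- r)) (BRight r)) => /= ->; rewrite lte_fin.
case: ltP => [_|rr]; first by rewrite -EFinD opprK; congr (_%:E); ring.
by have -> : r = 0; [lra|rewrite mulr0].
Qed.

Lemma ball_sub_cube n (r : R) : [set x : Rn R n | enorm x <= r] `<=` cube n r.
Proof.
move=> x /= xr i; apply: le_trans xr.
rewrite -sqrtr_sqr /enorm ler_wsqrtr// /dotp (bigD1 i)//= -expr2 lerDl.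
by apply: sumr_ge0 => j _; rewrite -expr2 sqr_ge0.
Qed.

Lemma lebesgue_ball_le n (r : R) : 0 <= r ->
  (lebesgue n [set x : Rn R n | (enorm x <= r)%R] <= ((2 * r) ^+ n)%:E)%E.
Proof.
move=> r0; rewrite -lebesgue_cube//; apply: le_measure.
- by rewrite inE; exact: measurable_ball_enorm.
- by rewrite inE; exact: measurable_cube.
- exact: ball_sub_cube.
Qed.

End ball_volume.

(** * The Fourier-Plancherel transform *)

Section fourier_L2_theory.
Context {R : realType} {n : nat}.
Local Notation leb := (lebesgue n : {sigma_finite_measure set (Rn R n) -> \bar R}).
Local Notation K := (@fourier_kernel R n).
Implicit Types (f g h F G : Rn R n -> R[i]).

Lemma cmfun_if d (T : measurableType d) (b : T -> bool) (f : T -> R[i]) :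
  measurable_fun setT b -> cmfun f -> cmfun (fun x => if b x then f x else 0).
Proof.
move=> mb [fr fi]; split.
- under eq_fun do rewrite (fun_if (@complex.Re R)).
  by apply: measurable_fun_ifT => //; exact: measurable_cst.
- under eq_fun do rewrite (fun_if (@complex.Im R)).
  by apply: measurable_fun_ifT => //; exact: measurable_cst.
Qed.

Lemma sqn_if_le (b : bool) (z : R[i]) : sqn (if b then z else 0) <= sqn z.
Proof. by case: b => //; rewrite /sqn /= expr0n addr0 sqn_ge0. Qed.

Lemma measurable_in_ball (r : R) : measurable_fun setT (fun x : Rn R n => enorm x <= r).
Proof. exact: (measurable_fun_ler measurable_enorm (measurable_cst r)). Qed.

Lemma cmfun_truncate k f : cmfun f -> cmfun (truncate k f).
Proof. by move=> mf; apply: cmfun_if => //; exact: measurable_in_ball. Qed.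

Lemma energy_truncate_le k f : cmfun f -> (energy leb (truncate k f) <= energy leb f)%E.
Proof.
by move=> mf; apply: le_energy => //; [exact: cmfun_truncate|move=> x; exact: sqn_if_le].
Qed.

Lemma energy_truncate_lty k f : cmfun f -> (energy leb f < +oo)%E ->
  (energy leb (truncate k f) < +oo)%E.
Proof. by move=> mf; exact/le_lt_trans/energy_truncate_le. Qed.

(** On a ball, which has finite volume, |a| <= 1 + a^2 puts square-integrable functions in L^1. *)
Lemma cL1_truncate k f : cmfun f -> (energy leb f < +oo)%E -> cL1 leb (truncate k f).
Proof.
move=> mf ff; have [tr ti] := cmfun_truncate k mf.
pose B := [set x : Rn R n | enorm x <= k%:R].
have iB : leb.-integrable setT (EFin \o (\1_B : Rn R n -> R)).
  apply: integrable_ge0 => //.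
    by apply: measurable_indic; exact: measurable_ball_enorm.
  rewrite integral_indic//; last exact: measurable_ball_enorm.
  rewrite setIT; apply: le_lt_trans (ltry _); first exact: lebesgue_ball_le.
have iD := integrableD measurableT iB (integrable_sqn mf ff).
have H (a c : R) : 0 <= c -> `|a| <= `|1 + (a ^+ 2 + c)|.
  move=> c0; rewrite [leRHS]ger0_norm ?addr_ge0 ?sqr_ge0//.
  by rewrite ler_norml; have := sqr_ge0 (a - 1); have := sqr_ge0 (a + 1); nra.
split; apply: le_integrable iD => //; try exact/measurable_EFinP;
  move=> x _; rewrite /= lee_fin /truncate indicE /B.
- case: ifPn => xk /=; last by rewrite normr0.
  by rewrite mem_set//; apply: H => //; exact: sqr_ge0.
- case: ifPn => xk /=; last by rewrite normr0.
  by rewrite mem_set// /sqn [_ ^+ 2 + _]addrC; apply: H => //; exact: sqr_ge0.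
Qed.

Lemma fourier_integralE f : cL1 leb f -> fourier_integral f = transform leb K f.
Proof.
move=> fL1; apply/funext => xi; rewrite /transform /fourier_kernel.
under [in RHS]eq_fun do rewrite -mulrA.
rewrite cintZ//; apply: (cL1_bddM (K := 1)) => //.
  apply: measurable_cexp_i; apply: measurable_funN.
  apply: measurable_sum => i.
  by apply: measurable_funM; [exact: measurable_tnth|exact: measurable_cst].
by move=> x; split; [exact: Re_cexp_i_le1|exact: Im_cexp_i_le1].
Qed.

Lemma energy_fourier_truncate k f : cmfun f -> (energy leb f < +oo)%E ->
  energy leb (transform leb K (truncate k f)) = energy leb (truncate k f).
Proof.
move=> mf ff; apply: isometric_fourier_kernel; first exact: cL1_truncate.
exact: energy_truncate_lty.
Qed.

Lemma cvg_energy_truncate f : cmfun f -> (energy leb f < +oo)%E ->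
  energy leb (fun x => f x - truncate k f x) @[k --> \oo] --> 0%E.
Proof.
move=> mf ff.
have := @dominated_convergence _ _ _ leb setT measurableT
  (fun k x => (sqn (f x - truncate k f x))%:E) (cst 0%E) (fun x => (sqn (f x))%:E).
case.
- by move=> k; apply: measurable_sqn; apply: cmfunB => //; exact: cmfun_truncate.
- exact: measurable_cst.
- apply: aeW => x _; apply: cvg_near_cst.
  near=> k; rewrite /truncate ifT; first by rewrite subrr /sqn /= expr0n addr0.
  by near: k; exact: nbhs_infty_ger.
- exact: integrable_sqn.
- apply: aeW => x k _; rewrite gee0_abs ?lee_fin ?sqn_ge0// /truncate.
  by case: ifP => _; rewrite ?subr0// subrr /sqn /= expr0n addr0 sqn_ge0.
- by move=> _ _; rewrite integral_cst// mul0e.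
Unshelve. all: by end_near. Qed.

Lemma fourier_L2P f F : fourier_L2 f F <->
  [/\ cmfun f /\ (energy leb f < +oo)%E, cmfun F /\ (energy leb F < +oo)%E &
      energy leb (fun xi => F xi - transform leb K (truncate k f) xi) @[k --> \oo] --> 0%E].
Proof.
have E : in_Lp 2 f ->
    (fun k => energy leb (fun xi => F xi - fourier_integral (truncate k f) xi)) =
    (fun k => energy leb (fun xi => F xi - transform leb K (truncate k f) xi)).
  move=> /in_Lp2P[mf ff]; apply/funext => k; congr energy; apply/funext => xi.
  by rewrite fourier_integralE//; exact: cL1_truncate.
split=> [[fL FL /cvg_Lp_norm2P]|[fL FL H]].
- by rewrite E// => H; split => //; exact/in_Lp2P.
- have {}fL : in_Lp 2 f by exact/in_Lp2P.
  by split; [|exact/in_Lp2P|apply/cvg_Lp_norm2P; rewrite E].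
Qed.

Lemma cmfun_fourier_truncate k f : cmfun f -> cmfun (transform leb K (truncate k f)).
Proof.
by move=> mf; apply: cmfun_transform; [exact: bounded_fourier_kernel|exact: cmfun_truncate].
Qed.

(** Shaped for limit arguments: after [energyD_le], an approximation error eta appears as 2 eta. *)
Lemma lee_2energy (x y : \bar R) : (0 <= y)%E ->
  (forall eta : R, (0 < eta)%R -> x <= (2 * eta)%:E + y)%E -> (x <= y)%E.
Proof.
move=> y0 H; apply/lee_addgt0Pr => e e0; rewrite addeC.
have -> : e = 2 * (e / 2) by field.
by apply: H; rewrite divr_gt0.
Qed.

(** Passage to the limit in the isometry for truncations. The factor 2 is the one of [energyD_le];
    the exact isometry would not improve anything beyond the final constant. *)
Lemma fourier_L2_energy f F : fourier_L2 f F -> (energy leb F <= 2%:E * energy leb f)%E.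
Proof.
move=> /fourier_L2P[[mf ff] [mF FF] H].
apply: lee_2energy; first by rewrite mule_ge0// energy_ge0.
move=> eta eta0.
have [k Hk] : exists k, (energy leb (fun xi => F xi - transform leb K (truncate k f) xi)%R <= eta%:E)%E.
  have := cvge_near_le (fun k => energy_ge0 _ _) H eta0.
  by case=> N _ /(_ N (leqnn N)) ?; exists N.
have mt := cmfun_fourier_truncate k mf.
rewrite (_ : F = fun xi => (F xi - transform leb K (truncate k f) xi) + transform leb K (truncate k f) xi); last first.
  by apply/funext => xi; rewrite subrK.
apply: le_trans (energyD_le _ _ _) _ => //; first exact: cmfunB.
apply: leeD; first by rewrite EFinM lee_wpmul2l.
by rewrite lee_wpmul2l// energy_fourier_truncate// energy_truncate_le.
Qed.

Lemma energyN f : energy leb (fun x => - f x) = energy leb f.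
Proof. by apply: eq_integral => x _; rewrite sqnN. Qed.

Lemma energyB_le f g : cmfun f -> cmfun g ->
  (energy leb (fun x => f x - g x)%R <= 2%:E * energy leb f + 2%:E * energy leb g)%E.
Proof.
by move=> mf mg; rewrite -(energyN g); apply: energyD_le => //; exact: cmfunN.
Qed.

Lemma energy_eq0 f : cmfun f -> energy leb f = 0%E -> {ae leb, forall x, f x = 0}.
Proof.
move=> mf f0.
have : ae_eq leb setT (fun x => (sqn (f x))%:E) (cst 0%E).
  apply/ae_eq_integral_abs => //; first exact: measurable_sqn.
  by rewrite -[RHS]f0; apply: eq_integral => x _; rewrite gee0_abs// lee_fin sqn_ge0.
apply: filterS => x /(_ Logic.I) [] /eqP.
rewrite /sqn paddr_eq0 ?sqr_ge0// !sqrf_eq0 => /andP[/eqP r0 /eqP i0].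
exact: eq_complexP.
Qed.

(** Both functions are L^2 limits of the transforms of the same truncations. *)
Lemma fourier_L2_unique f F G : fourier_L2 f F -> fourier_L2 f G ->
  {ae leb, forall xi, F xi = G xi}.
Proof.
move=> /fourier_L2P[[mf ff] [mF FF] HF] /fourier_L2P[_ [mG GG] HG].
have mFG : cmfun (fun xi => F xi - G xi) by exact: cmfunB.
have : energy leb (fun xi => F xi - G xi) = 0%E.
  apply/eqP; rewrite eq_le energy_ge0 andbT; apply: lee_2energy => // eta eta0.
  have e2 : 0 < eta / 2 by rewrite divr_gt0.
  have [k [H1 H2]] : exists k,
      (energy leb (fun xi => F xi - transform leb K (truncate k f) xi)%R <= (eta / 2)%:E)%E /\
      (energy leb (fun xi => G xi - transform leb K (truncate k f) xi)%R <= (eta / 2)%:E)%E.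
    have H := filterI (cvge_near_le (fun k => energy_ge0 _ _) HF e2)
                      (cvge_near_le (fun k => energy_ge0 _ _) HG e2).
    by case: H => N _ /(_ N (leqnn N)) ?; exists N.
  have mt := cmfun_fourier_truncate k mf.
  rewrite (_ : (fun xi => F xi - G xi) = fun xi => (F xi - transform leb K (truncate k f) xi) -
      (G xi - transform leb K (truncate k f) xi)); last first.
    by apply/funext => xi; rewrite opprB addrA subrK.
  apply: le_trans (energyB_le _ _) _; [exact: cmfunB|exact: cmfunB|].
  rewrite adde0 (_ : 2 * eta = 2 * (eta / 2) + 2 * (eta / 2)); last by field.
  by rewrite [leRHS]EFinD; apply: leeD; rewrite [leRHS]EFinM lee_wpmul2l.
move=> /(energy_eq0 mFG); apply: filterS => xi /eqP.
by rewrite subr_eq0 => /eqP.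
Qed.

End fourier_L2_theory.

(** * Surjectivity of the Fourier-Plancherel transform *)

Section fourier_L2_onto.
Context {R : realType} {n : nat}.
Local Notation leb := (lebesgue n : {sigma_finite_measure set (Rn R n) -> \bar R}).
Local Notation K := (@fourier_kernel R n).
Local Notation Kc := (fun x y : Rn R n => cconj (fourier_kernel y x)).
Implicit Types (f g h F G H : Rn R n -> R[i]).

Lemma cL1B f g : cL1 leb f -> cL1 leb g -> cL1 leb (fun x => f x - g x).
Proof.
move=> fL [gr gi]; apply: cL1D => //; split.
- by under eq_fun do rewrite ReN EFinN; apply: integrableN gr.
- by under eq_fun do rewrite ImN EFinN; apply: integrableN gi.
Qed.

Lemma transformB k f g : bounded_kernel k -> cL1 leb f -> cL1 leb g ->
  transform leb k (fun x => f x - g x) = fun y => transform leb k f y - transform leb k g y.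
Proof.
move=> bk fL gL; have := transformD bk (cL1B fL gL) gL.
rewrite (_ : (fun x => f x - g x + g x) = f); last by apply/funext => x; rewrite subrK.
by move=> E; apply/funext => y; rewrite E addrK.
Qed.

(** By this symmetry the adjoint kernel is the conjugate kernel, hence isometric as well. *)
Lemma fourier_kernelC (x y : Rn R n) : fourier_kernel x y = fourier_kernel y x.
Proof.
by rewrite /fourier_kernel /dotp; under eq_bigr do rewrite mulrC.
Qed.

Let KcE : Kc = fun x y => cconj (fourier_kernel x y).
Proof. by apply/funext => x; apply/funext => y; rewrite fourier_kernelC. Qed.

Let bKc : bounded_kernel Kc.
Proof. rewrite KcE; apply: bounded_kernel_cconj; exact: bounded_fourier_kernel. Qed.

Let isoKc : isometric leb Kc.
Proof.
rewrite KcE; apply: isometric_cconj; first exact: bounded_fourier_kernel.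
exact: isometric_fourier_kernel.
Qed.

Let bK := @bounded_fourier_kernel R n.
Let isoK := @isometric_fourier_kernel R n.

(* Parallelogram bookkeeping: the isometry of both kernels and their duality
   turn the error of the truncated inversion formula into the tail of [h]. *)
Let energy_inversion H k : cL1 leb H -> (energy leb H < +oo)%E ->
  let h := transform leb Kc H in
  energy leb (fun xi => H xi - transform leb K (truncate k h) xi) =
  energy leb (fun x => h x - truncate k h x).
Proof.
move=> HL Hfin h.
have mH := cL1_cmfun HL.
have mh : cmfun h by exact: cmfun_transform.
have eh : energy leb h = energy leb H by exact: isoKc.
have hfin : (energy leb h < +oo)%E by rewrite eh.
pose t := truncate k h.
have mt : cmfun t by exact: cmfun_truncate.
have tL : cL1 leb t by exact: cL1_truncate.
have tfin : (energy leb t < +oo)%E by exact: energy_truncate_lty.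
have eT : energy leb (transform leb K t) = energy leb t by exact: isoK.
have mT : cmfun (transform leb K t) by exact: cmfun_transform.
have Tfin : (energy leb (transform leb K t) < +oo)%E by rewrite eT.
have E1 := energyB mH mT Hfin Tfin.
have E2 := energyB mh mt hfin tfin.
rewrite (inner_transform bK HL tL) eT -eh -E2 in E1.
have := congr1 (fun z => z - (2 * inner leb h t)%:E)%E E1.
by rewrite !addeK.
Qed.

(** Truncations of G lie in L^1, so their inverse transforms are honest integrals; by isometry these
    form a Cauchy sequence, and its limit is g. That G is the transform of g follows by comparison
    with one of the approximants. *)
Lemma fourier_L2_onto G : cmfun G -> (energy leb G < +oo)%E ->
  exists g, fourier_L2 g G /\ (energy leb g <= 2%:E * energy leb G)%E.
Proof.
move=> mG Gfin.
(* The rate demanded by [riesz_fischer]. Truncations are taken within [q j / 4], since two such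
   errors, each doubled by [energyB_le], add up to [q j]. *)
pose q (j : nat) : R := 16^-1 ^+ j.
have q0 j : 0 < q j by rewrite exprn_gt0// invr_gt0.
have cG := cvg_energy_truncate mG Gfin.
have ex j : exists N, (energy leb (fun x => G x - truncate N G x)%R <= (q j / 4)%:E)%E.
  have := cvge_near_le (fun k => energy_ge0 _ _) cG (divr_gt0 (q0 j) (ltr0Sn R 3)).
  by case=> N _ /(_ N (leqnn N)) ?; exists N.
pose phi j := projT1 (cid (ex j)).
have phiP j : (energy leb (fun x => G x - truncate (phi j) G x)%R <= (q j / 4)%:E)%E.
  exact: (projT2 (cid (ex j))).
pose Gj j := truncate (phi j) G.
have mGj j : cmfun (Gj j) by exact: cmfun_truncate.
have GjL j : cL1 leb (Gj j) by exact: cL1_truncate.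
have Gjfin j : (energy leb (Gj j) < +oo)%E by exact: energy_truncate_lty.
pose u j := transform leb Kc (Gj j).
have mu_ j : cmfun (u j) by exact: cmfun_transform.
have eu j : energy leb (u j) = energy leb (Gj j) by exact: isoKc.
have ufin j : (energy leb (u j) < +oo)%E by rewrite eu.
have q_le j l : (j <= l)%N -> q l <= q j.
  by move=> jl; apply: ler_wiXn2l => //; rewrite ?invr_ge0// invf_le1// ler1n.
have u_cauchy j l : (j <= l)%N -> (energy leb (fun x => u l x - u j x)%R <= (q j)%:E)%E.
  move=> jl.
  have fin1 : (energy leb (fun x => Gj l x - Gj j x)%R < +oo)%E.
    apply: le_lt_trans (energyB_le (mGj l) (mGj j)) _.
    by rewrite lte_add_pinfty// lte_mul_pinfty.
  rewrite /u -transformB// isoKc//; last exact: cL1B.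
  rewrite (_ : (fun x => Gj l x - Gj j x) =
     fun x => (G x - Gj j x) - (G x - Gj l x)); last first.
    by apply/funext => x; rewrite opprB [RHS]addrC subrKA.
  apply: le_trans (energyB_le _ _) _; [exact: cmfunB|exact: cmfunB|].
  rewrite (_ : q j = 2 * (q j / 4) + 2 * (q j / 4)); last by field.
  rewrite [leRHS]EFinD; apply: leeD; rewrite [leRHS]EFinM lee_wpmul2l//; first exact: phiP.
  apply: le_trans (phiP l) _; rewrite lee_fin ler_wpM2r ?invr_ge0//; exact: q_le.
have [g [mg gu]] := riesz_fischer mu_ u_cauchy.
have q_small (eta : R) : 0 < eta -> exists j, q j <= eta.
  move=> eta0.
  have : q j @[j --> \oo] --> 0.
    by apply: cvg_expr; rewrite ger0_norm ?invr_ge0// invf_lt1// ltr1n.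
  move/cvgr0Pnorm_le => /(_ _ eta0)[N _ /(_ N (leqnn N))].
  by rewrite ger0_norm; [exists N|exact: ltW].
have eg : (energy leb g <= 2%:E * energy leb G)%E.
  apply: lee_2energy; first by rewrite mule_ge0// energy_ge0.
  move=> eta eta0; have [j qj] := q_small _ eta0.
  rewrite (_ : g = fun x => (g x - u j x) + u j x); last by apply/funext => x; rewrite subrK.
  apply: le_trans (energyD_le _ _ _) _ => //; first exact: cmfunB.
  apply: leeD.
    by rewrite EFinM lee_wpmul2l//; apply: le_trans (gu j) _; rewrite lee_fin.
  by rewrite lee_wpmul2l// eu energy_truncate_le.
have gfin : (energy leb g < +oo)%E.
  by apply: le_lt_trans eg _; rewrite lte_mul_pinfty.
exists g; split => //; apply/fourier_L2P; split => //.
apply: cvge0_le => [k|eta eta0]; first exact: energy_ge0.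
(* Three errors will be added: truncating G, inverting at [u j], and replacing [u j] by g. Two
   nested uses of [energyD_le] weight them by 2, 4 and 4, whence 10. *)
have [j qj] := q_small (eta / 10) ltac:(by rewrite divr_gt0).
have eta10 : 0 < eta / 10 by rewrite divr_gt0.
have := cvge_near_le (fun k => energy_ge0 _ _) (cvg_energy_truncate (mu_ j) (ufin j)) eta10.
apply: filterS => k Hk.
(* The tail of [u j], known to be small, equals the error made when its truncation is transformed
   back to [Gj j]. *)
rewrite -energy_inversion// -/(u j) in Hk.
have mT f : cmfun f -> cmfun (transform leb K (truncate k f)) by exact: cmfun_fourier_truncate.
have Tug : (energy leb (fun xi => transform leb K (truncate k (u j)) xi - transform leb K (truncate k g) xi)%R
    <= (q j)%:E)%E.
  rewrite -transformB//; try exact: cL1_truncate.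
  have mgu : cmfun (fun x => g x - u j x) by exact: cmfunB.
  rewrite (_ : (fun x => truncate k (u j) x - truncate k g x) = truncate k (fun x => u j x - g x)); last first.
    by apply/funext => x; rewrite /truncate; case: ifP => // _; rewrite subrr.
  have E : energy leb (fun x => u j x - g x) = energy leb (fun x => g x - u j x).
    by rewrite -energyN; congr energy; apply/funext => x; rewrite opprB.
  have mug : cmfun (fun x => u j x - g x) by exact: cmfunB.
  rewrite energy_fourier_truncate//; last by rewrite E; apply: le_lt_trans (gu j) (ltry _).
  by apply: le_trans (energy_truncate_le _ mug) _; rewrite E.
rewrite (_ : (fun xi => _) = fun xi => (G xi - Gj j xi) +
    ((Gj j xi - transform leb K (truncate k (u j)) xi) +
     (transform leb K (truncate k (u j)) xi - transform leb K (truncate k g) xi))); last first.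
  by apply/funext => xi; rewrite !subrKA.
have m1 : cmfun (fun xi => Gj j xi - transform leb K (truncate k (u j)) xi).
  by apply: cmfunB => //; exact: mT.
have m2 : cmfun (fun xi => transform leb K (truncate k (u j)) xi - transform leb K (truncate k g) xi).
  by apply: cmfunB; exact: mT.
apply: le_trans (energyD_le _ _ _) _; [exact: cmfunB|exact: cmfunD|].
rewrite (_ : eta = 2 * (eta / 10) + 2 * (2 * (eta / 10) + 2 * (eta / 10))); last by field.
rewrite [leRHS]EFinD; apply: leeD; rewrite [leRHS]EFinM lee_wpmul2l//.
  apply: le_trans (phiP j) _; rewrite lee_fin.
  by have := q0 j; lra.
apply: le_trans (energyD_le _ _ _) _; [by []|by []|].
rewrite [leRHS]EFinD; apply: leeD.
  by rewrite [leRHS]EFinM; apply: lee_wpmul2l; [rewrite lee_fin|exact: Hk].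
rewrite [leRHS]EFinM; apply: lee_wpmul2l; first by rewrite lee_fin.
by apply: le_trans Tug _; rewrite lee_fin.
Qed.

End fourier_L2_onto.

(** * Low frequencies *)

Section low_frequency.
Context {R : realType} {n : nat}.
Local Notation leb := (lebesgue n : {sigma_finite_measure set (Rn R n) -> \bar R}).
Local Notation K := (@fourier_kernel R n).
Implicit Types (f g F G : Rn R n -> R[i]).

Definition cutoff (r : R) F xi : R[i] := if enorm xi <= r then F xi else 0.

Lemma cmfun_cutoff r F : cmfun F -> cmfun (cutoff r F).
Proof. by move=> mF; apply: cmfun_if => //; exact: measurable_in_ball. Qed.

Lemma measurable_normc d (T : measurableType d) (f : T -> R[i]) : cmfun f ->
  measurable_fun setT (fun x => Normc.normc (f x)).
Proof.
move=> mf; under eq_fun do rewrite normcE.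
have msqrt : measurable_fun setT (Num.sqrt : R -> R).
  by apply: continuous_measurable_fun; exact: sqrt_continuous.
by apply: (measurableT_comp msqrt); have /measurable_EFinP := measurable_sqn mf.
Qed.

Lemma normc_ge0 (z : R[i]) : 0 <= Normc.normc z.
Proof. by rewrite normcE sqrtr_ge0. Qed.

Lemma energy_cutoff_bounded (r A : R) F : 0 <= r -> cmfun F ->
  (forall xi, sqn (F xi) <= A) ->
  (energy leb (cutoff r F) <= (A * (2 * r) ^+ n)%:E)%E.
Proof.
move=> r0 mF FA; have A0 : 0 <= A by apply: le_trans (FA [tuple 0 | _ < n]); exact: sqn_ge0.
apply: (@le_trans _ _ (A%:E * leb [set x : Rn R n | (enorm x <= r)%R])%E); last first.
  by rewrite EFinM lee_wpmul2l ?lee_fin//; exact: lebesgue_ball_le.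
rewrite -[X in leb X]setIT -integral_indic//; last exact: measurable_ball_enorm.
rewrite -ge0_integralZl//; last first.
  by apply/measurable_EFinP; apply: measurable_indic; exact: measurable_ball_enorm.
apply: ge0_le_integral => //.
- by move=> x _; rewrite lee_fin sqn_ge0.
- by apply: measurable_sqn; exact: cmfun_cutoff.
- apply: emeasurable_funM => //.
  by apply/measurable_EFinP; apply: measurable_indic; exact: measurable_ball_enorm.
- move=> x _; rewrite -EFinM lee_fin /cutoff indicE.
  case: ifPn => xr; first by rewrite mem_set// mulr1.
  by rewrite memNset ?mulr0; [rewrite /sqn /= expr0n addr0|exact/negP].
Qed.

(** The kernel has constant modulus [fourier_const n]; the factor 2 comes from bounding real and
    imaginary parts separately. *)
Lemma sqn_transform_le g (A : R) xi : cL1 leb g ->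
  (\int[leb]_x (Normc.normc (g x))%:E <= A%:E)%E ->
  sqn (transform leb K g xi) <= 2 * (fourier_const n * A) ^+ 2.
Proof.
move=> gL gA.
pose c : R := fourier_const n; have c0 : 0 < c by exact: fourier_const_gt0.
have A0 : 0 <= A by rewrite -lee_fin; apply: le_trans gA; apply: integral_ge0 => x _; rewrite lee_fin normc_ge0.
have mg := cL1_cmfun gL.
have iN : leb.-integrable setT (EFin \o (fun x => Normc.normc (g x))).
  apply: integrable_ge0; [exact: measurable_normc|by move=> x; exact: normc_ge0|].
  exact: le_lt_trans gA (ltry _).
have iu : leb.-integrable setT (EFin \o (fun x => c * Normc.normc (g x))).
  exact: (integrableZl measurableT _ iN).
have kE x : Normc.normc (K x xi * g x) = c * Normc.normc (g x).
  rewrite !normcE !sqnM sqn_cexp_i mulr1 sqn_real sqrtrM ?sqr_ge0//.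
  by rewrite sqrtr_sqr gtr0_norm.
have Hb x : `|Re (K x xi * g x)| <= c * Normc.normc (g x) /\
            `|Im (K x xi * g x)| <= c * Normc.normc (g x).
  by rewrite -kE; split; [exact: Re_normc|exact: Im_normc].
have [hr hi] := cint_le (cL1_kernel xi (bounded_fourier_kernel n) gL) iu Hb.
have IA : Rintegral leb setT (fun x => c * Normc.normc (g x)) <= c * A.
  rewrite RintegralZl// ler_wpM2l ?(ltW c0)//.
  by rewrite -lee_fin EFin_Rintegral.
rewrite /sqn /transform mulrDl !mul1r.
rewrite -(real_normK (num_real (Re _))) -(real_normK (num_real (Im _))).
by rewrite lerD// ler_sqr ?nnegrE ?mulr_ge0 ?(ltW c0)//; apply: le_trans IA.
Qed.

(** With c the normalising constant, this is 2 (2 (2 c^2 2^n) + 2): two nested uses of [energyD_le],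
    around the coefficient 2 c^2 2^n of the bounded transform and the coefficient 1 of the
    square-integrable part. *)
Definition bernstein_const : R := 8 * (fourier_const n ^+ 2 * 2 ^+ n) + 4.

Lemma bernstein_const_gt0 : 0 < bernstein_const.
Proof. by rewrite /bernstein_const ltr_wpDl// mulr_ge0// mulr_ge0 ?sqr_ge0 ?exprn_ge0. Qed.

(* [f] is split at the height [lam]: the large part is in L^1, so its
   transform is bounded; the small part is in L^2.  The choice of [lam]
   balances the two contributions, so no interpolation theorem is needed. *)
Lemma bernstein (m r N : R) f F : 1 <= m -> m < 2 -> 0 < r -> 0 < N ->
  fourier_L2 f F ->
  (\int[leb]_x (Normc.normc (f x) `^ m)%:E <= (N `^ m)%:E)%E ->
  (energy leb (cutoff r F) <=
   (bernstein_const * (r `^ (n%:R * (2 - m) / m) * N ^+ 2))%:E)%E.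
Proof.
move=> m1 m2 r0 N0 fF fm.
have m0 : 0 < m by exact: lt_le_trans ltr01 m1.
have /fourier_L2P[[mf ff] [mF FF] H] := fF.
pose c : R := fourier_const n.
(* The large part has L^1 norm at most lam^(1-m) N^m, hence energy of order r^n lam^(2-2m) N^(2m) on
   the ball; the small part has energy at most lam^(2-m) N^m. The two agree when lam^m = r^n N^m,
   and their common value is [B]. *)
pose lam : R := r `^ (n%:R / m) * N.
have lam0 : 0 < lam by rewrite mulr_gt0// powR_gt0.
have rn0 : 0 < r ^+ n by rewrite exprn_gt0.
pose B := lam ^+ 2 / r ^+ n.
have B0 : 0 < B by rewrite divr_gt0// exprn_gt0.
have -> : r `^ (n%:R * (2 - m) / m) * N ^+ 2 = B.
  rewrite /B /lam exprMn [RHS]mulrAC; congr (_ * _).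
  rewrite -[_ ^+ 2]powR_mulrn ?powR_ge0// -powRrM -[r ^+ n]powR_mulrn ?(ltW r0)// -powRN -powRD; last first.
    by apply/implyP => _; rewrite gt_eqF.
  by congr (_ `^ _); field; rewrite gt_eqF.
have lamm : lam `^ m = r ^+ n * N `^ m.
  rewrite /lam powRM ?powR_ge0 ?(ltW N0)// -powRrM divfK ?gt_eqF//.
  by rewrite powR_mulrn// ltW.
have Nm0 : 0 < N `^ m by rewrite powR_gt0.
(* In units of lam, both splitting estimates compare powers of z / lam: exponent m against 2 below
   the height, and against 1 above it. *)
have wE (z : R) : 0 <= z -> z `^ m = (r ^+ n * N `^ m) * (z / lam) `^ m.
  move=> z0; rewrite -lamm -powRM ?divr_ge0 ?(ltW lam0)//.
  by rewrite mulrC divfK ?gt_eqF.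
pose big x := lam < Normc.normc (f x).
pose f1 x := if big x then f x else 0.
pose small x := Normc.normc (f x) <= lam.
pose f2 x := if small x then f x else 0.
have mbig : measurable_fun setT big.
  apply: measurable_fun_ltr; first exact: measurable_cst.
  exact: measurable_normc.
have mf1 : cmfun f1 by exact: cmfun_if.
have mf2 : cmfun f2.
  apply: cmfun_if => //; apply: measurable_fun_ler; last exact: measurable_cst.
  exact: measurable_normc.
have f1fin : (energy leb f1 < +oo)%E.
  by apply: le_lt_trans ff; apply: le_energy => // x; exact: sqn_if_le.
have f2fin : (energy leb f2 < +oo)%E.
  by apply: le_lt_trans ff; apply: le_energy => // x; exact: sqn_if_le.
have mfm : measurable_fun setT (fun x => (Normc.normc (f x) `^ m)%:E).
  apply/measurable_EFinP; apply: (measurableT_comp (measurable_powR _)).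
  exact: measurable_normc.
have fm0 x : (0 <= (Normc.normc (f x) `^ m)%:E)%E by rewrite lee_fin powR_ge0.
have Hfm (a : R) : 0 <= a -> (\int[leb]_x (a * (Normc.normc (f x) `^ m))%:E <= (a * N `^ m)%:E)%E.
  move=> a0; under eq_integral do rewrite EFinM.
  by rewrite ge0_integralZl// [leRHS]EFinM lee_wpmul2l ?lee_fin.
have E2 : (energy leb f2 <= B%:E)%E.
  have -> : B = lam ^+ 2 / (r ^+ n * N `^ m) * N `^ m.
    by rewrite /B; field; rewrite !gt_eqF.
  have a0 : 0 <= lam ^+ 2 / (r ^+ n * N `^ m).
    by rewrite divr_ge0 ?sqr_ge0// mulr_ge0 ?ltW.
  apply: le_trans (Hfm _ a0); apply: ge0_le_integral => //.
  - by move=> x _; rewrite lee_fin sqn_ge0.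
  - exact: measurable_sqn.
  - apply/measurable_EFinP; apply: measurable_funM; first exact: measurable_cst.
    by move/measurable_EFinP : mfm.
  - move=> x _; rewrite lee_fin /f2 /small; case: ifP => zl; last first.
      by rewrite /sqn /= expr0n addr0 mulr_ge0// powR_ge0.
    rewrite -sqr_normc; move: (Normc.normc (f x)) (normc_ge0 (f x)) zl => z z0 zl.
    rewrite (wE _ z0) mulrA divfK ?gt_eqF ?mulr_gt0//.
    have [->|zn0] := eqVneq z 0.
      by rewrite expr0n mulr_ge0 ?sqr_ge0 ?powR_ge0.
    have zp : 0 < z by rewrite lt_def zn0.
    have -> : z ^+ 2 = lam ^+ 2 * (z / lam) ^+ 2 by field; rewrite gt_eqF.
    rewrite ler_wpM2l ?sqr_ge0// -powR_mulrn; last by rewrite divr_ge0 ?(ltW lam0).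
    rewrite ger_powR//; last exact: ltW.
    by rewrite divr_gt0//= ler_pdivrMr// mul1r.
have E1 : (\int[leb]_x (Normc.normc (f1 x))%:E <= (lam / r ^+ n)%:E)%E.
  have -> : lam / r ^+ n = lam / (r ^+ n * N `^ m) * N `^ m.
    by field; rewrite !gt_eqF.
  have a0 : 0 <= lam / (r ^+ n * N `^ m).
    by rewrite divr_ge0 ?(ltW lam0)// mulr_ge0 ?ltW.
  apply: le_trans (Hfm _ a0); apply: ge0_le_integral => //.
  - by move=> x _; rewrite lee_fin normc_ge0.
  - by apply/measurable_EFinP; exact: measurable_normc.
  - apply/measurable_EFinP; apply: measurable_funM; first exact: measurable_cst.
    by move/measurable_EFinP : mfm.
  - move=> x _; rewrite lee_fin /f1 /big; case: ifP => zl; last first.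
      by rewrite normcE /sqn /= expr0n addr0 sqrtr0 mulr_ge0// powR_ge0.
    move: (Normc.normc (f x)) (normc_ge0 (f x)) zl => z z0 zl.
    rewrite (wE _ z0) mulrA divfK ?gt_eqF ?mulr_gt0//.
    have -> : z = lam * (z / lam) by field; rewrite gt_eqF.
    rewrite ler_wpM2l ?(ltW lam0)//.
    have -> : lam * (z / lam) / lam = z / lam by field; rewrite gt_eqF.
    rewrite -[leLHS]powRr1 ?divr_ge0 ?(ltW lam0)// ler_powR//.
    by rewrite ler_pdivlMr// mul1r ltW.
(* The bound is uniform in the truncation, as needed because the transform of f is only a limit. *)
have E1k k : (energy leb (cutoff r (transform leb K (truncate k f1))) <=
    (2 * (c ^+ 2 * 2 ^+ n) * B)%:E)%E.
  have -> : 2 * (c ^+ 2 * 2 ^+ n) * B = 2 * (c * (lam / r ^+ n)) ^+ 2 * (2 * r) ^+ n.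
    by rewrite /B [(2 * r) ^+ n]exprMn; field; rewrite gt_eqF.
  apply: energy_cutoff_bounded; [exact: ltW|exact: cmfun_fourier_truncate|].
  move=> xi; apply: sqn_transform_le; first exact: cL1_truncate.
  apply: le_trans E1; apply: ge0_le_integral => //.
  - by move=> x _; rewrite lee_fin normc_ge0.
  - by apply/measurable_EFinP; apply: measurable_normc; exact: cmfun_truncate.
  - by apply/measurable_EFinP; exact: measurable_normc.
  - move=> x _; rewrite lee_fin /truncate; case: ifP => // _.
    by rewrite normcE /sqn /= expr0n addr0 sqrtr0 normc_ge0.
apply: lee_2energy; first by rewrite lee_fin mulr_ge0 ?(ltW B0)// ltW// bernstein_const_gt0.
move=> eta eta0.
have [k Hk] : exists k, (energy leb (fun xi => F xi - transform leb K (truncate k f) xi)%R <= eta%:E)%E.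
  have := cvge_near_le (fun k => energy_ge0 _ _) H eta0.
  by case=> j _ /(_ j (leqnn j)) ?; exists j.
pose T1 := transform leb K (truncate k f1).
pose T2 := transform leb K (truncate k f2).
have mT1 : cmfun T1 by exact: cmfun_fourier_truncate.
have mT2 : cmfun T2 by exact: cmfun_fourier_truncate.
have TE : transform leb K (truncate k f) = fun xi => T1 xi + T2 xi.
  rewrite /T1 /T2 -transformD; [|exact: bounded_fourier_kernel|exact: cL1_truncate|exact: cL1_truncate].
  congr transform; apply/funext => x; rewrite /truncate /f1 /f2.
  by rewrite /big /small ltNge; case: ifP => _; case: (_ <= lam); rewrite ?addr0 ?add0r.
rewrite TE in Hk.
pose D xi := F xi - (T1 xi + T2 xi).
have mT12 : cmfun (fun xi => T1 xi + T2 xi) by exact: cmfunD.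
have mD : cmfun D by exact: cmfunB.
have -> : cutoff r F = fun xi => cutoff r D xi + (cutoff r T1 xi + cutoff r T2 xi).
  apply/funext => xi; rewrite /cutoff /D; case: ifP => _; last by rewrite !addr0.
  by rewrite subrK.
apply: le_trans (energyD_le _ _ _) _.
- exact: cmfun_cutoff.
- by apply: cmfunD; exact: cmfun_cutoff.
apply: leeD.
  rewrite EFinM; apply: lee_wpmul2l; first by rewrite lee_fin.
  apply: le_trans Hk; apply: le_energy => //; first exact: cmfun_cutoff.
  by move=> xi; exact: sqn_if_le.
have -> : bernstein_const * B = 2 * (2 * (2 * (c ^+ 2 * 2 ^+ n) * B) + 2 * B).
  by rewrite /bernstein_const -/c; ring.
rewrite EFinM; apply: lee_wpmul2l; first by rewrite lee_fin.
apply: le_trans (energyD_le _ _ _) _; [exact: cmfun_cutoff|exact: cmfun_cutoff|].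
rewrite [leRHS]EFinD; apply: leeD.
  by rewrite [leRHS]EFinM; apply: lee_wpmul2l; [rewrite lee_fin|exact: E1k].
rewrite [leRHS]EFinM; apply: lee_wpmul2l; first by rewrite lee_fin.
apply: (@le_trans _ _ (energy leb T2)).
  by apply: le_energy => //; [exact: cmfun_cutoff|move=> xi; exact: sqn_if_le].
rewrite /T2 energy_fourier_truncate//.
by apply: le_trans E2; exact: energy_truncate_le.
Qed.

End low_frequency.

(** * Dyadic summation over frequencies *)

Section dyadic_sum.
Context {R : realType} {n : nat}.
Local Notation leb := (lebesgue n : {sigma_finite_measure set (Rn R n) -> \bar R}).

(** For x >= 1 the real power is at most an integer power k > |p|, which one term of the exponential
    series controls. *)
Lemma powR_expR_bounded (p c : R) : 0 < c ->
  exists2 C : R, 0 < C & forall x, 1 <= x -> x `^ p * expR (- (c * x)) <= C.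
Proof.
move=> c0; pose k := (Num.truncn `|p|).+1.
have pk : p <= k%:R.
  by apply: le_trans (ler_norm p) _; rewrite ltW// truncnS_gt.
exists (k`!%:R / c ^+ k).
  by rewrite divr_gt0 ?exprn_gt0// ltr0n fact_gt0.
move=> x x1; have x0 : 0 < x by exact: lt_le_trans x1.
have cx0 : 0 <= c * x by rewrite mulr_ge0 ?ltW.
rewrite expRN ler_pdivrMr ?expR_gt0//.
apply: (@le_trans _ _ (x ^+ k)).
  by rewrite -powR_mulrn ?(ltW x0)// ler_powR.
rewrite mulrAC ler_pdivlMr ?exprn_gt0// -exprMn (mulrC x).
rewrite [leRHS]mulrC -ler_pdivrMr; last by rewrite ltr0n fact_gt0.
apply: le_trans (expR_ge1Dxn (Num.truncn `|p|) cx0).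
by rewrite lerDr.
Qed.

Lemma exists_dyadic (y : R) : exists j, y <= 2 ^+ j /\ (j = 0%N \/ 2 ^+ j <= 2 * y).
Proof.
have ex : exists j, y <= 2 ^+ j.
  exists (Num.truncn `|y|).+1; apply: le_trans (ler_norm y) _.
  apply: le_trans (ltW (truncnS_gt _)) _.
  by rewrite -natrX ler_nat ltnW// ltn_expl.
have [j yj jmin] := ex_minnP ex; exists j; split => //.
case: j yj jmin => [|j] yj jmin; [by left|right].
rewrite exprS ler_wpM2l// leNgt; apply/negP => /ltW /jmin.
by rewrite ltnn.
Qed.

(* Dyadic decomposition of the profile: on the shell [y ~ 2^j] the exponential
   beats the power [2^(j (b + 1))]. *)
Lemma dyadic_profile (a b c kap : R) : 0 <= a -> 0 <= b -> 0 < c -> 0 < kap ->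
  exists2 C : R, 0 < C & forall y, 0 <= y -> exists j,
    y <= 2 ^+ j /\ y `^ a * expR (- (c * y `^ kap)) <= C * ((2 ^+ j) `^ (b + 1))^-1.
Proof.
move=> a0 b0 c0 k0.
(* To be applied at y^kap, where the power becomes y^(a + b + 1): the factor y^a of the profile, and
   y^(b + 1) to be traded for 2^(j (b + 1)). *)
have [C1 C10 HC1] := powR_expR_bounded ((a + (b + 1)) / kap) c0.
(* The 1 serves y <= 1, where j = 0; the factor 2^(b+1) comes from 2^j <= 2 y. *)
pose C := Num.max 1 (C1 * 2 `^ (b + 1)).
have C0 : 0 < C by rewrite lt_max ltr01.
exists C => // y y0.
have [y1|y1] := leP y 1.
  exists 0%N; rewrite expr0 powR1 invr1 mulr1; split => //.
  apply: (@le_trans _ _ 1); last by rewrite le_max lexx.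
  rewrite -[leRHS]mulr1 ler_pM ?powR_ge0 ?expR_ge0//.
    have [->|yn0] := eqVneq y 0; first by have [->|an0] := eqVneq a 0; rewrite ?powRr0// powR0.
    by rewrite -(powRr0 y) ger_powR// lt_def yn0 y0.
  by rewrite -expR0 ler_expR oppr_le0 mulr_ge0 ?powR_ge0 ?(ltW c0).
have [j [yj Hj]] := exists_dyadic y; exists j; split => //.
have yp : 0 < y by exact: lt_trans ltr01 y1.
have {}Hj : 2 ^+ j <= 2 * y.
  by case: Hj => // j0; move: yj; rewrite j0 expr0 leNgt y1.
have jp : 0 < (2 ^+ j : R) `^ (b + 1) by rewrite powR_gt0 ?exprn_gt0.
rewrite ler_pdivlMr//.
have yb : (2 ^+ j) `^ (b + 1) <= 2 `^ (b + 1) * y `^ (b + 1).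
  by rewrite -powRM// ge0_ler_powR ?nnegrE ?addr_ge0 ?exprn_ge0 ?mulr_ge0.
apply: (@le_trans _ _ (y `^ a * expR (- (c * y `^ kap)) * (2 `^ (b + 1) * y `^ (b + 1)))).
  by rewrite ler_wpM2l// mulr_ge0 ?powR_ge0 ?expR_ge0.
apply: (@le_trans _ _ (C1 * 2 `^ (b + 1))); last by rewrite le_max lexx orbT.
have yk1 : 1 <= y `^ kap by rewrite -(powRr0 y) ler_powR ?ltW.
have ke : kap * ((a + (b + 1)) / kap) = a + (b + 1).
  by rewrite mulrCA divff ?mulr1 ?gt_eqF.
have := HC1 _ yk1; rewrite -powRrM ke.
rewrite powRD; last by rewrite (gt_eqF yp) /= implybT.
move=> H; rewrite (_ : _ * _ = (y `^ a * y `^ (b + 1) * expR (- (c * y `^ kap))) * 2 `^ (b + 1)).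
  by rewrite ler_wpM2r ?powR_ge0// mulrC.
ring.
Qed.

Let sum_half (D : R) : 0 <= D ->
  (\sum_(j <oo) (D * (2 ^+ j)^-1)%:E <= (2 * D)%:E)%E.
Proof.
move=> D0.
rewrite (eq_eseriesr (g := fun j => (2 * D / (2 ^ j.+1)%:R)%:E)); last first.
  move=> j _; congr EFin; rewrite natrX exprS; field.
  by rewrite expf_neq0.
by apply: (epsilon_trick0 xpredT); rewrite mulr_ge0.
Qed.

(** On the ball of radius 2^j tau the energy is at most A (2^j tau)^b, while the profile supplies
    2^(-j (b + 1)); the product leaves a summable 2^(-j). Balls may replace disjoint shells because
    at each frequency a single term of the series already dominates the integrand. *)
Lemma weighted_energy_le (a b c kap : R) : 0 <= a -> 0 <= b -> 0 < c -> 0 < kap ->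
  exists2 C : R, 0 < C & forall (F : Rn R n -> R[i]) (A T : R),
    cmfun F -> 0 <= A -> 0 < T ->
    (forall r, 0 < r -> (energy leb (cutoff r F) <= (A * r `^ b)%:E)%E) ->
    (\int[leb]_xi (enorm xi `^ a * expR (- (c * (enorm xi `^ kap * T))) * sqn (F xi))%:E
      <= (C * T `^ (- ((a + b) / kap)) * A)%:E)%E.
Proof.
move=> a0 b0 c0 k0; have [C C0 HC] := dyadic_profile a0 b0 c0 k0.
exists (2 * C) => [|F A T mF A0 T0 HF]; first by rewrite mulr_gt0.
(* The frequency at which r^kap T = 1; measuring frequencies in this unit removes T from the
   exponential. *)
pose tau := T `^ (- kap^-1).
have tau0 : 0 < tau by rewrite powR_gt0.
have tauT : tau `^ kap * T = 1.
  rewrite /tau -powRrM mulNr mulVf ?gt_eqF// powR_inv1 ?(ltW T0)// mulVf// gt_eqF//.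
pose r j := 2 ^+ j * tau.
have r0 j : 0 < r j by rewrite mulr_gt0 ?exprn_gt0.
pose q j := tau `^ a * (C * ((2 ^+ j) `^ (b + 1))^-1).
have q0 j : 0 <= q j by rewrite !mulr_ge0 ?powR_ge0 ?invr_ge0 ?powR_ge0 ?(ltW C0).
have mcut j : cmfun (cutoff (r j) F) by exact: cmfun_cutoff.
have mq j : measurable_fun setT (fun xi => (q j)%:E * (sqn (cutoff (r j) F xi))%:E)%E.
  by apply: emeasurable_funM => //; exact: measurable_sqn.
have pq j xi : (0 <= (q j)%:E * (sqn (cutoff (r j) F xi))%:E)%E.
  by rewrite mule_ge0// lee_fin ?sqn_ge0.
apply: (@le_trans _ _ (\int[leb]_xi (\sum_(j <oo) ((q j)%:E * (sqn (cutoff (r j) F xi))%:E)))%E).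
  apply: ge0_le_integral => //.
  - by move=> xi _; rewrite lee_fin !mulr_ge0 ?powR_ge0 ?expR_ge0 ?sqn_ge0.
  - apply/measurable_EFinP; apply: measurable_funM; last by have /measurable_EFinP := measurable_sqn mF.
    apply: measurable_funM.
      exact: (measurableT_comp (measurable_powR _) measurable_enorm).
    apply: (measurableT_comp (@measurable_expR R)); apply: measurable_funN.
    apply: measurable_funM; first exact: measurable_cst.
    apply: measurable_funM; last exact: measurable_cst.
    exact: (measurableT_comp (measurable_powR _) measurable_enorm).
  - by apply: (ge0_emeasurable_sum (P := xpredT)) => // j xi _ _.
  - move=> xi _.
    pose y := enorm xi / tau.
    have y0 : 0 <= y by rewrite divr_ge0 ?sqrtr_ge0 ?(ltW tau0).
    have [j [yj Hj]] := HC y y0.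
    apply: (@le_trans _ _ ((q j)%:E * (sqn (cutoff (r j) F xi))%:E)%E); last first.
      apply: le_trans (nneseries_lim_ge j.+1 _) => //.
      by rewrite big_nat_recr//= leeDr// sume_ge0.
    rewrite /cutoff ifT; last by rewrite /r -ler_pdivrMr.
    rewrite -EFinM lee_fin ler_wpM2r ?sqn_ge0//.
    have xiE : enorm xi = tau * y by rewrite /y mulrC divfK// gt_eqF.
    rewrite xiE !(powRM _ (ltW tau0) y0) -(mulrA (tau `^ a)) /q ler_wpM2l ?powR_ge0//.
    by rewrite (mulrAC (tau `^ kap)) tauT mul1r.
rewrite integral_nneseries//.
pose D := tau `^ a * C * (tau `^ b * A).
have D0 : 0 <= D by rewrite !mulr_ge0 ?powR_ge0 ?(ltW C0).
apply: (@le_trans _ _ (\sum_(j <oo) (D * (2 ^+ j)^-1)%:E)%E).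
  apply: lee_nneseries => j _; first by move=> _; exact: integral_ge0.
  rewrite ge0_integralZl_EFin//; [|by move=> x _; rewrite lee_fin sqn_ge0|exact: measurable_sqn].
  apply: (@le_trans _ _ ((q j)%:E * (A * r j `^ b)%:E)%E).
    by apply: lee_wpmul2l; [rewrite lee_fin|exact: (HF _ (r0 j))].
  rewrite -EFinM lee_fin /q /D /r powRM ?exprn_ge0 ?(ltW tau0)//.
  have jn0 : (2 ^+ j : R) != 0 by rewrite expf_neq0.
  rewrite powRD; last by rewrite jn0 implybT.
  rewrite powRr1 ?exprn_ge0// le_eqVlt; apply/orP; left; apply/eqP.
  have : (2 ^+ j : R) `^ b != 0 by rewrite gt_eqF// powR_gt0// exprn_gt0.
  move: ((2 ^+ j : R) `^ b) => u u0; field; by rewrite jn0 u0.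
apply: le_trans (sum_half D0) _.
rewrite lee_fin /D (_ : T `^ _ = tau `^ a * tau `^ b); last first.
  rewrite /tau -!powRrM -powRD; last by rewrite (gt_eqF T0) /= implybT.
  by congr (_ `^ _); field; rewrite gt_eqF.
by rewrite le_eqVlt; apply/orP; left; apply/eqP; ring.
Qed.

End dyadic_sum.

(** * Decay at a fixed frequency *)

Section exponential_decay.
Context {R : realType}.
Implicit Types (L V W Th : R -> R).

Let is_derive_mul (f g : R -> R) (t a b : R) :
  is_derive t (1 : R) f a -> is_derive t (1 : R) g b ->
  is_derive t (1 : R) (fun x => f x * g x) (a * g t + f t * b).
Proof.
move=> fa gb; have h : is_derive t (1 : R) (fun x => f x * g x) _ := is_deriveM fa gb.
by apply: (is_derive_eq h); rewrite addrC /GRing.scale/= (mulrC (g t)).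
Qed.

Let is_derive_add (f g : R -> R) (t a b : R) :
  is_derive t (1 : R) f a -> is_derive t (1 : R) g b ->
  is_derive t (1 : R) (fun x => f x + g x) (a + b).
Proof. by move=> fa gb; exact: (is_deriveD fa gb). Qed.

(** The product exp(c t) L(t) does not increase. Only one-sided continuity is known at 0, so the
    mean value theorem is used on [x, t] and x then tends to 0 from the right. *)
Lemma gronwall_decay L (dL : R -> R) c : 0 <= c ->
  (forall t : R, 0 < t -> is_derive t (1 : R) L (dL t)) ->
  (forall t : R, 0 < t -> dL t <= - c * L t) ->
  L t @[t --> 0^'+] --> L 0 ->
  forall t, 0 <= t -> L t <= expR (- (c * t)) * L 0.
Proof.
move=> c0 dLP dLle L0 t; rewrite le_eqVlt => /predU1P[<-|t0].
  by rewrite mulr0 oppr0 expR0 mul1r.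
pose f (x : R) : R := expR (c * x) * L x.
pose df (x : R) : R := (expR (c * x) * c) * L x + expR (c * x) * dL x.
have dexp (x : R) : is_derive x (1 : R) (fun y => expR (c * y)) (expR (c * x) * c).
  apply: (@is_derive1_comp R expR (fun y => c * y)).
  apply: (is_derive_eq (is_derive_mul (is_derive_cst c x 1) (is_derive_id x 1))).
  by rewrite mul0r add0r mulr1.
have dfP (x : R) : 0 < x -> is_derive x (1 : R) f (df x).
  by move=> x0; exact: (is_derive_mul (dexp x) (dLP x x0)).
have dfle (x : R) : 0 < x -> df x <= 0.
  move=> x0; rewrite /df -mulrA -mulrDr mulr_ge0_le0 ?expR_ge0//.
  by have := dLle x x0; lra.
suff : f t <= f 0.
  by rewrite /f mulr0 expR0 mul1r [in X in _ -> X]mulrC expRN ler_pdivlMr ?expR_gt0// mulrC.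
have f0 : f x @[x --> 0^'+] --> f 0.
  apply: cvgM => //; apply: cvg_at_right_filter.
  apply: (continuous_comp (g := expR)); last exact: continuous_expR.
  exact: mulrl_continuous.
apply: (cvgr_to_ge f0); near=> x.
have x0 : 0 < x by [].
have xt : x <= t by near: x; exact: nbhs_right_le.
have fx (y : R) : y \in `]x, t[%R -> is_derive y (1 : R) f (df y).
  by rewrite in_itv/= => /andP[xy _]; apply: dfP; exact: lt_trans xy.
have cf : {within `[x, t], continuous f}.
  apply: derivable_within_continuous => y; rewrite in_itv/= => /andP[xy _].
  by have [] := dfP y (lt_le_trans x0 xy).
have [y yxt fE] := MVT_segment xt fx cf.
rewrite -subr_le0 fE mulr_le0_ge0 ?subr_ge0//; apply: dfle.
by move: yxt; rewrite in_itv/= => /andP[xy _]; exact: lt_le_trans xy.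
Unshelve. all: by end_near. Qed.

Let norm_mul_le (x y : R) : `|x * y| <= (x ^+ 2 + y ^+ 2) / 2.
Proof.
have := (sqr_ge0 (x + y), sqr_ge0 (x - y)); rewrite !expr2 => -[? ?].
by rewrite ler_norml; apply/andP; split; lra.
Qed.

Section real_system.
Variables (V W Th : R -> R) (p q : R).
Hypothesis (p0 : 0 <= p) (q0 : 0 <= q).
Hypothesis dV : forall t : R, 0 < t -> is_derive t (1 : R) V (q * W t).
Hypothesis dW : forall t : R, 0 < t -> is_derive t (1 : R) W (- q * V t + q * Th t - p * W t).
Hypothesis dTh : forall t : R, 0 < t -> is_derive t (1 : R) Th (- q * Th t - q * W t).
Hypothesis V0 : V t @[t --> 0^'+] --> V 0.
Hypothesis W0 : W t @[t --> 0^'+] --> W 0.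
Hypothesis Th0 : Th t @[t --> 0^'+] --> Th 0.

(** The plain energy dissipates only 2 p W^2 + 2 q Th^2. The term a Th W adds a dissipation a q W^2
    that does not depend on p, and b V W adds b q V^2, the only damping of V. *)
Let lyapunov (a b t : R) : R :=
  V t * V t + W t * W t + Th t * Th t + a * (Th t * W t) + b * (V t * W t).

Let lyapunov_cvg a b : lyapunov a b t @[t --> 0^'+] --> lyapunov a b 0.
Proof.
apply: cvgD; last by apply: cvgM; [exact: cvg_cst|exact: cvgM].
apply: cvgD; last by apply: cvgM; [exact: cvg_cst|exact: cvgM].
by apply: cvgD; [apply: cvgD|]; exact: cvgM.
Qed.

Let dlyapunov a b (t : R) : 0 < t -> is_derive t (1 : R) (lyapunov a b)
  (- 2 * p * (W t * W t) - 2 * q * (Th t * Th t)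
   + a * ((- q * Th t - q * W t) * W t + Th t * (- q * V t + q * Th t - p * W t))
   + b * (q * W t * W t + V t * (- q * V t + q * Th t - p * W t))).
Proof.
move=> t0.
have dZ (k : R) f (d : R) : is_derive t (1 : R) f d -> is_derive t (1 : R) (fun x => k * f x) (k * d).
  move=> fd; apply: (is_derive_eq (is_derive_mul (is_derive_cst k t 1) fd)).
  by rewrite mul0r add0r.
have [v w th] := And3 (dV t0) (dW t0) (dTh t0).
have h := is_derive_add (is_derive_add (is_derive_add (is_derive_add
  (is_derive_mul v v) (is_derive_mul w w)) (is_derive_mul th th))
  (dZ a _ _ (is_derive_mul th w))) (dZ b _ _ (is_derive_mul v w)).
by apply: (is_derive_eq h); ring.
Qed.

(* For [p <= q] both the [W]-damping and the coupling act at rate [q]; for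
   [q <= p] the overdamped mode relaxes at rate [eps * q] only. *)
Lemma real_system_decay (eps : R) : 0 <= eps <= 1 -> eps * p <= q ->
  forall t, 0 <= t -> V t ^+ 2 + W t ^+ 2 + Th t ^+ 2 <=
    2 * (expR (- (eps * q / 40 * t)) * (V 0 ^+ 2 + W 0 ^+ 2 + Th 0 ^+ 2)).
Proof.
move=> /andP[e0 e1] epq.
have c0 : 0 <= eps * q / 40 by rewrite !mulr_ge0// invr_ge0.
(* With |a| + |b| <= 1/2 the functional lies between 3/4 and 5/4 of the energy, and the ratio 5/3 is
   below the factor 2 claimed. *)
suff [a [b [ab lyle]]] : exists a b, `|a| + `|b| <= 1 / 2 /\ forall v w th : R,
    - 2 * p * (w * w) - 2 * q * (th * th)
      + a * ((- q * th - q * w) * w + th * (- q * v + q * th - p * w))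
      + b * (q * w * w + v * (- q * v + q * th - p * w)) <=
    - (eps * q / 40) * (v * v + w * w + th * th + a * (th * w) + b * (v * w)).
  move=> t t0.
  have H : lyapunov a b t <= expR (- (eps * q / 40 * t)) * lyapunov a b 0.
    apply: (gronwall_decay c0 (L := lyapunov a b)) t0.
    - by move=> x; exact: dlyapunov.
    - by move=> x _; exact: lyle.
    - exact: lyapunov_cvg.
  have cross (v w th : R) :
      `|a * (th * w) + b * (v * w)| <= 1 / 4 * (v ^+ 2 + w ^+ 2 + th ^+ 2).
    have prod (x y : R) : `|x * y| <= (v ^+ 2 + w ^+ 2 + th ^+ 2) / 2 ->
      forall k, `|k * (x * y)| <= `|k| * ((v ^+ 2 + w ^+ 2 + th ^+ 2) / 2).
      by move=> xy k; rewrite normrM ler_wpM2l.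
    have h1 : `|th * w| <= (v ^+ 2 + w ^+ 2 + th ^+ 2) / 2.
      by apply: le_trans (norm_mul_le _ _) _; move: (sqr_ge0 v); lra.
    have h2 : `|v * w| <= (v ^+ 2 + w ^+ 2 + th ^+ 2) / 2.
      by apply: le_trans (norm_mul_le _ _) _; move: (sqr_ge0 th); lra.
    apply: le_trans (ler_normD _ _) _.
    have := lerD (prod _ _ h1 a) (prod _ _ h2 b); rewrite -mulrDl => /le_trans; apply.
    rewrite (_ : 1 / 4 * _ = 1 / 2 * ((v ^+ 2 + w ^+ 2 + th ^+ 2) / 2)); last by field.
    by rewrite ler_wpM2r// divr_ge0// !addr_ge0 ?sqr_ge0.
  have /ler_normlP[c1 _] := cross (V t) (W t) (Th t).
  have /ler_normlP[_ c2] := cross (V 0) (W 0) (Th 0).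
  have ex0 := expR_ge0 (- (eps * q / 40 * t)).
  move: H; rewrite /lyapunov; move: (expR _) ex0 => E E0 H.
  have K0 : 0 <= V 0 ^+ 2 + W 0 ^+ 2 + Th 0 ^+ 2 by rewrite !addr_ge0 ?sqr_ge0.
  have Kt : 0 <= V t ^+ 2 + W t ^+ 2 + Th t ^+ 2 by rewrite !addr_ge0 ?sqr_ge0.
  have := ler_wpM2l E0 c2; have := mulr_ge0 E0 K0; move: H c1 Kt; rewrite !expr2; lra.
have [pq|qp] := leP p q.
  (* The gain a q W^2 must absorb the loss b q W^2 caused by the V W term, so b is taken well below
     a. *)
  exists (1 / 4), (1 / 16); split; first by rewrite !ger0_norm; lra.
  move=> v w th; have qp0 : 0 <= q - p by rewrite subr_ge0.
  have e10 : 0 <= (1 - eps) * q by rewrite mulr_ge0// subr_ge0.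
  (* Affine in [(p, q)]: sums of squares at the extreme rays [p = 0] and [p = q]. *)
  rewrite -subr_ge0 (_ : _ - _ =
    (q - p) * (3 / 128 * (v + 4 * th) ^+ 2 + 39 / 320 * (w + th) ^+ 2 + (v - w) ^+ 2 / 1280
      + 17 / 1280 * v ^+ 2 + 51 / 1280 * w ^+ 2 + 393 / 320 * th ^+ 2)
    + p * (3 / 128 * (v + 4 * th) ^+ 2 + 79 / 320 * (w + th) ^+ 2 + 13 / 1280 * (v + 3 * w) ^+ 2
      + v ^+ 2 / 256 + 467 / 256 * w ^+ 2 + 353 / 320 * th ^+ 2)
    + (1 - eps) * q / 40 * ((th + w) ^+ 2 / 8 + (v + w) ^+ 2 / 32
      + 31 / 32 * v ^+ 2 + 27 / 32 * w ^+ 2 + 7 / 8 * th ^+ 2)); last by field.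
  by do ![assumption|exact: ler0n|rewrite invr_ge0; exact: ler0n|exact: sqr_ge0|apply: mulr_ge0|apply: addr_ge0].
(* Here p already damps W. The term b p V W has to be absorbed by p W^2 and b q V^2, which requires
   b of order at most q/p; the hypothesis eps p <= q grants this for b = eps/2. *)
exists 0, (eps / 2); split; first by rewrite normr0 add0r ger0_norm ?divr_ge0//; lra.
move=> v w th.
have eq0 : 0 <= eps * q by rewrite mulr_ge0.
have epp : eps * q <= p by apply: le_trans (ltW qp); rewrite -[leRHS]mul1r ler_wpM2r.
have eqq : 0 <= 1 - eps by rewrite subr_ge0.
have e2 : 0 <= 1 - eps ^+ 2 by rewrite subr_ge0 exprn_ile1.
rewrite -subr_ge0 (_ : _ - _ =
  p / 2 * (w + eps * v / 2) ^+ 2 + eps / 8 * (q - eps * p) * v ^+ 2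
  + 3 / 2 * (p - eps * q) * w ^+ 2 + 2 * (q * (1 - eps)) * th ^+ 2
  + eps * q * ((v - eps * w) ^+ 2 / 160 + (1 - eps ^+ 2) * w ^+ 2 / 160 + (v - 2 * th) ^+ 2 / 8
    + 31 / 32 * w ^+ 2 + 7 / 32 * v ^+ 2 + 59 / 40 * th ^+ 2)); last by field.
by do ![assumption|rewrite subr_ge0; assumption|exact: ler0n|rewrite invr_ge0; exact: ler0n|exact: sqr_ge0|apply: mulr_ge0|apply: addr_ge0].
Qed.

End real_system.
End exponential_decay.

(** * Decay of the Fourier-transformed thermoelastic system *)

Section thermoelastic_system.
Context {R : realType}.
Implicit Types (sigma r t : R) (U W Th : R -> R[i]).

Definition decay_exponent sigma : R := if sigma < 1 then 2 * (2 - sigma) else 2.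

Lemma decay_exponent_gt0 sigma : 0 < decay_exponent sigma.
Proof. by rewrite /decay_exponent; case: ifPn => // s1; rewrite mulr_gt0//; lra. Qed.

Definition symbol_rate sigma r : R := if r <= 1 then r `^ decay_exponent sigma else 1.

(** For r > 0 the weight is min(1, q/p) with q = r^2 and p = r^(2 sigma); which term is smaller
    depends on the position of r and sigma relative to 1. For r >= 1 and sigma >= 1 the resulting
    rate r^(2 (2 - sigma)) is at least 1 because sigma <= 2. *)
Lemma symbol_rate_le sigma r : 0 <= sigma <= 2 -> 0 <= r ->
  exists eps, [/\ 0 <= eps <= 1, eps * r `^ (2 * sigma) <= r ^+ 2 &
                  symbol_rate sigma r <= eps * r ^+ 2].
Proof.
move=> /andP[s0 s2] r0.
(* At r = 0 the convention 0^0 = 1 excludes a positive weight when sigma = 0; the rate vanishes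
   there anyway. *)
have [->|rn0] := eqVneq r 0.
  exists 0; rewrite !mul0r expr2 mul0r lexx ler01; split => //.
  by rewrite /symbol_rate ler01 powR0// gt_eqF// decay_exponent_gt0.
have rp : 0 < r by rewrite lt_def rn0 r0.
have r2 : r ^+ 2 = r `^ 2 by rewrite powR_mulrn.
have powRD' x y : r `^ x * r `^ y = r `^ (x + y) by rewrite powRD// rn0 implybT.
have powR_le1 x : r <= 1 -> 0 <= x -> r `^ x <= 1.
  by move=> r1 x0; rewrite -(powRr0 r) ger_powR// rp r1.
have powR_ge1 x : 1 <= r -> 0 <= x -> 1 <= r `^ x.
  by move=> r1 x0; rewrite -[leLHS](powRr0 r) ler_powR.
rewrite r2 /symbol_rate /decay_exponent; case: (leP r 1) => [r1|/ltW r1].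
- have [s1|s1] := ltP sigma 1.
    exists (r `^ (2 * (1 - sigma))); rewrite powR_ge0 !powRD'.
    have -> : 2 * (1 - sigma) + 2 * sigma = 2 by ring.
    have -> : 2 * (1 - sigma) + 2 = 2 * (2 - sigma) by ring.
    by split=> //; apply: powR_le1 => //; lra.
  exists 1; rewrite ler01 lexx !mul1r; split => //.
  by rewrite ger_powR ?rp//; lra.
- have [s1|s1] := ltP sigma 1.
    exists 1; rewrite ler01 lexx !mul1r; split => //; last exact: powR_ge1.
    by rewrite ler_powR//; lra.
  exists (r `^ (- (2 * (sigma - 1)))); rewrite powR_ge0 !powRD'.
  have -> : - (2 * (sigma - 1)) + 2 * sigma = 2 by ring.
  split => //.
    by rewrite -[leRHS](powRr0 r) ler_powR//; lra.
  by apply: powR_ge1 => //; lra.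
Qed.

(** All coefficients are real, so real and imaginary parts solve the same real system with V = r^2
    U. In the proof [P] stands for either part. *)
Lemma fourier_system_decay sigma r U W Th : 0 <= sigma <= 2 -> 0 <= r ->
  (forall t, 0 < t -> fourier_system sigma r U W Th t) ->
  right_continuous0 U -> right_continuous0 W -> right_continuous0 Th ->
  forall t, 0 <= t ->
    sqn ((r ^+ 2)%:C * U t) + sqn (W t) + sqn (Th t) <=
    2 * (expR (- (symbol_rate sigma r / 40 * t)) *
         (sqn ((r ^+ 2)%:C * U 0) + sqn (W 0) + sqn (Th 0))).
Proof.
move=> s02 r0 sys [rU iU] [rW iW] [rTh iTh] t t0.
have [eps [e01 ep eq]] := symbol_rate_le s02 r0.
have p0 : 0 <= r `^ (2 * sigma) by exact: powR_ge0.
have q0 : 0 <= r ^+ 2 by exact: sqr_ge0.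
have dZ (k : R) (f : R -> R) (x d : R) : is_derive x (1 : R) f d ->
    is_derive x (1 : R) (fun y => k * f y) (k * d).
  move=> fd; have h : is_derive x (1 : R) (fun y => k * f y) _ := is_deriveZ k fd.
  by apply: (is_derive_eq h).
have reZ (k : R) (z : R[i]) : Re (k%:C * z) = k * Re z by rewrite ReM /= mul0r subr0.
have imZ (k : R) (z : R[i]) : Im (k%:C * z) = k * Im z by rewrite ImM /= mul0r addr0.
have decay (P : R[i] -> R) (PD : forall z w, P (z + w) = P z + P w)
    (PZ : forall (k : R) z, P (k%:C * z) = k * P z)
    (Pder : forall (f : R -> R[i]) x z, has_cderive f x z ->
       is_derive x (1 : R) (fun y => P (f y)) (P z)) :
    P (U x) @[x --> 0^'+] --> P (U 0) -> P (W x) @[x --> 0^'+] --> P (W 0) ->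
    P (Th x) @[x --> 0^'+] --> P (Th 0) ->
    (r ^+ 2 * P (U t)) ^+ 2 + P (W t) ^+ 2 + P (Th t) ^+ 2 <=
    2 * (expR (- (eps * r ^+ 2 / 40 * t)) *
      ((r ^+ 2 * P (U 0)) ^+ 2 + P (W 0) ^+ 2 + P (Th 0) ^+ 2)).
  move=> cU cW cTh.
  have P0 : P 0 = 0 by have := PZ 0 0; rewrite mulr0 mul0r.
  apply: (@real_system_decay _ (fun x => r ^+ 2 * P (U x)) (fun x => P (W x))
    (fun x => P (Th x)) (r `^ (2 * sigma)) (r ^+ 2)) => //.
  - move=> x x0; have [Wt [Tht [dU _ _ _ _]]] := sys x x0.
    exact: dZ (Pder _ _ _ dU).
  - move=> x x0; have [Wt [Tht [_ dW _ E _]]] := sys x x0.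
    apply: (is_derive_eq (Pder _ _ _ dW)).
    have := congr1 P E; rewrite /= !PD P0 -rmorphXn/= !PZ => h.
    move: h; move: (P Wt) (P (U x)) (P (Th x)) (P (W x)) => a b c d h.
    by apply/eqP; rewrite -subr_eq0 -h; apply/eqP; ring.
  - move=> x x0; have [Wt [Tht [_ _ dTh _ E]]] := sys x x0.
    apply: (is_derive_eq (Pder _ _ _ dTh)).
    have := congr1 P E; rewrite /= !PD P0 -!mulNr -!rmorphN/= !PZ => h.
    move: h; move: (P Tht) (P (Th x)) (P (W x)) => a b c h.
    by apply/eqP; rewrite -subr_eq0 -h; apply/eqP; ring.
  - by apply: cvgM => //; exact: cvg_cst.
have dre := decay (fun z => Re z) (@ReD _) reZ (fun _ _ _ => @proj1 _ _) rU rW rTh.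
have dim := decay (fun z => Im z) (@ImD _) imZ (fun _ _ _ => @proj2 _ _) iU iW iTh.
have sqnE z : sqn z = Re z ^+ 2 + Im z ^+ 2 by [].
rewrite !sqnE !reZ !imZ.
apply: (@le_trans _ _ (2 * (expR (- (eps * r ^+ 2 / 40 * t)) *
  ((r ^+ 2 * Re (U 0)) ^+ 2 + (r ^+ 2 * Im (U 0)) ^+ 2 +
     (Re (W 0) ^+ 2 + Im (W 0) ^+ 2) + (Re (Th 0) ^+ 2 + Im (Th 0) ^+ 2))))).
  move: dre dim; move: (expR _) => E; lra.
rewrite ler_wpM2l// ler_wpM2r ?addr_ge0 ?sqr_ge0//.
rewrite ler_expR lerN2 ler_wpM2r// ler_wpM2r ?invr_ge0//.
Qed.

End thermoelastic_system.

(** * Weighted energy estimates for the initial data *)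

Section decay.
Context {R : realType} {n : nat}.
Variables (sigma s m : R).
Hypotheses (s_ge0 : 0 <= s) (m_ge1 : 1 <= m) (m_lt2 : m < 2).
Local Notation leb := (lebesgue n : {sigma_finite_measure set (Rn R n) -> \bar R}).
Local Notation gam := (decay_rate sigma n m s).
Local Notation kap := (decay_exponent sigma).

Definition decay_profile (t r : R) : R := r `^ (2 * s) * expR (- (symbol_rate sigma r / 40 * t)).
Let bracket (r : R) : R := (1 + r ^+ 2) `^ (s / 2).

(** Identifies the exponent produced by [weighted_energy_le] for a = 2 s and b = n (2 - m) / m; the
    right-hand side is doubled because energies are squares. *)
Lemma decay_rateE : (2 * s + n%:R * (2 - m) / m) / kap = 2 * gam.
Proof.
have m0 : m != 0 by rewrite gt_eqF// (lt_le_trans _ m_ge1).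
rewrite /decay_exponent /decay_rate; case: ifPn => s1; last by field.
by field; rewrite m0 andbT gt_eqF//; lra.
Qed.

Let decay_profile_ge0 t r : 0 <= decay_profile t r.
Proof. by rewrite mulr_ge0 ?powR_ge0 ?expR_ge0. Qed.

(** For r <= 1 the rate is r^kap <= 1, so passing from t to 1 + t costs at most exp(1/40). For r > 1
    the factor exp(-t/40) beats any power of 1 + t, and r^(2 s) is at most the squared Sobolev
    weight. *)
Let decay_profile_le : exists2 C : R, 0 < C & forall t r, 0 <= t -> 0 <= r ->
  decay_profile t r <= C * (r `^ (2 * s) * expR (- (40^-1 * (r `^ kap * (1 + t)))))
                 + C * (1 + t) `^ (- (2 * gam)) * bracket r ^+ 2.
Proof.
have c0 : 0 < 40^-1 :> R by rewrite invr_gt0.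
have [C C0 HC] := powR_expR_bounded (2 * gam) c0.
pose D := expR 40^-1 : R; have D0 : 0 < D by exact: expR_gt0.
(* D is the cost of replacing t by 1 + t in the exponential, C bounds (1 + t)^(2 gam) exp(-(1 +
   t)/40); the sum serves both ranges of r. *)
exists (D + C * D); first by rewrite addr_gt0// mulr_gt0.
move=> t r t0 r0; rewrite /decay_profile /symbol_rate.
have T1 : 1 <= 1 + t by rewrite lerDl.
have T0 : 0 < 1 + t by exact: lt_le_trans T1.
have E0 := @expR_ge0 R.
have P0 := @powR_ge0 R.
have K0 : 0 <= D + C * D by rewrite addr_ge0 ?mulr_ge0 ?(ltW D0) ?(ltW C0).
case: (leP r 1) => r1.
  apply: le_trans (_ : D * (r `^ (2 * s) * expR (- (40^-1 * (r `^ kap * (1 + t))))) <= _).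
    rewrite mulrCA ler_wpM2l// -expRD ler_expR.
    have rk : r `^ kap <= 1.
      have [->|rn0] := eqVneq r 0; first by rewrite powR0// gt_eqF// decay_exponent_gt0.
      by rewrite -(powRr0 r) ger_powR ?(ltW (decay_exponent_gt0 _))// lt_def rn0 r0 r1.
    rewrite mulrDr mulr1 mulrDr; move: rk; move: (r `^ kap) => x x1; lra.
  rewrite -[leLHS]addr0 lerD//.
    by rewrite ler_wpM2r ?mulr_ge0// lerDl mulr_ge0 ?ltW.
  by rewrite mulr_ge0 ?sqr_ge0// mulr_ge0.
apply: le_trans (_ : C * D * (1 + t) `^ (- (2 * gam)) * bracket r ^+ 2 <= _).
  rewrite mulrC ler_pM//.
    rewrite powRN ler_pdivlMr ?powR_gt0// mulrC.
    have := HC _ T1; rewrite mulrDr mulr1 opprD expRD => H.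
    rewrite mul1r -ler_pdivrMr// -mulrA; apply: le_trans H.
    by rewrite (expRN 40^-1) -/D (mulrC D^-1).
  rewrite /bracket -powR_mulrn// -powRrM divfK//.
  have -> : s = 2 * s / 2 by rewrite mulrAC divff ?mul1r.
  have -> : r `^ (2 * (2 * s / 2)) = (r ^+ 2) `^ (2 * s / 2).
    by rewrite -powR_mulrn// -powRrM.
  by rewrite ge0_ler_powR ?nnegrE ?divr_ge0 ?mulr_ge0 ?addr_ge0 ?sqr_ge0// lerDr.
rewrite -[leLHS]add0r lerD ?mulr_ge0//.
by rewrite ler_wpM2r ?sqr_ge0// ler_wpM2r// lerDr ltW.
Qed.

Let measurable_bracket : measurable_fun setT (fun xi : Rn R n => bracket (enorm xi)).
Proof.
apply: (measurableT_comp (measurable_powR _)).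
apply: measurable_funD; first exact: measurable_cst.
by apply: measurable_funX; exact: measurable_enorm.
Qed.

(** The strict bound produces a competitor in the infimum; the transform of f used there agrees
    almost everywhere with F by uniqueness. The 2 is that of [fourier_L2_energy]. *)
Lemma sobolev_norm_energy (M : R) (f F : Rn R n -> R[i]) : 0 < M ->
  fourier_L2 f F -> (sobolev_norm s f < M%:E)%E ->
  (energy leb (fun xi => (((1 + enorm xi ^+ 2) `^ (s / 2))%:C * F xi)%R) <= (2 * M ^+ 2)%:E)%E.
Proof.
move=> M0 fF /ereal_inf_lt[_ [g [F' fF' gG] <-]] gM.
have mF : cmfun F by case: fF => _ [].
have mG : cmfun (fun xi => ((1 + enorm xi ^+ 2) `^ (s / 2))%:C * F' xi) by case: gG => _ [].
have mG' : cmfun (fun xi => ((1 + enorm xi ^+ 2) `^ (s / 2))%:C * F xi).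
  by apply: cmfunM => //; apply: cmfun_real; exact: measurable_bracket.
rewrite [leLHS](_ : _ = energy leb (fun xi => ((1 + enorm xi ^+ 2) `^ (s / 2))%:C * F' xi)).
  apply: le_trans (fourier_L2_energy gG) _.
  rewrite EFinM; apply: lee_wpmul2l => //.
  by rewrite -Lp_norm2_le ?ltW.
rewrite /energy; apply: ae_eq_integral => //.
- exact: measurable_sqn.
- exact: measurable_sqn.
- by apply: filterS (fourier_L2_unique fF fF') => xi -> _.
Qed.

Lemma Lp_norm_powR (M : R) (f : Rn R n -> R[i]) : (Lp_norm m f < M%:E)%E ->
  (\int[leb]_x (Normc.normc (f x) `^ m)%:E <= (M `^ m)%:E)%E.
Proof.
move=> fM; have m0 : 0 < m by exact: lt_le_trans m_ge1.
have := @poweR_Lnorm _ _ _ leb (fun x => (Normc.normc (f x))%:E) m (lt0r_neq0 m0).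
rewrite [X in _ = X -> _](_ : _ = \int[leb]_x (Normc.normc (f x) `^ m)%:E)%E; last first.
  by apply: eq_integral => x _; rewrite /= ger0_norm ?normc_ge0.
move=> <-; rewrite -poweR_EFin; apply: (gt0_ler_poweR (ltW m0)).
- by rewrite in_itv/= Lnorm_ge0 leey.
- by rewrite in_itv/= leey andbT (le_trans (Lnorm_ge0 _ _ _) (ltW fM)).
- exact: ltW.
Qed.

Lemma measurable_decay_profile (t : R) :
  measurable_fun setT (fun xi : Rn R n => decay_profile t (enorm xi)).
Proof.
have mrate : measurable_fun setT (fun r : R => symbol_rate sigma r).
  apply: measurable_fun_if => //.
  - by apply: measurable_fun_ler => //; exact: measurable_cst.
  - exact: measurable_funTS (measurable_powR _).
apply: measurable_funM.
  exact: (measurableT_comp (measurable_powR _) measurable_enorm).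
apply: (measurableT_comp (@measurable_expR R)); apply: measurable_funN.
apply: measurable_funM; last exact: measurable_cst.
apply: measurable_funM; last exact: measurable_cst.
exact: (measurableT_comp mrate measurable_enorm).
Qed.

Lemma decay_profile_energy_le : exists2 C : R, 0 < C &
  forall (f F : Rn R n -> R[i]) (M t : R), 0 < M -> 0 <= t -> fourier_L2 f F ->
    (sobolev_norm s f < M%:E)%E -> (Lp_norm m f < M%:E)%E ->
    (\int[leb]_xi (decay_profile t (enorm xi) * sqn (F xi))%:E
      <= (C * (1 + t) `^ (- (2 * gam)) * M ^+ 2)%:E)%E.
Proof.
have [C C0 HC] := decay_profile_le.
have m0 : 0 < m by exact: lt_le_trans m_ge1.
have a0 : 0 <= 2 * s by rewrite mulr_ge0.
have b0 : 0 <= n%:R * (2 - m) / m by rewrite divr_ge0 ?(ltW m0)// mulr_ge0// subr_ge0 ltW.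
have c0 : 0 < 40^-1 :> R by rewrite invr_gt0.
have [K K0 HK] := @weighted_energy_le R n _ _ _ _ a0 b0 c0 (decay_exponent_gt0 sigma).
pose B := @bernstein_const R n; have B0 : 0 < B := bernstein_const_gt0.
exists (C * (K * B) + C * 2); first by rewrite addr_gt0// !mulr_gt0.
move=> f F M t M0 t0 fF sM LM.
have T0 : 0 < 1 + t by rewrite (lt_le_trans ltr01)// lerDl.
have mF : cmfun F by case: fF => _ [].
pose A := B * M ^+ 2; have A0 : 0 <= A by rewrite mulr_ge0 ?sqr_ge0 ?(ltW B0).
have cut r : 0 < r -> (energy leb (cutoff r F) <= (A * r `^ (n%:R * (2 - m) / m))%:E)%E.
  move=> r0; apply: le_trans (bernstein m_ge1 m_lt2 r0 M0 fF (Lp_norm_powR LM)) _.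
  by rewrite lee_fin /A -/B mulrA (mulrAC B) lexx.
have low := HK F A (1 + t) mF A0 T0 cut.
have high := sobolev_norm_energy M0 fF sM.
pose Tg := (1 + t) `^ (- (2 * gam)).
have Tg0 : 0 <= Tg by exact: powR_ge0.
pose phi xi := enorm xi `^ (2 * s) * expR (- (40^-1 * (enorm xi `^ kap * (1 + t)))) * sqn (F xi).
pose psi (xi : Rn R n) := sqn ((bracket (enorm xi))%:C * F xi).
have phi0 xi : 0 <= phi xi by rewrite mulr_ge0 ?sqn_ge0// mulr_ge0 ?powR_ge0 ?expR_ge0.
have psi0 xi : 0 <= psi xi by exact: sqn_ge0.
have msqF : measurable_fun setT (fun xi => sqn (F xi)).
  by have /measurable_EFinP := measurable_sqn mF.
have mphi : measurable_fun setT phi.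
  apply: measurable_funM => //; apply: measurable_funM.
    exact: (measurableT_comp (measurable_powR _) measurable_enorm).
  apply: (measurableT_comp (@measurable_expR R)); apply: measurable_funN.
  apply: measurable_funM; first exact: measurable_cst.
  apply: measurable_funM; last exact: measurable_cst.
  exact: (measurableT_comp (measurable_powR _) measurable_enorm).
have mpsi : measurable_fun setT psi.
  by apply/measurable_EFinP/measurable_sqn; apply: cmfunM => //; exact: cmfun_real.
apply: (@le_trans _ _ (\int[leb]_xi (C%:E * (phi xi)%:E + (C * Tg)%:E * (psi xi)%:E)))%E.
  apply: ge0_le_integral => //.
  - by move=> xi _; rewrite lee_fin mulr_ge0 ?sqn_ge0 ?decay_profile_ge0.
  - by apply/measurable_EFinP; apply: measurable_funM => //; exact: measurable_decay_profile.
  - by apply: emeasurable_funD; apply: emeasurable_funM => //; exact/measurable_EFinP.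
  - move=> xi _; rewrite -!EFinM -EFinD lee_fin /phi /psi sqnM sqn_real !mulrA -mulrDl.
    rewrite ler_wpM2r ?sqn_ge0//; have := HC t (enorm xi) t0 (sqrtr_ge0 _).
    by rewrite !mulrA.
rewrite ge0_integralD//; last 4 first.
- by move=> xi _; rewrite mule_ge0 ?lee_fin ?(ltW C0) ?phi0.
- by apply: emeasurable_funM => //; exact/measurable_EFinP.
- by move=> xi _; rewrite mule_ge0 ?lee_fin ?mulr_ge0 ?(ltW C0) ?psi0.
- by apply: emeasurable_funM => //; exact/measurable_EFinP.
have scale (k : R) (g : Rn R n -> R) : 0 <= k -> (forall xi, 0 <= g xi) -> measurable_fun setT g ->
    (\int[leb]_xi (k%:E * (g xi)%:E) = k%:E * \int[leb]_xi (g xi)%:E)%E.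
  by move=> k0 g0 mg; apply: ge0_integralZl_EFin => //; [move=> x _; rewrite lee_fin|exact/measurable_EFinP].
rewrite !scale ?mulr_ge0 ?(ltW C0)//.
rewrite [X in (_ <= X%:E)%E](_ : _ = C * (K * Tg * A) + C * Tg * (2 * M ^+ 2)); last first.
  by rewrite /A -/Tg; ring.
rewrite EFinD; apply: leeD.
  by rewrite EFinM; apply: lee_wpmul2l; [rewrite lee_fin ltW|rewrite /Tg -decay_rateE].
by rewrite [leRHS]EFinM; apply: lee_wpmul2l; [rewrite lee_fin mulr_ge0// ltW|].
Qed.

End decay.

(** * Decay of solutions *)

Section solution_decay.
Context {R : realType} {n : nat}.
Local Notation leb := (lebesgue n : {sigma_finite_measure set (Rn R n) -> \bar R}).
Implicit Types (f g u v w th F U W Th : Rn R n -> R[i]).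

Lemma multiplier_norm_ge0 (a : Rn R n -> R) f : (0 <= multiplier_norm a f)%E.
Proof. by apply: le_ereal_inf_tmp => _ [g _ <-]; exact: Lnorm_ge0. Qed.

(** The infimum is bounded only once a function with transform |xi|^s F exists; the one from
    [fourier_L2_onto] has energy at most 2 K^2 <= (2 K)^2. *)
Lemma homogeneous_sobolev_norm_le (s K : R) f F : 0 <= K -> fourier_L2 f F ->
  (\int[leb]_xi (enorm xi `^ (2 * s) * sqn (F xi))%:E <= (K ^+ 2)%:E)%E ->
  (homogeneous_sobolev_norm s f <= (2 * K)%:E)%E.
Proof.
move=> K0 fF FK; have mF : cmfun F by case: fF => _ [].
pose G xi := (enorm xi `^ s)%:C * F xi.
have mG : cmfun G.
  apply: cmfunM => //; apply: cmfun_real.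
  exact: (measurableT_comp (measurable_powR _) measurable_enorm).
have {}FK : (energy leb G <= (K ^+ 2)%:E)%E.
  apply: le_trans FK; rewrite le_eqVlt; apply/orP; left; apply/eqP.
  rewrite /energy; apply: eq_integral => xi _; rewrite /G sqnM sqn_real.
  by rewrite -powR_mulrn ?powR_ge0// -powRrM (mulrC 2).
have [g [gG gK]] := fourier_L2_onto mG (le_lt_trans FK (ltry _)).
apply: (@le_trans _ _ (Lp_norm 2 g)).
  by apply: ereal_inf_lbound; exists g => //; exists F.
rewrite Lp_norm2_le ?mulr_ge0//; apply: le_trans gK _.
apply: (@le_trans _ _ (2%:E * (K ^+ 2)%:E)%E); first exact: lee_wpmul2l.
by rewrite -EFinM lee_fin exprMn ler_wpM2r ?sqr_ge0// expr2; lra.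
Qed.

Lemma A_norm_lt (m s : R) v w th (M : \bar R) : (A_norm m s v w th < M)%E ->
  [/\ (sobolev_norm s v < M)%E /\ (Lp_norm m v < M)%E,
      (sobolev_norm s w < M)%E /\ (Lp_norm m w < M)%E &
      (sobolev_norm s th < M)%E /\ (Lp_norm m th < M)%E].
Proof.
have H0 f : (0 <= Hs_Lm_norm m s f)%E.
  by rewrite /Hs_Lm_norm adde_ge0 ?multiplier_norm_ge0 ?Lnorm_ge0.
have split f : (Hs_Lm_norm m s f < M)%E -> (sobolev_norm s f < M)%E /\ (Lp_norm m f < M)%E.
  move=> fM; split; apply: le_lt_trans fM; rewrite /Hs_Lm_norm.
    exact: (leeDl _ (Lnorm_ge0 _ _ _)).
  exact: (leeDr _ (multiplier_norm_ge0 _ _)).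
rewrite /A_norm => H.
have vw : (Hs_Lm_norm m s v + Hs_Lm_norm m s w < M)%E.
  exact: le_lt_trans (leeDl _ (H0 th)) H.
split; apply: split.
- exact: le_lt_trans (leeDl _ (H0 w)) vw.
- exact: le_lt_trans (leeDr _ (H0 v)) vw.
- exact: le_lt_trans (leeDr _ (adde_ge0 (H0 v) (H0 w))) H.
Qed.

(** The data enter through a real M strictly above their norm: strictness yields competitors in the
    infima, and M > 0 is required by the splitting height of [bernstein], so vanishing data need no
    separate case. *)
Lemma solution_decay (sigma s m : R) : 0 <= sigma <= 2 -> 0 <= s -> 1 <= m -> m < 2 ->
  exists2 C : R, 0 < C &
    forall u0 v0 w0 th0 U0 W0 Th0, fourier_state u0 v0 w0 th0 U0 W0 Th0 ->
    forall (u v w th : R -> Rn R n -> R[i]), solution sigma U0 W0 Th0 u v w th ->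
    forall M t : R, 0 < M -> 0 <= t -> (A_norm m s v0 w0 th0 < M%:E)%E ->
      (homogeneous_sobolev_norm s (v t) + homogeneous_sobolev_norm s (w t)
         + homogeneous_sobolev_norm s (th t)
       <= (C * (1 + t) `^ (- decay_rate sigma n m s) * M)%:E)%E.
Proof.
move=> s02 s0 m1 m2; have [C C0 HC] := @decay_profile_energy_le R n sigma s m s0 m1 m2.
(* The squared norm of a component is bounded with 6 C, a factor 2 from the frequencywise decay
   times three initial components; 6 C <= (6 C + 1)^2 avoids a square root. The 6 of the witness is
   three components times the 2 of [homogeneous_sobolev_norm_le]. *)
pose K := 6 * C + 1; have K0 : 0 < K by rewrite addr_gt0// mulr_gt0.
exists (6 * K); first by rewrite mulr_gt0.
move=> u0 v0 w0 th0 U0 W0 Th0 [_ fV0 fW0 fTh0] u v w th [U [W [Th [st sys]]]] M t M0 t0.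
move=> /A_norm_lt[[sv Lv] [sw Lw] [sth Lth]].
have [_ fV fW fTh] := st t t0.
have BV := HC _ _ _ _ M0 t0 fV0 sv Lv.
have BW := HC _ _ _ _ M0 t0 fW0 sw Lw.
have BTh := HC _ _ _ _ M0 t0 fTh0 sth Lth.
pose T (g : R) := (1 + t) `^ g : R.
pose prof := decay_profile sigma s t.
pose Y0 xi := (enorm xi ^+ 2)%:C * U0 xi.
have prof0 r : 0 <= prof r by rewrite mulr_ge0 ?powR_ge0 ?expR_ge0.
have mprof : measurable_fun setT (fun xi : Rn R n => prof (enorm xi)).
  exact: measurable_decay_profile.
have msqn F : cmfun F -> measurable_fun setT (fun xi => sqn (F xi)).
  by move=> mF; apply/measurable_EFinP/measurable_sqn.
have mps f F : fourier_L2 f F -> measurable_fun setT (fun xi => prof (enorm xi) * sqn (F xi)).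
  by move=> [_ [mF _] _]; apply: measurable_funM => //; exact: msqn.
have mV0 : measurable_fun setT (fun xi => prof (enorm xi) * sqn (Y0 xi)) by exact: mps fV0.
have mW0 := mps _ _ fW0; have mTh0 := mps _ _ fTh0.
have ps0 F xi : 0 <= prof (enorm xi) * sqn (F xi) by rewrite mulr_ge0 ?sqn_ge0.
have component f F : fourier_L2 f F ->
    {ae leb, forall xi, sqn (F xi) <=
       2 * (expR (- (symbol_rate sigma (enorm xi) / 40 * t)) *
            (sqn (Y0 xi) + sqn (W0 xi) + sqn (Th0 xi)))} ->
    (homogeneous_sobolev_norm s f <= (2 * (K * T (- decay_rate sigma n m s) * M))%:E)%E.
  move=> fF Fle; have mF : cmfun F by case: fF => _ [].
  apply: homogeneous_sobolev_norm_le fF _; first by rewrite !mulr_ge0 ?powR_ge0 ?(ltW K0) ?(ltW M0).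
  apply: (@le_trans _ _ (\int[leb]_xi (2%:E * ((prof (enorm xi) * sqn (Y0 xi))%:E +
      (prof (enorm xi) * sqn (W0 xi))%:E + (prof (enorm xi) * sqn (Th0 xi))%:E)))%E).
    apply: ae_ge0_le_integral => //.
    - by move=> xi _; rewrite lee_fin mulr_ge0 ?powR_ge0 ?sqn_ge0.
    - apply/measurable_EFinP; apply: measurable_funM; last exact: msqn.
      exact: (measurableT_comp (measurable_powR _) measurable_enorm).
    - by move=> xi _; rewrite -!EFinD -EFinM lee_fin mulr_ge0// !addr_ge0.
    - apply: emeasurable_funM => //; apply/measurable_EFinP.
      by apply: measurable_funD; [apply: measurable_funD|].
    - apply: filterS Fle => xi Hxi _; rewrite -!EFinD -EFinM lee_fin -!mulrDr /prof /decay_profile.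
      apply: le_trans (ler_wpM2l (powR_ge0 _ _) Hxi) _.
      by rewrite le_eqVlt; apply/orP; left; apply/eqP; ring.
  rewrite ge0_integralZl_EFin//; last 2 first.
  - by move=> xi _; rewrite -!EFinD lee_fin !addr_ge0.
  - by apply: emeasurable_funD; [apply: emeasurable_funD|]; exact/measurable_EFinP.
  rewrite ge0_integralD//; last 4 first.
  - by move=> xi _; rewrite -!EFinD lee_fin !addr_ge0.
  - by apply: emeasurable_funD; exact/measurable_EFinP.
  - by move=> xi _; rewrite lee_fin.
  - exact/measurable_EFinP.
  rewrite ge0_integralD//; last 4 first.
  - by move=> xi _; rewrite lee_fin.
  - exact/measurable_EFinP.
  - by move=> xi _; rewrite lee_fin.
  - exact/measurable_EFinP.
  apply: le_trans (lee_wpmul2l _ (leeD (leeD BV BW) BTh)) _ => //.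
  rewrite -!EFinD -EFinM lee_fin.
  have -> : (1 + t) `^ (- (2 * decay_rate sigma n m s)) = T (- decay_rate sigma n m s) ^+ 2.
    by rewrite /T -[RHS]powR_mulrn ?powR_ge0// -powRrM mulNr mulrC.
  rewrite [leLHS](_ : _ = 6 * C * (T (- decay_rate sigma n m s) * M) ^+ 2); last by ring.
  rewrite -(mulrA K) [leRHS]exprMn ler_wpM2r ?sqr_ge0//.
  by rewrite /K expr2; move: C0 (mulr_gt0 C0 C0); lra.
have decay : {ae leb, forall xi,
    sqn ((enorm xi ^+ 2)%:C * U t xi) + sqn (W t xi) + sqn (Th t xi) <=
    2 * (expR (- (symbol_rate sigma (enorm xi) / 40 * t)) *
         (sqn (Y0 xi) + sqn (W0 xi) + sqn (Th0 xi)))}.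
  apply: filterS sys => xi [sysxi [cU cW cTh] [U0E W0E Th0E]].
  rewrite /Y0 -U0E -W0E -Th0E.
  exact: (fourier_system_decay s02 (sqrtr_ge0 _) sysxi cU cW cTh).
apply: (@le_trans _ _ ((2 * (K * T (- decay_rate sigma n m s) * M))%:E +
  (2 * (K * T (- decay_rate sigma n m s) * M))%:E +
  (2 * (K * T (- decay_rate sigma n m s) * M))%:E)%E).
  apply: leeD; [apply: leeD|].
  - apply: component fV _; apply: filterS decay => xi; apply: le_trans.
    by rewrite -addrA lerDl addr_ge0 ?sqn_ge0.
  - apply: component fW _; apply: filterS decay => xi; apply: le_trans.
    by rewrite addrAC lerDr addr_ge0 ?sqn_ge0.
  - apply: component fTh _; apply: filterS decay => xi; apply: le_trans.
    by rewrite lerDr addr_ge0 ?sqn_ge0.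
rewrite -!EFinD lee_fin -/(T _) le_eqVlt; apply/orP; left; apply/eqP; ring.
Qed.

End solution_decay.

Theorem theorem4p2 (R : realType) (n : nat) (sigma s m : R)
    (n_ge1 : (1 <= n)%N) (sigma_range : 0 <= sigma <= 2) (s_ge0 : 0 <= s)
    (m_range : 1 <= m < 2) :
  exists2 C : R, 0 < C &
    forall (u0 D2u0 u1 theta0 U0 U1 Theta0 : Rn R n -> R[i]),
      fourier_state u0 D2u0 u1 theta0 U0 U1 Theta0 ->
      in_A m s D2u0 u1 theta0 ->
    forall (u D2u ut theta : R -> Rn R n -> R[i]),
      solution sigma U0 U1 Theta0 u D2u ut theta ->
    forall t : R, 0 <= t ->
      (homogeneous_sobolev_norm s (D2u t) + homogeneous_sobolev_norm s (ut t)
         + homogeneous_sobolev_norm s (theta t)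
       <= (C * (1 + t) `^ (- decay_rate sigma n m s))%:E
          * A_norm m s D2u0 u1 theta0)%E.
Proof.
move: m_range => /andP[m1 m2].
have [C C0 HC] := @solution_decay R n sigma s m sigma_range s_ge0 m1 m2.
exists C => // u0 v0 w0 th0 U0 W0 Th0 st [[v1 [_ v2]] [w1 [_ w2]] [th1 [_ th2]]] u v w th sol t t0.
have A0 : (0 <= A_norm m s v0 w0 th0)%E.
  by rewrite /A_norm /Hs_Lm_norm !adde_ge0 ?multiplier_norm_ge0 ?Lnorm_ge0.
have Hoo (f : Rn R n -> R[i]) : (sobolev_norm s f < +oo -> Lp_norm m f < +oo -> Hs_Lm_norm m s f < +oo)%E.
  by move=> a b; exact: (lte_add_pinfty a b).
have Aoo : (A_norm m s v0 w0 th0 < +oo)%E.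
  exact: (lte_add_pinfty (lte_add_pinfty (Hoo _ v1 v2) (Hoo _ w1 w2)) (Hoo _ th1 th2)).
have /fineK AE : A_norm m s v0 w0 th0 \is a fin_num by rewrite ge0_fin_numE.
have T0 : 0 < C * (1 + t) `^ (- decay_rate sigma n m s).
  by rewrite mulr_gt0// powR_gt0// (lt_le_trans ltr01)// lerDl.
(* M exceeds the norm of the data by exactly the amount that becomes e after multiplication by the
   decay factor; e is arbitrary. *)
apply/lee_addgt0Pr => e e0; rewrite -AE -EFinM -EFinD.
pose a := fine (A_norm m s v0 w0 th0).
have a0 : 0 <= a by exact: fine_ge0.
pose M := a + e / (C * (1 + t) `^ (- decay_rate sigma n m s)).
have aM : a < M by rewrite ltrDl divr_gt0.
have AM : (A_norm m s v0 w0 th0 < M%:E)%E by rewrite -AE lte_fin.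
apply: le_trans (HC _ _ _ _ _ _ _ st _ _ _ _ sol M t (le_lt_trans a0 aM) t0 AM) _.
by rewrite lee_fin /M mulrDr mulrCA divff ?mulr1 ?gt_eqF.
Qed.
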